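(* Let $J$ be a Jordan algebra of compact operators on a complex Banach space $\mathcal{X}$ (a linear subspace of compact operators with $a\circ b:=ab+ba\in J$ for all $a,b\in J$), and suppose $J$ has a nonzero Jordan ideal $I$ (a linear subspace $I\subseteq J$ with $a\circ b\in I$ for all $a\in J$, $b\in I$) consisting of Volterra (compact quasinilpotent) operators. Then $J$ is reducible, i.e. there is a closed subspace of $\mathcal{X}$ other than $0$ and $\mathcal{X}$ invariant under every operator in $J$. *)

(* Defs.v *)
From Stdlib Require Import Reals.
Open Scope R_scope.

Record C := mkC { Cre : R; Cim : R }.
Definition C0 : C := mkC 0 0.
Definition C1 : C := mkC 1 0.
Definition Cadd (a b : C) : C := mkC (Cre a + Cre b) (Cim a + Cim b).
Definition Cmul (a b : C) : C :=
  mkC (Cre a * Cre b - Cim a * Cim b) (Cre a * Cim b + Cim a * Cre b).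
Definition Copp (a : C) : C := mkC (- Cre a) (- Cim a).
Definition Cabs (a : C) : R := sqrt (Cre a ^ 2 + Cim a ^ 2).

Record CBanach := {
  carrier :> Type;
  vzero : carrier;
  vadd : carrier -> carrier -> carrier;
  vopp : carrier -> carrier;
  vscal : C -> carrier -> carrier;
  vnorm : carrier -> R;
  vadd_assoc : forall x y z, vadd x (vadd y z) = vadd (vadd x y) z;
  vadd_comm : forall x y, vadd x y = vadd y x;
  vadd_0 : forall x, vadd x vzero = x;
  vadd_opp : forall x, vadd x (vopp x) = vzero;
  vscal_1 : forall x, vscal C1 x = x;
  vscal_assoc : forall a b x, vscal a (vscal b x) = vscal (Cmul a b) x;
  vscal_distr_v : forall a x y, vscal a (vadd x y) = vadd (vscal a x) (vscal a y);
  vscal_distr_s : forall a b x, vscal (Cadd a b) x = vadd (vscal a x) (vscal b x);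
  vnorm_nonneg : forall x, 0 <= vnorm x;
  vnorm_eq0 : forall x, vnorm x = 0 -> x = vzero;
  vnorm_triangle : forall x y, vnorm (vadd x y) <= vnorm x + vnorm y;
  vnorm_scal : forall a x, vnorm (vscal a x) = Cabs a * vnorm x;
  vcomplete : forall u : nat -> carrier,
      (forall eps, 0 < eps -> exists N, forall m n, (N <= m)%nat -> (N <= n)%nat ->
          vnorm (vadd (u m) (vopp (u n))) < eps) ->
      exists l, forall eps, 0 < eps -> exists N, forall n, (N <= n)%nat ->
          vnorm (vadd (u n) (vopp l)) < eps
}.

Arguments vzero {c}.
Arguments vadd {c}.
Arguments vopp {c}.
Arguments vscal {c}.
Arguments vnorm {c}.

Section Ops.
Variable X : CBanach.

Definition converges (u : nat -> X) (l : X) : Prop :=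
  forall eps, 0 < eps -> exists N, forall n, (N <= n)%nat -> vnorm (vadd (u n) (vopp l)) < eps.

Definition bounded_op (T : X -> X) : Prop :=
  (forall x y, T (vadd x y) = vadd (T x) (T y)) /\
  (forall a x, T (vscal a x) = vscal a (T x)) /\
  (exists M, forall x, vnorm (T x) <= M * vnorm x).

Definition compact_op (T : X -> X) : Prop :=
  bounded_op T /\
  forall u : nat -> X, (exists M, forall n, vnorm (u n) <= M) ->
    exists (phi : nat -> nat) (l : X),
      (forall n, (phi n < phi (S n))%nat) /\ converges (fun n => T (u (phi n))) l.

(** quasinilpotent: spectrum (in the Banach algebra B(X)) contained in {0},
    i.e. T - lambda I is invertible in B(X) for every lambda <> 0 *)
Definition quasinilpotent (T : X -> X) : Prop :=
  forall lam : C, lam <> C0 ->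
    exists S : X -> X, bounded_op S /\
      forall x, S (vadd (T x) (vopp (vscal lam x))) = x /\
                vadd (T (S x)) (vopp (vscal lam (S x))) = x.

Definition volterra (T : X -> X) : Prop := compact_op T /\ quasinilpotent T.

Definition op0 : X -> X := fun _ => vzero.
Definition opadd (a b : X -> X) : X -> X := fun x => vadd (a x) (b x).
Definition opscal (c : C) (a : X -> X) : X -> X := fun x => vscal c (a x).
Definition jprod (a b : X -> X) : X -> X := fun x => vadd (a (b x)) (b (a x)).

Definition op_subspace (S : (X -> X) -> Prop) : Prop :=
  S op0 /\ (forall a b, S a -> S b -> S (opadd a b)) /\
  (forall c a, S a -> S (opscal c a)).

Definition jordan_algebra_compact (J : (X -> X) -> Prop) : Prop :=
  op_subspace J /\ (forall a, J a -> compact_op a) /\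
  (forall a b, J a -> J b -> J (jprod a b)).

Definition jordan_ideal (J I : (X -> X) -> Prop) : Prop :=
  op_subspace I /\ (forall a, I a -> J a) /\
  (forall a b, J a -> I b -> I (jprod a b)).

Definition closed_subspace (M : X -> Prop) : Prop :=
  M vzero /\ (forall x y, M x -> M y -> M (vadd x y)) /\
  (forall c x, M x -> M (vscal c x)) /\
  (forall (u : nat -> X) l, (forall n, M (u n)) -> converges u l -> M l).

Definition reducible (J : (X -> X) -> Prop) : Prop :=
  exists M : X -> Prop, closed_subspace M /\
    (exists x, M x /\ x <> vzero) /\ (exists x, ~ M x) /\
    (forall a x, J a -> M x -> M (a x)).
End Ops.

Arguments converges {X}.
Arguments bounded_op {X}.
Arguments compact_op {X}.
Arguments quasinilpotent {X}.
Arguments volterra {X}.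
Arguments jordan_algebra_compact {X}.
Arguments jordan_ideal {X}.
Arguments closed_subspace {X}.
Arguments reducible {X}.

(* Main.v *)
(** Assume that J is irreducible, and let W be the norm closure of I; by upper semicontinuity of the
    spectrum of compact operators, W consists of Volterra operators.

    1. W has no nonzero finite-rank element.  On finite-dimensional spaces Jacobson's theorem makes all
       products of such elements nilpotent.  If p has minimal rank among the nonzero linear combinations
       of such products, commuting letters of J past p gives p w p = p q with q nilpotent, for every word
       w in J; minimality forces p w p = 0, hence p = 0 by irreducibility.

    2. Every product of elements of J is quasinilpotent.  Let g = (1 + a_1)...(1 + a_n) and let h be the
       product in reverse order.  The map Phi(x) = g x h preserves W, since a x a is a combination of
       Jordan products.  As W contains no finite-rank element, Phi - 1 is locally quasinilpotent at every
       x in W.  If h had an eigenvalue c <> 1, every x in W would interchange the generalised kernels of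
       h - c and c g - 1, which are finite-dimensional; by Jacobson's theorem W would have a common
       kernel, contradicting irreducibility.  So h - 1 is quasinilpotent; replacing a_i by t a_i and
       letting t tend to infinity shows that a_n ... a_1 is quasinilpotent.

    3. By Turovskii's theorem a semigroup of quasinilpotent compact operators is reducible: normalise
       the joint spectral radius of {K b : |b| <= 1} to 1, which is possible by Hilden's argument.
       If the norms of the products are unbounded, nearly norming products converge, up to scaling, to
       some T <> 0 with T s T = 0 for all s in the semigroup.  If they are bounded, a limit U <> 0 of
       suffixes of long products has finite rank, and for U of minimal rank some U s is quasinilpotent
       but bijective on the range of U. *)

From Stdlib Require Import Reals Lra Lia Psatz List Classical ClassicalEpsilon FunctionalExtensionality ProofIrrelevance.
From Stdlib Require Cantor.
From mathcomp.classical Require classical_sets.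
From Corelib Require Import ssreflect.
Require Import Defs.
Import ListNotations.
Set Implicit Arguments.
Unset Strict Implicit.
Unset Printing Implicit Defensive.
Open Scope R_scope.

(** * Complex scalars and vector identities *)

(** All spectral theory here rests on one construction without integrals. If 1 - aS is invertible
    for all |a| = 1, the operators (1 - S^(2^j))^-1 converge to the projection belonging to the part
    of the spectrum inside the circle. Partial fractions write the inverse at one level as the mean
    of two at the previous level, so bounds on the circle are inherited, while the variation in a
    shrinks by the factor 3/4. Gelfand's formula, the Riesz decomposition, the semicontinuity of the
    spectrum and the local study of Phi - 1 are all read off from this, with rates that are uniform
    under small perturbations.

    The passage from I to its closure W is forced: projections of Phi are limits, so they can only
    be expected to respect closed subspaces. That resolvents of Phi keep W invariant is not
    automatic either; it holds because the spectrum of Phi lies in a countable set, so that a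
    half-line in a generic direction joins a regular point to infinity, where the Neumann series
    gives invariance.

    Dimension is measured by the length of a spanning list, and minimal rank means minimal
    length. *)

Lemma C_ext (a b : C) : Cre a = Cre b -> Cim a = Cim b -> a = b.
Proof. by case: a => ar ai; case: b => br bi /= -> ->. Qed.

Definition Cminus (a b : C) := Cadd a (Copp b).

Lemma C_ring_theory : ring_theory C0 C1 Cadd Cmul Cminus Copp (@eq C).
Proof. by split; intros; apply: C_ext; cbn; ring. Qed.
Add Ring C_ring : C_ring_theory.

Definition RtoC (r : R) : C := mkC r 0.
Definition Cinv (a : C) : C :=
  mkC (Cre a / (Cre a ^ 2 + Cim a ^ 2)) (- Cim a / (Cre a ^ 2 + Cim a ^ 2)).
Definition Cdiv (a b : C) := Cmul a (Cinv b).

Lemma Cabs_nonneg a : 0 <= Cabs a.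
Proof. exact: sqrt_pos. Qed.

Lemma Cabs_sq a : Cabs a * Cabs a = Cre a ^ 2 + Cim a ^ 2.
Proof. rewrite /Cabs sqrt_sqrt //; nra. Qed.

Lemma Cabs_le a b : 0 <= b -> Cre a ^ 2 + Cim a ^ 2 <= b * b -> Cabs a <= b.
Proof.
move=> b0 H; rewrite -(sqrt_square b) //; rewrite /Cabs; exact: sqrt_le_1_alt.
Qed.

Lemma Cabs_unique a b : 0 <= b -> Cre a ^ 2 + Cim a ^ 2 = b * b -> Cabs a = b.
Proof. by move=> b0 H; rewrite /Cabs H sqrt_square. Qed.

Lemma Cabs_mul a b : Cabs (Cmul a b) = Cabs a * Cabs b.
Proof.
apply: Cabs_unique; first by apply: Rmult_le_pos; exact: Cabs_nonneg.
have -> : Cabs a * Cabs b * (Cabs a * Cabs b) = (Cabs a * Cabs a) * (Cabs b * Cabs b) by ring.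
rewrite !Cabs_sq /=; ring.
Qed.

Lemma Cabs_triangle a b : Cabs (Cadd a b) <= Cabs a + Cabs b.
Proof.
have Ha := Cabs_nonneg a; have Hb := Cabs_nonneg b.
apply: Cabs_le; first lra.
have -> : (Cabs a + Cabs b) * (Cabs a + Cabs b) =
  Cabs a * Cabs a + Cabs b * Cabs b + 2 * (Cabs a * Cabs b) by ring.
rewrite !Cabs_sq /=.
suff : Cre a * Cre b + Cim a * Cim b <= Cabs a * Cabs b by nra.
rewrite -Cabs_mul.
apply: Rle_trans (Rle_abs _) _.
rewrite -(sqrt_Rsqr_abs) /Cabs; apply: sqrt_le_1_alt; rewrite /Rsqr /=.
have := pow2_ge_0 (Cre a * Cim b - Cim a * Cre b); nra.
Qed.

Lemma Cabs_RtoC r : Cabs (RtoC r) = Rabs r.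
Proof.
apply: Cabs_unique; first exact: Rabs_pos.
rewrite -Rabs_mult Rabs_right /=; nra.
Qed.

Lemma Cabs_C0 : Cabs C0 = 0.
Proof. by apply: Cabs_unique; [lra|cbn; ring]. Qed.
Lemma Cabs_C1 : Cabs C1 = 1.
Proof. by apply: Cabs_unique; [lra|cbn; ring]. Qed.
Lemma Cabs_opp a : Cabs (Copp a) = Cabs a.
Proof. by rewrite /Cabs /=; f_equal; ring. Qed.

Lemma Cabs_eq0 a : Cabs a = 0 -> a = C0.
Proof.
move=> H; have := Cabs_sq a; rewrite H => H2; apply: C_ext; cbn in *; nra.
Qed.

Lemma Cabs_pos a : a <> C0 -> 0 < Cabs a.
Proof.
move=> H; case: (Cabs_nonneg a) => // H0; by case: H; apply: Cabs_eq0.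
Qed.

Lemma C_neq0_sq a : a <> C0 -> Cre a ^ 2 + Cim a ^ 2 <> 0.
Proof. move=> H; rewrite -Cabs_sq; have := Cabs_pos H; nra. Qed.

Lemma Cinv_l a : a <> C0 -> Cmul (Cinv a) a = C1.
Proof.
move=> H; have H2 := C_neq0_sq H; cbn in H2; apply: C_ext; cbn; field; nra.
Qed.
Lemma Cinv_r a : a <> C0 -> Cmul a (Cinv a) = C1.
Proof. by move=> H; rewrite -(Cinv_l H); ring. Qed.

Lemma C1_neq0 : C1 <> C0.
Proof. by move=> H; have := f_equal Cre H; cbn; lra. Qed.

Lemma Cabs_inv a : a <> C0 -> Cabs (Cinv a) = / Cabs a.
Proof.
move=> H; have Hp := Cabs_pos H.
apply: (Rmult_eq_reg_r (Cabs a)); last lra.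
rewrite -Cabs_mul Cinv_l // Cabs_C1; field; lra.
Qed.

Lemma Cinv_neq0 a : a <> C0 -> Cinv a <> C0.
Proof.
by move=> H E; have := Cinv_l H; rewrite E => E2; apply: C1_neq0; rewrite -E2; ring.
Qed.

Lemma Cmul_neq0 a b : a <> C0 -> b <> C0 -> Cmul a b <> C0.
Proof.
move=> Ha Hb E; have := Cabs_mul a b; rewrite E Cabs_C0.
have := Cabs_pos Ha; have := Cabs_pos Hb; nra.
Qed.

Lemma C_field_theory : field_theory C0 C1 Cadd Cmul Cminus Copp Cdiv Cinv (@eq C).
Proof.
split; [exact: C_ring_theory|exact: C1_neq0|by []|].
by move=> p Hp; apply: Cinv_l.
Qed.
Add Field C_field : C_field_theory.

Lemma Cminus_neq0 a b : a <> b -> Cminus a b <> C0.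
Proof.
move=> H E; apply: H; have -> : a = Cadd (Cminus a b) b by ring.
by rewrite E; ring.
Qed.

Lemma RtoC_neq0 r : r <> 0 -> RtoC r <> C0.
Proof. by move=> H E; have := f_equal Cre E. Qed.

Declare Scope vec_scope.
Delimit Scope vec_scope with V.
Notation "x +v y" := (vadd x y) (at level 50, left associativity).
Notation "-v x" := (vopp x) (at level 35, right associativity).
Notation "x -v y" := (vadd x (vopp y)) (at level 50, left associativity).
Notation "a *v x" := (vscal a x) (at level 40, left associativity).
Notation "0v" := vzero.
Notation "<| x |>" := (vnorm x) (at level 0, x at level 99, format "<| x |>").

Arguments vadd_assoc {c}. Arguments vadd_comm {c}. Arguments vadd_0 {c}.
Arguments vadd_opp {c}. Arguments vscal_1 {c}. Arguments vscal_assoc {c}.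
Arguments vscal_distr_v {c}. Arguments vscal_distr_s {c}. Arguments vnorm_nonneg {c}.
Arguments vnorm_eq0 {c}. Arguments vnorm_triangle {c}. Arguments vnorm_scal {c}.

Section VecBasics.
Variable X : CBanach.
Implicit Types x y z : X.

Lemma vadd_0l x : 0v +v x = x.
Proof. by rewrite vadd_comm vadd_0. Qed.

Lemma vadd_cancel x y z : x +v y = x +v z -> y = z.
Proof.
move=> H; have := f_equal (fun t => -v x +v t) H.
by rewrite !vadd_assoc (vadd_comm (-v x)) vadd_opp !vadd_0l.
Qed.

Lemma vscal_0 x : C0 *v x = 0v.
Proof.
apply: (@vadd_cancel (C0 *v x)); rewrite -vscal_distr_s vadd_0.
by congr (_ *v _); ring.
Qed.

Lemma vscal_v0 a : a *v (0v : X) = 0v.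
Proof.
apply: (@vadd_cancel (a *v 0v)); by rewrite -vscal_distr_v !vadd_0.
Qed.

Lemma vopp_scal x : -v x = Copp C1 *v x.
Proof.
apply: (@vadd_cancel x); rewrite vadd_opp -{1}(vscal_1 x) -vscal_distr_s.
by rewrite -(vscal_0 x); congr (_ *v _); ring.
Qed.

(** Reflection for linear identities: an expression is reduced to its coefficients over the atoms
    [env], so that an identity between vectors becomes a list of scalar equations. *)
Inductive vexp := VZ | VV (n : nat) | VA (a b : vexp) | VN (a : vexp) | VS (c : C) (a : vexp).

Fixpoint veval (env : list X) (e : vexp) : X :=
  match e with
  | VZ => 0v
  | VV n => nth n env 0v
  | VA a b => veval env a +v veval env b
  | VN a => -v veval env a
  | VS c a => c *v veval env a
  end.

Fixpoint lc (cs : list C) (env : list X) : X :=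
  match cs, env with
  | c :: cs, x :: env => c *v x +v lc cs env
  | _, _ => 0v
  end.

Fixpoint cunit (k n : nat) : list C :=
  match k with
  | O => []
  | S k => match n with O => C1 :: repeat C0 k | S n => C0 :: cunit k n end
  end.

Fixpoint cadd (l m : list C) : list C :=
  match l, m with a :: l, b :: m => Cadd a b :: cadd l m | _, _ => [] end.

Fixpoint vcoef (k : nat) (e : vexp) : list C :=
  match e with
  | VZ => repeat C0 k
  | VV n => cunit k n
  | VA a b => cadd (vcoef k a) (vcoef k b)
  | VN a => map (fun c => Copp c) (vcoef k a)
  | VS c a => map (fun d => Cmul c d) (vcoef k a)
  end.

Lemma lc_repeat0 env k : lc (repeat C0 k) env = 0v.
Proof.
by elim: k env => [|k IH] [|x env] //=; rewrite IH vscal_0 vadd_0.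
Qed.

Lemma cadd_length k l m : length l = k -> length m = k -> length (cadd l m) = k.
Proof.
elim: l m k => [|x l IH] [|y m] [|k] //= [Ha] [Hb]; by rewrite (IH m k).
Qed.

Lemma vcoef_length k e : length (vcoef k e) = k.
Proof.
elim: e => /= [|n|a IHa b IHb|a IH|c a IH]; rewrite ?length_map ?repeat_length //.
- by elim: k n => [|k IH] [|n] //=; rewrite ?repeat_length ?IH.
- exact: cadd_length.
Qed.

Lemma vadd_ACA (a b c d : X) : (a +v b) +v (c +v d) = (a +v c) +v (b +v d).
Proof.
by rewrite -!vadd_assoc; congr (_ +v _); rewrite !vadd_assoc (vadd_comm b c).
Qed.

Lemma lc_cadd env l m : length l = length env -> length m = length env ->
  lc (cadd l m) env = lc l env +v lc m env.
Proof.
elim: env l m => [|v env IH] [|x l] [|y m] //=; rewrite ?vadd_0 //.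
by move=> [H1] [H2]; rewrite IH // vscal_distr_s vadd_ACA.
Qed.

Lemma lc_scal env c l : lc (map (fun d => Cmul c d) l) env = c *v lc l env.
Proof.
elim: env l => [|v env IH] [|x l] //=; rewrite ?vscal_v0 //.
by rewrite IH vscal_distr_v vscal_assoc.
Qed.

Lemma vcoefP env e : veval env e = lc (vcoef (length env) e) env.
Proof.
elim: e => /= [|n|a IHa b IHb|a IH|c a IH].
- by rewrite lc_repeat0.
- by elim: env n => [|x env IH] [|n] //=; rewrite ?lc_repeat0 ?vscal_1 ?vadd_0 // -IH vscal_0 vadd_0l.
- by rewrite IHa IHb lc_cadd ?vcoef_length.
- rewrite IH vopp_scal -lc_scal; congr lc; apply: map_ext => d; ring.
- by rewrite IH -lc_scal.
Qed.

Lemma vring_correct env e1 e2 :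
  vcoef (length env) e1 = vcoef (length env) e2 -> veval env e1 = veval env e2.
Proof. by move=> H; rewrite !vcoefP H. Qed.
End VecBasics.

Lemma cons_eq (T : Type) (a b : T) l m : a = b -> l = m -> a :: l = b :: m.
Proof. by move=> -> ->. Qed.

Ltac vfind x l :=
  match l with
  | x :: _ => constr:(O)
  | _ :: ?l' => let n := vfind x l' in constr:(S n)
  end.
Ltac vatoms e l :=
  lazymatch e with
  | vzero => l
  | vadd ?a ?b => let l1 := vatoms a l in vatoms b l1
  | vopp ?a => vatoms a l
  | vscal _ ?a => vatoms a l
  | ?x => match l with
          (* [vfind] only tests membership: its failure makes the match fall through to the branch
             that adds the atom. *)
          | _ => let n := vfind x l in l
          | _ => constr:(x :: l)
          end
  end.
Ltac vreify e l :=
  lazymatch e with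
  | vzero => constr:(VZ)
  | vadd ?a ?b => let a' := vreify a l in let b' := vreify b l in constr:(VA a' b')
  | vopp ?a => let a' := vreify a l in constr:(VN a')
  | vscal ?c ?a => let a' := vreify a l in constr:(VS c a')
  | ?x => let n := vfind x l in constr:(VV n)
  end.
(** Scalar equations that [ring] does not settle, such as those with [Cinv], are left to the
    caller. *)
Ltac vring :=
  lazymatch goal with
  | |- @eq _ ?a ?b =>
    let X := lazymatch a with
      | @vadd ?X _ _ => X | @vopp ?X _ => X | @vscal ?X _ _ => X | @vzero ?X => X
      | _ => lazymatch b with
        | @vadd ?X _ _ => X | @vopp ?X _ => X | @vscal ?X _ _ => X | @vzero ?X => X end
      end in
    let l0 := constr:(@nil (carrier X)) in
    let l1 := vatoms a l0 in
    let l := vatoms b l1 in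
    let ea := vreify a l in
    let eb := vreify b l in
    change (veval l ea = veval l eb); apply: vring_correct;
    cbn [vcoef length cunit cadd map repeat];
    repeat (apply: cons_eq; [try ring|]); try reflexivity
  end.

(** * Norms, convergence and geometric series *)

Section NormBasics.
Variable X : CBanach.
Implicit Types x y z : X.

Lemma vnorm_0 : <|(0v : X)|> = 0.
Proof. by rewrite -(vscal_0 (0v : X)) vnorm_scal Cabs_C0; ring. Qed.

Lemma vnorm_opp x : <|-v x|> = <|x|>.
Proof. by rewrite vopp_scal vnorm_scal Cabs_opp Cabs_C1; ring. Qed.

Lemma vnorm_sub_sym x y : <|x -v y|> = <|y -v x|>.
Proof. by rewrite -vnorm_opp; congr vnorm; vring. Qed.

Lemma vnorm_pos x : x <> 0v -> 0 < <|x|>.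
Proof. by move=> H; case: (vnorm_nonneg x) => // E; case: H; apply: vnorm_eq0. Qed.

Lemma vnorm_tri x y z : <|x -v z|> <= <|x -v y|> + <|y -v z|>.
Proof. have -> : x -v z = (x -v y) +v (y -v z) by vring. exact: vnorm_triangle. Qed.

Lemma vnorm_sub_le x y : <|x -v y|> <= <|x|> + <|y|>.
Proof. by rewrite -(vnorm_opp y); exact: vnorm_triangle. Qed.

Lemma vnorm_rev x y : <|x|> - <|y|> <= <|x -v y|>.
Proof.
have -> : x = (x -v y) +v y by vring.
have := vnorm_triangle (x -v y) y; have -> : (x -v y) +v y -v y = x -v y by vring. lra.
Qed.

Lemma vsub_eq0 x y : x -v y = 0v -> x = y.
Proof. move=> H; have -> : x = (x -v y) +v y by vring. by rewrite H; vring. Qed.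

Lemma vnorm_small x : (forall e, 0 < e -> <|x|> <= e) -> x = 0v.
Proof.
move=> H; apply: vnorm_eq0; have := vnorm_nonneg x.
case: (Rle_lt_dec <|x|> 0) => [|Hx]; first lra.
have := H (<|x|> / 2); lra.
Qed.

Lemma vscal_eq0 a x : a <> C0 -> a *v x = 0v -> x = 0v.
Proof.
move=> Ha H; rewrite -(vscal_1 x) -(Cinv_l Ha) -vscal_assoc H vscal_v0 //.
Qed.

Lemma converges_unique (u : nat -> X) l m : converges u l -> converges u m -> l = m.
Proof.
move=> Hl Hm; apply: vsub_eq0; apply: vnorm_small => e e0.
case: (Hl (e / 2)); first lra. move=> N1 H1.
case: (Hm (e / 2)); first lra. move=> N2 H2.
have := H1 (max N1 N2); have := H2 (max N1 N2).
rewrite (vnorm_sub_sym _ l) => A B.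
have := vnorm_tri l (u (max N1 N2)) m.
have := A ltac:(lia); have := B ltac:(lia); lra.
Qed.

Lemma converges_const l : converges (fun _ => l : X) l.
Proof. by move=> e e0; exists 0%nat => n _; rewrite vadd_opp vnorm_0. Qed.

Lemma converges_add (u v : nat -> X) l m :
  converges u l -> converges v m -> converges (fun n => u n +v v n) (l +v m).
Proof.
move=> Hl Hm e e0.
case: (Hl (e / 2)); first lra. move=> N1 H1.
case: (Hm (e / 2)); first lra. move=> N2 H2.
exists (max N1 N2) => n Hn.
have -> : u n +v v n -v (l +v m) = (u n -v l) +v (v n -v m) by vring.
have := vnorm_triangle (u n -v l) (v n -v m).
have := H1 n ltac:(lia); have := H2 n ltac:(lia); lra.
Qed.

Lemma converges_scal (u : nat -> X) l a :
  converges u l -> converges (fun n => a *v u n) (a *v l).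
Proof.
move=> Hl e e0; have Ha := Cabs_nonneg a.
case: (Hl (e / (Cabs a + 1))); first by apply: Rdiv_lt_0_compat; lra.
move=> N H; exists N => n Hn.
have -> : a *v u n -v a *v l = a *v (u n -v l) by vring.
rewrite vnorm_scal; have Hn' := H n Hn.
have : <|u n -v l|> * (Cabs a + 1) < e.
  apply: (Rmult_lt_reg_r (/ (Cabs a + 1))); first by apply: Rinv_0_lt_compat; lra.
  rewrite Rmult_assoc Rinv_r; lra.
have := vnorm_nonneg (u n -v l); nra.
Qed.

Lemma converges_sub (u v : nat -> X) l m :
  converges u l -> converges v m -> converges (fun n => u n -v v n) (l -v m).
Proof.
move=> Hl Hm; rewrite vopp_scal.
have -> : (fun n => u n -v v n) = (fun n => u n +v Copp C1 *v v n).
  by apply: functional_extensionality => n; rewrite vopp_scal.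
by apply: converges_add => //; apply: converges_scal.
Qed.

Lemma subseq_ge (phi : nat -> nat) : (forall n, phi n < phi (S n))%nat -> forall n, (n <= phi n)%nat.
Proof. by move=> H; elim=> [|n IH]; [lia|have := H n; lia]. Qed.

Lemma subseq_mono (phi : nat -> nat) : (forall n, phi n < phi (S n))%nat ->
  forall m n, (m < n)%nat -> (phi m < phi n)%nat.
Proof.
move=> H m n; elim: n => [|n IH] Hmn; first lia.
have := H n; case: (Nat.eq_dec m n) => [->|]; first by []. move=> ?; have := IH ltac:(lia); lia.
Qed.

Lemma converges_subseq (u : nat -> X) l phi :
  (forall n, phi n < phi (S n))%nat -> converges u l -> converges (fun n => u (phi n)) l.
Proof.
move=> Hphi Hu e e0; case: (Hu e e0) => N H; exists N => n Hn; apply: H.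
have := subseq_ge Hphi n; lia.
Qed.

Lemma converges_norm_le (u : nat -> X) l B :
  converges u l -> (exists N, forall n, (N <= n)%nat -> <|u n|> <= B) -> <|l|> <= B.
Proof.
move=> Hu [N0 HB]; case: (Rle_lt_dec <|l|> B) => // Hlt.
case: (Hu (<|l|> - B)); first lra. move=> N H.
have A := H (max N N0) ltac:(lia); have Bn := HB (max N N0) ltac:(lia).
have := vnorm_rev l (u (max N N0)); rewrite vnorm_sub_sym; lra.
Qed.

Lemma converges_norm_ge (u : nat -> X) l B :
  converges u l -> (exists N, forall n, (N <= n)%nat -> B <= <|u n|>) -> B <= <|l|>.
Proof.
move=> Hu [N0 HB]; case: (Rle_lt_dec B <|l|>) => // Hlt.
case: (Hu (B - <|l|>)); first lra. move=> N H.
have A := H (max N N0) ltac:(lia); have Bn := HB (max N N0) ltac:(lia).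
have := vnorm_rev (u (max N N0)) l; lra.
Qed.

Lemma converges_bounded (u : nat -> X) l : converges u l ->
  exists M, forall n, <|u n|> <= M.
Proof.
move=> Hu; case: (Hu 1); first lra. move=> N H.
have [M HM] : exists M, forall n, (n < N)%nat -> <|u n|> <= M.
  elim: N {H} => [|N [M HM]]; first by exists 0 => n; lia.
  exists (Rmax M <|u N|>) => n Hn; case: (Nat.eq_dec n N) => [->|Hne]; first exact: Rmax_r.
  apply: Rle_trans (Rmax_l _ _); apply: HM; lia.
exists (Rmax M (<|l|> + 1)) => n; case: (Nat.lt_ge_cases n N) => Hn.
  by apply: Rle_trans (Rmax_l _ _); apply: HM.
apply: Rle_trans (Rmax_r _ _); have := H n Hn; have := vnorm_rev (u n) l; lra.
Qed.

Lemma pow_lt_small (t : R) : 0 <= t < 1 -> forall e, 0 < e -> exists N, forall n, (N <= n)%nat -> t ^ n < e.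
Proof.
move=> Ht e e0; have := @pow_lt_1_zero t; rewrite Rabs_right; last lra.
move=> /(_ ltac:(lra) e e0) [N H]; exists N => n Hn; have := H n ltac:(lia).
rewrite Rabs_right //; apply: Rle_ge; apply: pow_le; lra.
Qed.

(** The tail of the dominating geometric series is kept as an explicit error bound, because the
    later arguments need a rate that depends only on [B] and [t]. *)
Lemma geom_cauchy (u : nat -> X) B t : 0 <= t < 1 ->
  (forall n, <|u (S n) -v u n|> <= B * t ^ n) ->
  exists l, converges u l /\ forall n, <|l -v u n|> <= B * t ^ n / (1 - t).
Proof.
move=> Ht H.
have B0 : 0 <= B by have := H 0%nat; have := vnorm_nonneg (u 1%nat -v u 0%nat); cbn; lra.
have K k n : <|u (n + k)%nat -v u n|> <= B * t ^ n / (1 - t).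
  have : <|u (n + k)%nat -v u n|> <= B * t ^ n * (1 - t ^ k) / (1 - t).
    elim: k => [|k IH].
      by rewrite Nat.add_0_r vadd_opp vnorm_0 /=; apply: Req_le; field; lra.
    apply: Rle_trans (vnorm_tri _ (u (n + k)%nat) _) _.
    rewrite Nat.add_succ_r; have := H (n + k)%nat; rewrite pow_add => H1.
    apply: Rle_trans (Rplus_le_compat _ _ _ _ H1 IH) _; apply: Req_le; cbn; field; lra.
  move=> H1; apply: Rle_trans H1 _; rewrite /Rdiv; apply: Rmult_le_compat_r.
    by apply: Rlt_le; apply: Rinv_0_lt_compat; lra.
  have P1 : 0 <= t ^ n by apply: pow_le; lra.
  have P2 : 0 <= t ^ k by apply: pow_le; lra.
  have : 0 <= B * t ^ n * t ^ k by repeat apply: Rmult_le_pos.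
  lra.
have K' e : 0 < e -> exists N, forall n, (N <= n)%nat -> B * t ^ n / (1 - t) < e.
  move=> e0; case: (pow_lt_small Ht (e := e * (1 - t) / (B + 1))).
    by apply: Rdiv_lt_0_compat; [apply: Rmult_lt_0_compat; lra|lra].
  move=> N HN; exists N => n Hn; have := HN n Hn => H1.
  apply: (Rmult_lt_reg_r (1 - t)); first lra.
  rewrite /Rdiv Rmult_assoc Rinv_l ?Rmult_1_r; last lra.
  have : t ^ n * (B + 1) < e * (1 - t).
    apply: (Rmult_lt_reg_r (/ (B + 1))); first by apply: Rinv_0_lt_compat; lra.
    by rewrite Rmult_assoc Rinv_r; lra.
  have : 0 <= t ^ n by apply: pow_le; lra. nra.
have [l Hl] : exists l, converges u l.
  apply: vcomplete => e e0; case: (K' (e / 2)); first lra.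
  move=> N HN; exists N => m n Hm Hn.
  apply: Rle_lt_trans (vnorm_tri _ (u N) _) _.
  have := K (m - N)%nat N; have := K (n - N)%nat N.
  have -> : (N + (m - N) = m)%nat by lia.
  have -> : (N + (n - N) = n)%nat by lia.
  rewrite (vnorm_sub_sym (u n)); have := HN N ltac:(lia); lra.
exists l; split=> // n.
apply: (converges_norm_le (u := fun k => u k -v u n)).
  by apply: converges_sub => //; apply: converges_const.
exists n => k Hk; have := K (k - n)%nat n; by have -> : (n + (k - n) = k)%nat by lia.
Qed.

End NormBasics.

Lemma CmulVK a c : c <> C0 -> Cmul (Cmul a (Cinv c)) c = a.
Proof. by move=> Hc; field. Qed.

(** * The Banach space of bounded operators *)

Record Bop (X : CBanach) := mkBop { bfun :> X -> X; bprf : bounded_op bfun }.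

Lemma Bop_ext X (A B : Bop X) : (forall x, A x = B x) -> A = B.
Proof.
case: A => f pf; case: B => g pg /= H.
have E : f = g by apply: functional_extensionality.
by move: pf pg; rewrite E => pf pg; congr mkBop; apply: proof_irrelevance.
Qed.

Section Operators.
Variable X : CBanach.
Implicit Types (A B D T R : Bop X) (x y : X).

Lemma bopD T x y : T (x +v y) = T x +v T y.
Proof. case: T => f [H1 [H2 H3]]; exact: H1. Qed.
Lemma bopZ T a x : T (a *v x) = a *v T x.
Proof. case: T => f [H1 [H2 H3]]; exact: H2. Qed.
Lemma bopN T x : T (-v x) = -v T x.
Proof. by rewrite (vopp_scal x) bopZ -vopp_scal. Qed.
Lemma bop0 T : T 0v = 0v.
Proof. by rewrite -(vscal_0 (0v : X)) bopZ !vscal_0. Qed.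

Lemma bop_bound T : exists M, 0 <= M /\ forall x, <|T x|> <= M * <|x|>.
Proof.
case: T => f [_ [_ [M H]]] /=; exists (Rabs M); split; first exact: Rabs_pos.
move=> x; apply: Rle_trans (H x) _; apply: Rmult_le_compat_r; [exact: vnorm_nonneg|exact: Rle_abs].
Qed.

Definition opvals T (r : R) := exists x, <|x|> <= 1 /\ r = <|T x|>.

Lemma opvals_bound T : bound (opvals T).
Proof.
case: (bop_bound T) => M [M0 H]; exists M => r [x [Hx ->]].
apply: Rle_trans (H x) _; have := vnorm_nonneg x; nra.
Qed.
Lemma opvals_inh T : exists r, opvals T r.
Proof. by exists <|T 0v|>, 0v; rewrite vnorm_0; split=> //; lra. Qed.

Definition opnorm T : R := proj1_sig (completeness _ (opvals_bound T) (opvals_inh T)).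

Lemma opnorm_spec T x : <|T x|> <= opnorm T * <|x|>.
Proof.
rewrite /opnorm; case: (completeness _ _ _) => N [/= ub _].
case: (Req_dec <|x|> 0) => [E|Hx].
  by rewrite E (vnorm_eq0 _ E) bop0 vnorm_0; lra.
have Hp : 0 < <|x|> by have := vnorm_nonneg x; lra.
have Hc : RtoC <|x|> <> C0 by apply: RtoC_neq0.
have := ub <|T (Cinv (RtoC <|x|>) *v x)|>; rewrite bopZ vnorm_scal Cabs_inv // Cabs_RtoC Rabs_right; last lra.
move=> H; have : / <|x|> * <|T x|> <= N.
  apply: H; exists (Cinv (RtoC <|x|>) *v x); rewrite bopZ !vnorm_scal Cabs_inv // Cabs_RtoC Rabs_right; last lra.
  by split=> //; right; field.
move=> H2; apply: (Rmult_le_reg_l (/ <|x|>)); first exact: Rinv_0_lt_compat.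
by rewrite (Rmult_comm N) -Rmult_assoc Rinv_l // Rmult_1_l.
Qed.

Lemma opnorm_lub T M : 0 <= M -> (forall x, <|T x|> <= M * <|x|>) -> opnorm T <= M.
Proof.
rewrite /opnorm; case: (completeness _ _ _) => N [/= _ lu] M0 H.
apply: lu => r [x [Hx ->]]; apply: Rle_trans (H x) _; have := vnorm_nonneg x; nra.
Qed.

Lemma opnorm_nonneg T : 0 <= opnorm T.
Proof.
rewrite /opnorm; case: (completeness _ _ _) => N [/= ub _].
apply: Rle_trans (ub <|T 0v|> _); first exact: vnorm_nonneg.
by exists 0v; rewrite vnorm_0; split=> //; lra.
Qed.

Lemma badd_bounded A B : bounded_op (fun x => A x +v B x).
Proof.
split; first by move=> x y; rewrite !bopD; vring.
split; first by move=> a x; rewrite !bopZ; vring.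
exists (opnorm A + opnorm B) => x; apply: Rle_trans (vnorm_triangle _ _) _.
have := opnorm_spec A x; have := opnorm_spec B x; lra.
Qed.
Definition badd A B := mkBop (badd_bounded A B).

Lemma bscal_bounded a A : bounded_op (fun x => a *v A x).
Proof.
split; first by move=> x y; rewrite !bopD; vring.
split; first by move=> b x; rewrite !bopZ; vring.
exists (Cabs a * opnorm A) => x; rewrite vnorm_scal Rmult_assoc.
apply: Rmult_le_compat_l; [exact: Cabs_nonneg|exact: opnorm_spec].
Qed.
Definition bscal a A := mkBop (bscal_bounded a A).

Lemma bopp_bounded A : bounded_op (fun x => -v A x).
Proof.
split; first by move=> x y; rewrite !bopD; vring.
split; first by move=> b x; rewrite !bopZ; vring.
by exists (opnorm A) => x; rewrite vnorm_opp; exact: opnorm_spec.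
Qed.
Definition bopp A := mkBop (bopp_bounded A).

Lemma bzero_bounded : bounded_op (fun _ : X => 0v : X).
Proof.
split; first by move=> x y; vring.
split; first by move=> b x; vring.
by exists 0 => x; rewrite vnorm_0; lra.
Qed.
Definition bzero := mkBop bzero_bounded.

Lemma opnorm_eq0 A : opnorm A = 0 -> A = bzero.
Proof.
move=> H; apply: Bop_ext => x /=; apply: vnorm_eq0.
have := opnorm_spec A x; have := vnorm_nonneg (A x); rewrite H; lra.
Qed.

Lemma opnorm_tri A B : opnorm (badd A B) <= opnorm A + opnorm B.
Proof.
apply: opnorm_lub; first by have := opnorm_nonneg A; have := opnorm_nonneg B; lra.
move=> x /=; apply: Rle_trans (vnorm_triangle _ _) _.
have := opnorm_spec A x; have := opnorm_spec B x; lra.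
Qed.

Lemma opnorm_scal a A : opnorm (bscal a A) = Cabs a * opnorm A.
Proof.
have H b B : opnorm (bscal b B) <= Cabs b * opnorm B.
  apply: opnorm_lub; first by apply: Rmult_le_pos; [exact: Cabs_nonneg|exact: opnorm_nonneg].
  move=> x /=; rewrite vnorm_scal Rmult_assoc; apply: Rmult_le_compat_l; [exact: Cabs_nonneg|exact: opnorm_spec].
apply: Rle_antisym => //.
case: (classic (a = C0)) => [->|Ha]; first by rewrite Cabs_C0 Rmult_0_l; exact: opnorm_nonneg.
have Hp := Cabs_pos Ha.
have E : A = bscal (Cinv a) (bscal a A).
  by apply: Bop_ext => x /=; rewrite vscal_assoc Cinv_l // vscal_1.
have := H (Cinv a) (bscal a A); rewrite -E Cabs_inv // => H2.
apply: (Rmult_le_reg_l (/ Cabs a)); first exact: Rinv_0_lt_compat.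
by rewrite -Rmult_assoc Rinv_l ?Rmult_1_l //; lra.
Qed.

Lemma bop_complete (u : nat -> Bop X) :
  (forall eps, 0 < eps -> exists N, forall m n, (N <= m)%nat -> (N <= n)%nat ->
          opnorm (badd (u m) (bopp (u n))) < eps) ->
  exists l, forall eps, 0 < eps -> exists N, forall n, (N <= n)%nat ->
          opnorm (badd (u n) (bopp l)) < eps.
Proof.
move=> HC.
have Hx x : exists l, converges (fun n => u n x) l.
  apply: vcomplete => e e0; case: (HC (e / (<|x|> + 1))).
    by apply: Rdiv_lt_0_compat => //; have := vnorm_nonneg x; lra.
  move=> N H; exists N => m n Hm Hn; have := opnorm_spec (badd (u m) (bopp (u n))) x => /= H1.
  apply: Rle_lt_trans H1 _; have {}H := H m n Hm Hn; have P := vnorm_nonneg x.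
  have : e = e / (<|x|> + 1) * (<|x|> + 1) by field; lra.
  have := opnorm_nonneg (badd (u m) (bopp (u n))); nra.
pose f x := proj1_sig (constructive_indefinite_description _ (Hx x)).
have Hf x : converges (fun n => u n x) (f x).
  by rewrite /f; case: (constructive_indefinite_description _ _).
have HB e : 0 < e -> exists N, forall n, (N <= n)%nat -> forall x, <|u n x -v f x|> <= e * <|x|>.
  move=> e0; case: (HC e e0) => N H; exists N => n Hn x.
  apply: (converges_norm_le (u := fun m => u n x -v u m x)).
    by apply: converges_sub => //; exact: converges_const.
  exists N => m Hm; have := opnorm_spec (badd (u n) (bopp (u m))) x => /= H1.
  apply: Rle_trans H1 _; apply: Rmult_le_compat_r; first exact: vnorm_nonneg.
  by have := H n m Hn Hm; lra.
have bf : bounded_op f.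
  split; first by move=> x y; apply: (converges_unique (Hf _)); move: (converges_add (Hf x) (Hf y)) => H e e0;
    case: (H e e0) => N HN; exists N => n Hn; rewrite bopD; exact: HN.
  split; first by move=> a x; apply: (converges_unique (Hf _)); move: (converges_scal a (Hf x)) => H e e0;
    case: (H e e0) => N HN; exists N => n Hn; rewrite bopZ; exact: HN.
  case: (HB 1); first lra. move=> N /(_ N (le_n _)) H; exists (opnorm (u N) + 1) => x.
  have -> : f x = u N x -v (u N x -v f x) by vring.
  apply: Rle_trans (vnorm_sub_le _ _) _.
  have := H x; have := opnorm_spec (u N) x; lra.
exists (mkBop bf) => e e0; case: (HB (e / 2)); first lra.
move=> N H; exists N => n Hn; apply: Rle_lt_trans (_ : e / 2 < e); last lra.
by apply: opnorm_lub; [lra|move=> x /=; exact: H].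
Qed.

(** Operators form a [CBanach] again, so every result applies to operators acting on operators, such
    as the multiplications [lr A B]. The definition is transparent so that the carrier of [opB X]
    converts to [Bop X]. *)
Definition opB : CBanach.
Proof.
refine (@Build_CBanach (Bop X) bzero badd bopp bscal opnorm _ _ _ _ _ _ _ _ opnorm_nonneg opnorm_eq0 opnorm_tri opnorm_scal bop_complete).
- by move=> A B D; apply: Bop_ext => x /=; vring.
- by move=> A B; apply: Bop_ext => x /=; vring.
- by move=> A; apply: Bop_ext => x /=; vring.
- by move=> A; apply: Bop_ext => x /=; vring.
- by move=> A; apply: Bop_ext => x /=; vring.
- by move=> a b A; apply: Bop_ext => x /=; vring.
- by move=> a A B; apply: Bop_ext => x /=; vring.
- by move=> a b A; apply: Bop_ext => x /=; vring.
Defined.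
Canonical opB.

Lemma badd_app A B x : (A +v B : Bop X) x = A x +v B x. Proof. by []. Qed.
Lemma bopp_app A x : (-v A : Bop X) x = -v A x. Proof. by []. Qed.
Lemma bscal_app a A x : (a *v A : Bop X) x = a *v A x. Proof. by []. Qed.
Lemma bzero_app x : (0v : Bop X) x = 0v. Proof. by []. Qed.

Lemma bop_le T x : <|T x|> <= <|T|> * <|x|>. Proof. exact: opnorm_spec. Qed.
Lemma bop_lub T M : 0 <= M -> (forall x, <|T x|> <= M * <|x|>) -> <|T|> <= M.
Proof. exact: opnorm_lub. Qed.

Lemma cmp_bounded A B : bounded_op (fun x => A (B x)).
Proof.
split; first by move=> x y; rewrite !bopD.
split; first by move=> a x; rewrite !bopZ.
exists (<|A|> * <|B|>) => x; apply: Rle_trans (bop_le A _) _.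
rewrite Rmult_assoc; apply: Rmult_le_compat_l; [exact: vnorm_nonneg|exact: bop_le].
Qed.
Definition cmp A B := mkBop (cmp_bounded A B).

Lemma idB_bounded : bounded_op (fun x : X => x).
Proof. by split=> //; split=> //; exists 1 => x; lra. Qed.
Definition idB := mkBop idB_bounded.

Fixpoint pw A n := match n with O => idB | S n => cmp A (pw A n) end.
End Operators.

Notation "A ∘ B" := (cmp A B) (at level 40, left associativity).
Arguments idB {X}.

Lemma cmp_app X (A B : Bop X) x : (A ∘ B) x = A (B x). Proof. by []. Qed.
Lemma idB_app (X : CBanach) (x : X) : idB x = x. Proof. by []. Qed.

#[global] Hint Rewrite badd_app bopp_app bscal_app bzero_app cmp_app idB_app bopD bopN bopZ bop0 : bop.

Ltac bext x := apply: Bop_ext => x; autorewrite with bop; try solve [vring].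

Section Algebra.
Variable X : CBanach.
Implicit Types (A B D T R S : Bop X) (x y : X).

Lemma cmpA A B D : A ∘ (B ∘ D) = A ∘ B ∘ D. Proof. by apply: Bop_ext. Qed.
Lemma cmp1l A : idB ∘ A = A. Proof. by apply: Bop_ext. Qed.
Lemma cmp1r A : A ∘ idB = A. Proof. by apply: Bop_ext. Qed.
Lemma cmpDl A B D : (A +v B) ∘ D = A ∘ D +v B ∘ D. Proof. by apply: Bop_ext. Qed.
Lemma cmpDr A B D : D ∘ (A +v B) = D ∘ A +v D ∘ B. Proof. bext x. Qed.
Lemma cmpNl A D : (-v A) ∘ D = -v (A ∘ D). Proof. by apply: Bop_ext. Qed.
Lemma cmpNr A D : D ∘ (-v A) = -v (D ∘ A). Proof. bext x. Qed.
Lemma cmpZl a A D : (a *v A) ∘ D = a *v (A ∘ D). Proof. by apply: Bop_ext. Qed.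
Lemma cmpZr a A D : D ∘ (a *v A) = a *v (D ∘ A). Proof. bext x. Qed.
Lemma cmp0l A : (0v : Bop X) ∘ A = 0v. Proof. by apply: Bop_ext. Qed.
Lemma cmp0r A : A ∘ (0v : Bop X) = 0v. Proof. bext x. Qed.

Lemma bnorm_cmp A B : <|A ∘ B|> <= <|A|> * <|B|>.
Proof.
apply: bop_lub; first by apply: Rmult_le_pos; exact: vnorm_nonneg.
move=> x; rewrite cmp_app; apply: Rle_trans (bop_le A _) _.
rewrite Rmult_assoc; apply: Rmult_le_compat_l; [exact: vnorm_nonneg|exact: bop_le].
Qed.

Lemma bnorm_id : <|(idB : Bop X)|> <= 1.
Proof. by apply: bop_lub; [lra|move=> x; rewrite idB_app; lra]. Qed.

Lemma pwS A n : pw A (S n) = A ∘ pw A n. Proof. by []. Qed.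
Lemma pwD A m n : pw A (m + n) = pw A m ∘ pw A n.
Proof. by elim: m => [|m IH] /=; rewrite ?cmp1l // IH cmpA. Qed.
Lemma pw1 A : pw A 1 = A. Proof. exact: cmp1r. Qed.
Lemma pwSr A n : pw A (S n) = pw A n ∘ A.
Proof. by rewrite -Nat.add_1_r pwD pw1. Qed.
Lemma pwZ a A n : exists c, pw (a *v A) n = c *v pw A n /\ Cabs c = Cabs a ^ n.
Proof.
elim: n => [|n [c [E Hc]]]; first by exists C1; split; [bext x|exact: Cabs_C1].
exists (Cmul a c); rewrite !pwS E cmpZl cmpZr vscal_assoc; split=> //.
by rewrite Cabs_mul Hc.
Qed.
Lemma bnorm_pw A n : <|pw A n|> <= <|A|> ^ n.
Proof.
elim: n => [|n IH]; first exact: bnorm_id.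
apply: Rle_trans (bnorm_cmp _ _) _; apply: Rmult_le_compat_l => //; exact: vnorm_nonneg.
Qed.
Lemma pw_app A n x : pw A (S n) x = A (pw A n x). Proof. by []. Qed.

Definition comm A B := A ∘ B = B ∘ A.
Lemma comm_pw A B n : comm A B -> comm A (pw B n).
Proof.
move=> H; elim: n => [|n IH]; first by rewrite /comm cmp1l cmp1r.
by rewrite /comm pwS cmpA H -cmpA IH cmpA.
Qed.
Lemma comm_sym A B : comm A B -> comm B A. Proof. by rewrite /comm => ->. Qed.
Lemma pw_cmp A B n : comm A B -> pw (A ∘ B) n = pw A n ∘ pw B n.
Proof.
move=> H; elim: n => [|n IH]; first by rewrite cmp1l.
rewrite !pwS IH -!cmpA; congr (_ ∘ _); rewrite !cmpA; congr (_ ∘ _).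
exact: (comm_pw n (comm_sym H)).
Qed.

Lemma conv_app (u : nat -> Bop X) T x : converges u T -> converges (fun n => u n x) (T x).
Proof.
move=> H e e0; have P := vnorm_nonneg x.
case: (H (e / (<|x|> + 1))); first by apply: Rdiv_lt_0_compat; lra.
move=> N HN; exists N => n Hn.
have -> : u n x -v T x = (u n -v T : Bop X) x by autorewrite with bop.
apply: Rle_lt_trans (bop_le _ _) _; have := HN n Hn => H1.
have : e = e / (<|x|> + 1) * (<|x|> + 1) by field; lra.
have := vnorm_nonneg (u n -v T); nra.
Qed.

Lemma conv_bop (u : nat -> X) l T : converges u l -> converges (fun n => T (u n)) (T l).
Proof.
move=> H e e0; have P := vnorm_nonneg T.
case: (H (e / (<|T|> + 1))); first by apply: Rdiv_lt_0_compat; lra.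
move=> N HN; exists N => n Hn; rewrite -bopN -bopD.
apply: Rle_lt_trans (bop_le _ _) _; have := HN n Hn => H1.
have : e = e / (<|T|> + 1) * (<|T|> + 1) by field; lra.
have := vnorm_nonneg (u n -v l); nra.
Qed.

Lemma conv_cmp (u v : nat -> Bop X) A B : converges u A -> converges v B ->
  converges (fun n => u n ∘ v n) (A ∘ B).
Proof.
move=> Hu Hv e e0; case: (converges_bounded Hu) => M HM; have PB := vnorm_nonneg B.
have M0 : 0 <= M by apply: Rle_trans (HM 0%nat); exact: vnorm_nonneg.
case: (Hu (e / (2 * (<|B|> + 1)))); first by apply: Rdiv_lt_0_compat; lra.
move=> N1 H1; case: (Hv (e / (2 * (M + 1)))); first by apply: Rdiv_lt_0_compat; lra.
move=> N2 H2; exists (max N1 N2) => n Hn.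
have -> : u n ∘ v n -v A ∘ B = u n ∘ (v n -v B) +v (u n -v A) ∘ B by bext x.
apply: Rle_lt_trans (vnorm_triangle _ _) _.
have E1 := bnorm_cmp (u n) (v n -v B); have E2 := bnorm_cmp (u n -v A) B.
have F1 := H1 n ltac:(lia); have F2 := H2 n ltac:(lia).
have P1 := vnorm_nonneg (v n -v B); have P2 := vnorm_nonneg (u n -v A); have P3 := vnorm_nonneg (u n).
have G1 : <|u n|> * <|v n -v B|> < e / 2.
  apply: Rle_lt_trans (_ : (M + 1) * <|v n -v B|> < _); first by have := HM n; nra.
  apply: Rlt_le_trans (_ : (M + 1) * (e / (2 * (M + 1))) <= _); last by right; field; lra.
  by apply: Rmult_lt_compat_l; lra.
have G2 : <|u n -v A|> * <|B|> <= e / 2.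
  apply: Rle_trans (_ : <|u n -v A|> * (<|B|> + 1) <= _); first nra.
  apply: Rle_trans (_ : (e / (2 * (<|B|> + 1))) * (<|B|> + 1) <= _); last by right; field; lra.
  by apply: Rmult_le_compat_r; lra.
lra.
Qed.

Definition inv A R := A ∘ R = idB /\ R ∘ A = idB.

Lemma inv_uniq A R S : inv A R -> inv A S -> R = S.
Proof. by move=> [H1 H2] [H3 H4]; rewrite -(cmp1r R) -H3 cmpA H2 cmp1l. Qed.
Lemma inv_sym A R : inv A R -> inv R A. Proof. by case. Qed.
Lemma inv_cmp A B R S : inv A R -> inv B S -> inv (A ∘ B) (S ∘ R).
Proof.
move=> [H1 H2] [H3 H4]; split.
  by rewrite -cmpA (cmpA B) H3 cmp1l.
by rewrite -cmpA (cmpA R) H2 cmp1l.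
Qed.
Lemma inv_comm A B R : inv A R -> comm A B -> comm R B.
Proof.
move=> [H1 H2] H; rewrite /comm -{1}(cmp1r B) -H1 (cmpA B) -H !cmpA H2 cmp1l //.
Qed.
Lemma inv_scal a A R : a <> C0 -> inv A R -> inv (a *v A) (Cinv a *v R).
Proof.
move=> Ha [H1 H2]; split; rewrite cmpZl cmpZr vscal_assoc ?H1 ?H2 ?Cinv_l ?Cinv_r //; exact: vscal_1.
Qed.

Fixpoint psum (D : Bop X) n : Bop X := match n with O => 0v | S n => psum D n +v pw D n end.

(** Only the powers of [D] are assumed to decay, which covers operators of large norm and small
    spectral radius. The inverse is a limit of polynomials in [D], hence keeps every closed subspace
    that [D] keeps. *)
Lemma neumann D K t : 0 <= t < 1 -> (forall n, <|pw D n|> <= K * t ^ n) ->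
  exists R, inv (idB -v D) R /\ <|R|> <= K / (1 - t) /\
    (forall V, closed_subspace V -> (forall x, V x -> V (D x)) -> forall x, V x -> V (R x)).
Proof.
move=> Ht H.
case: (@geom_cauchy (opB X) (psum D) K t Ht).
  move=> n; have -> : psum D (S n) -v psum D n = pw D n by cbn [psum]; vring.
  exact: H.
move=> R [HR HB]; exists R; split; last split.
- have E n : (idB -v D) ∘ psum D n = idB -v pw D n /\ psum D n ∘ (idB -v D) = idB -v pw D n.
    elim: n => [|n [IH1 IH2]]; first by split; cbn [psum pw]; bext x.
    split; cbn [psum].
      by rewrite cmpDr IH1 cmpDl cmpNl cmp1l -pwS; vring.
    by rewrite cmpDl IH2 cmpDr cmpNr cmp1r -pwSr; vring.
  have Z : converges (fun n => idB -v pw D n) (idB : Bop X).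
    have {2}-> : (idB : Bop X) = idB -v 0v by vring.
    apply: converges_sub; first exact: converges_const.
    have B0 : 0 <= K by have := H 0%nat; have := vnorm_nonneg (pw D 0); cbn; lra.
    move=> e e0; case: (pow_lt_small Ht (e := e / (K + 1))); first by apply: Rdiv_lt_0_compat; lra.
    move=> N HN; exists N => n Hn; have -> : pw D n -v 0v = pw D n by vring.
    apply: Rle_lt_trans (H n) _; have F := HN n Hn.
    have : 0 <= t ^ n by apply: pow_le; lra.
    have : e = e / (K + 1) * (K + 1) by field; lra.
    nra.
  split.
    apply: (converges_unique (u := fun n => (idB -v D) ∘ psum D n)).
      by apply: conv_cmp => //; exact: converges_const.
    by move=> e e0; case: (Z e e0) => N HN; exists N => n Hn; rewrite (proj1 (E n)); exact: HN.
  apply: (converges_unique (u := fun n => psum D n ∘ (idB -v D))).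
    by apply: conv_cmp => //; exact: converges_const.
  by move=> e e0; case: (Z e e0) => N HN; exists N => n Hn; rewrite (proj2 (E n)); exact: HN.
- have := HB 0%nat; have -> : R -v psum D 0 = R by cbn [psum]; vring.
  by rewrite pow_O Rmult_1_r.
- move=> V HV HD x Hx; case: (HV) => [V0 [Va [Vs Vc]]].
  have Hp n : V (pw D n x) by elim: n => [|n IH] //; rewrite pw_app; exact: HD.
  apply: (Vc (fun n => psum D n x)); last exact: conv_app.
  elim=> [|n IH]; first exact: V0. by apply: Va.
Qed.

Lemma neumann_half D : <|D|> <= / 2 ->
  exists R, inv (idB -v D) R /\ <|R|> <= 2 /\
    (forall V, closed_subspace V -> (forall x, V x -> V (D x)) -> forall x, V x -> V (R x)).
Proof.
move=> H; case: (@neumann D 1 (/ 2)); first lra.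
  move=> n; rewrite Rmult_1_l; apply: Rle_trans (bnorm_pw _ _) _; apply: pow_incr.
  by split=> //; exact: vnorm_nonneg.
move=> R [H1 [H2 H3]]; exists R; split=> //; split=> //; lra.
Qed.

(** [A'] factors as A (1 - D) with D = R (A - A') of norm at most 1/2. The clause on [V] is what
    carries invariance along a path of resolvents. *)
Lemma inv_perturb A A' R M : inv A R -> <|R|> <= M -> <|A' -v A|> * M <= / 2 ->
  exists R', inv A' R' /\ <|R'|> <= 2 * M /\
    (forall V, closed_subspace V -> (forall x, V x -> V (R x)) ->
       (forall x, V x -> V ((A' -v A) x)) -> forall x, V x -> V (R' x)).
Proof.
move=> HA HM H; pose D := R ∘ (A -v A').
have M0 : 0 <= M by apply: Rle_trans HM; exact: vnorm_nonneg.
case: (@neumann_half D).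
  apply: Rle_trans (bnorm_cmp _ _) _; rewrite vnorm_sub_sym.
  have := vnorm_nonneg (A' -v A); nra.
move=> Q [HQ [HQn HQV]]; exists (Q ∘ R).
have E : A' = A ∘ (idB -v D).
  rewrite cmpDr cmpNr cmp1r /D cmpA (proj1 HA) cmp1l; vring.
split; first by rewrite E; exact: inv_cmp.
split.
  apply: Rle_trans (bnorm_cmp _ _) _; have := vnorm_nonneg R; have := vnorm_nonneg Q; nra.
move=> V HV HR HD x Hx; rewrite cmp_app; apply: HQV => //; last exact: HR.
move=> y Hy; rewrite /D cmp_app; apply: HR.
case: (HV) => [V0 [Va [Vs Vc]]].
have -> : (A -v A') y = Copp C1 *v ((A' -v A) y) by autorewrite with bop; vring.
by apply: Vs; exact: HD.
Qed.
End Algebra.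

(** * Compactness of sequences and finite-dimensional subspaces *)

Fixpoint flist (T : Type) (f : nat -> T) n : list T :=
  match n with O => [] | S n => f n :: flist f n end.

Lemma In_flist T (f : nat -> T) n i : (i < n)%nat -> In (f i) (flist f n).
Proof.
elim: n => [|n IH] Hi; first lia.
case: (Nat.eq_dec i n) => [->|Hne]; [by left|right; apply: IH; lia].
Qed.

Lemma flist_In T (f : nat -> T) n a : In a (flist f n) -> exists2 i, (i < n)%nat & a = f i.
Proof.
elim: n => [|n IH] //= [<-|/IH [i Hi ->]]; first by exists n.
by exists i => //; lia.
Qed.

(** Dependent choice in the form used throughout: each term is chosen relative to the list of all
    earlier ones, the most recent first. *)
Lemma greedy T (P : list T -> T -> Prop) : (forall l, exists a, P l a) ->
  exists f : nat -> T, forall n, P (flist f n) (f n).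
Proof.
move=> H; pose c l := proj1_sig (constructive_indefinite_description _ (H l)).
have Hc l : P l (c l) by rewrite /c; case: (constructive_indefinite_description _ _).
pose g := fix g n := match n with O => [] | S n => c (g n) :: g n end.
exists (fun n => c (g n)) => n.
have -> : flist (fun n => c (g n)) n = g n by elim: n => [|n IH] //=; rewrite IH.
exact: Hc.
Qed.

Definition incr (phi : nat -> nat) := forall n, (phi n < phi (S n))%nat.
Definition infinite (P : nat -> Prop) := forall N, exists2 n, (N <= n)%nat & P n.

Lemma incr_comp phi psi : incr phi -> incr psi -> incr (fun n => phi (psi n)).
Proof. by move=> H1 H2 n; apply: subseq_mono. Qed.

Lemma infinite_seq P : infinite P -> exists phi, incr phi /\ forall n, P (phi n).
Proof.
move=> HP; case: (@greedy nat (fun l a => P a /\ forall b, In b l -> (b < a)%nat)).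
  move=> l; have [N HN] : exists N, forall b, In b l -> (b < N)%nat.
    elim: l => [|b l [N HN]]; first by exists 0%nat.
    by exists (S (max b N)) => x /= [<-|/HN]; lia.
  by case: (HP N) => n Hn Pn; exists n; split=> // b /HN; lia.
move=> f Hf.
exists f; split; last by move=> n; case: (Hf n).
by move=> n; case: (Hf (S n)) => _; apply; left.
Qed.

Lemma seq_dec (P : nat -> nat -> Prop) : (forall k, infinite (P k)) ->
  (forall k n, P (S k) n -> P k n) -> exists phi, incr phi /\ forall k n, (k <= n)%nat -> P k (phi n).
Proof.
move=> HP Hd.
case: (@greedy nat (fun l a => P (length l) a /\ forall b, In b l -> (b < a)%nat)).
  move=> l; have [N HN] : exists N, forall b, In b l -> (b < N)%nat.
    elim: l => [|b l [N HN]]; first by exists 0%nat.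
    by exists (S (max b N)) => x /= [<-|/HN]; lia.
  by case: (HP (length l) N) => n Hn Pn; exists n; split=> // b /HN; lia.
move=> f Hf.
have Hl n : length (flist f n) = n by elim: n => //= n ->.
exists f; split; first by move=> n; case: (Hf (S n)) => _; apply; left.
move=> k n Hkn; have := proj1 (Hf n); rewrite Hl => Pn.
have Hd' j i : P (i + j)%nat (f n) -> P i (f n).
  elim: j => [|j IH]; rewrite ?Nat.add_0_r ?Nat.add_succ_r // => Hj; apply: IH; exact: Hd.
apply: (Hd' (n - k)%nat); by have -> : (k + (n - k) = n)%nat by lia.
Qed.

Lemma inv_pow2_small e : 0 < e -> exists k, (/ 2) ^ k < e.
Proof. by move=> e0; case: (@pow_lt_small (/ 2) ltac:(lra) e e0) => N H; exists N; apply: H. Qed.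

Section Precompact.
Variable X : CBanach.

Definition precomp (u : nat -> X) := exists (phi : nat -> nat) l, incr phi /\ converges (fun n => u (phi n)) l.
Definition close_pairs (u : nat -> X) := forall P, infinite P -> forall e, 0 < e ->
  exists i j, (i < j)%nat /\ P i /\ P j /\ <|u i -v u j|> < e.

(** If each index in [P] had only finitely many others in [P] with values within e/2, a greedy
    choice would produce an e/2-separated infinite subfamily, against [close_pairs]. So some ball of
    radius e/2 catches infinitely many terms. *)
Lemma close_refine u P e : close_pairs u -> infinite P -> 0 < e ->
  exists Q, infinite Q /\ (forall n, Q n -> P n) /\ (forall i j, Q i -> Q j -> <|u i -v u j|> < e).
Proof.
move=> Hu HP e0.
case: (classic (exists2 i, P i & infinite (fun j => P j /\ <|u i -v u j|> < e / 2))).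
  move=> [i Pi Hi]; exists (fun j => P j /\ <|u i -v u j|> < e / 2); split=> //; split; first by move=> n [].
  move=> j k [_ Hj] [_ Hk]; apply: Rle_lt_trans (vnorm_tri _ (u i) _) _.
  rewrite vnorm_sub_sym; lra.
move=> H; exfalso.
have Hbad i : exists N, P i -> forall j, (N <= j)%nat -> P j -> e / 2 <= <|u i -v u j|>.
  apply: NNPP => K; apply: H; exists i.
    by apply: NNPP => Pi; apply: K; exists 0%nat.
  move=> N; apply: NNPP => K2; apply: K; exists N => Pi j Hj Pj.
  apply: Rnot_lt_le => Hlt; apply: K2; by exists j.
case: (@greedy nat (fun l a => P a /\ forall b, In b l -> (b < a)%nat /\ (P b -> e / 2 <= <|u b -v u a|>))).
  move=> l; have [N HN] : exists N, forall b, In b l -> (b < N)%nat /\ (P b -> forall j, (N <= j)%nat -> P j -> e / 2 <= <|u b -v u j|>).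
    elim: l => [|b l [N HN]]; first by exists 0%nat.
    case: (Hbad b) => M HM; exists (S (max b (max M N))) => x /= [<-|/HN [H1 H2]].
      by split; [lia|move=> Pb j Hj; apply: HM => //; lia].
    by split; [lia|move=> Pb j Hj; apply: H2 => //; lia].
  case: (HP N) => n Hn Pn; exists n; split=> // b /HN [H1 H2].
  by split; [lia|move=> Pb; exact: H2].
move=> f Hf.
have Hinc : incr f by move=> n; case: (Hf (S n)) => _ /(_ (f n)); case=> //; left.
case: (Hu (fun n => exists k, n = f k) _ (e / 2)); last 2 first.
- lra.
- move=> i [j [Hij [[a Ea] [[b Eb] Hlt]]]]; subst i j.
  have Hab : (a < b)%nat.
    apply: NNPP => K; case: (Nat.eq_dec a b) => [E|Hne]; first by rewrite E in Hij; lia.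
    have := @subseq_mono f Hinc b a ltac:(lia); lia.
  case: (Hf b) => _ /(_ (f a) (In_flist f Hab)) [_ /(_ (proj1 (Hf a)))]; lra.
- move=> N; exists (f N); last by exists N.
  exact: subseq_ge.
Qed.

(** Index sets of diameter below (1/2)^k are nested by [close_refine], and a diagonal subsequence is
    Cauchy. *)
Lemma precompP u : close_pairs u -> precomp u.
Proof.
move=> Hu; pose T := {P | infinite P}.
have HT : infinite (fun _ => True) by move=> N; exists N.
pose step (k : nat) (P : T) : T :=
  let H := close_refine Hu (proj2_sig P) (pow_lt _ k (ltac:(lra) : 0 < / 2)) in
  let Q := constructive_indefinite_description _ H in
  exist infinite (proj1_sig Q) (proj1 (proj2_sig Q)).
pose PP := fix PP k := match k with O => exist infinite _ HT : T | S k => step k (PP k) end.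
case: (@seq_dec (fun k n => proj1_sig (PP k) n)).
- by move=> k; case: (PP k).
- move=> k n /=; rewrite /step /=.
  case: (constructive_indefinite_description _ _) => Q /= [H1 [H2 H3]]; exact: H2.
- move=> phi [Hi Hphi].
have [l Hl] : exists l, converges (fun n => u (phi n)) l.
  apply: vcomplete => e e0; case: (inv_pow2_small e0) => k Hk; exists (S k) => m n Hm Hn.
  have := Hphi (S k) m Hm; have := Hphi (S k) n Hn => /=; rewrite /step /=.
  case: (constructive_indefinite_description _ _) => Q /= [H1 [H2 H3]] Qn Qm.
  have := H3 _ _ Qm Qn; lra.
by exists phi, l.
Qed.

Lemma precomp_close (u : nat -> X) (P : nat -> Prop) :
  (forall phi, incr phi -> (forall n, P (phi n)) -> precomp (fun n => u (phi n))) ->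
  infinite P -> forall e, 0 < e -> exists i j, (i < j)%nat /\ P i /\ P j /\ <|u i -v u j|> < e.
Proof.
move=> H HP e e0; case: (infinite_seq HP) => phi [Hphi HPp].
case: (H phi Hphi HPp) => psi [l [Hpsi Hl]].
case: (Hl (e / 2)); first lra. move=> N HN.
have Hi := incr_comp Hphi Hpsi.
exists (phi (psi N)), (phi (psi (S N))); split; first exact: Hi.
split=> //; split=> //; apply: Rle_lt_trans (vnorm_tri _ l _) _.
have A := HN N (le_n _); have B := HN (S N) ltac:(lia).
rewrite (vnorm_sub_sym l); lra.
Qed.

Lemma compact_precomp (T : X -> X) (u : nat -> X) M : compact_op T ->
  (forall n, <|u n|> <= M) -> precomp (fun n => T (u n)).
Proof.
move=> [_ H] HM; case: (H u); first by exists M. by move=> phi [l [H1 H2]]; exists phi, l.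
Qed.

Lemma precomp_pair (u : nat -> X) e : precomp u -> 0 < e -> exists i j, (i < j)%nat /\ <|u i -v u j|> < e.
Proof.
move=> [phi [l [Hphi Hl]]] e0; case: (Hl (e / 2)); first lra. move=> N HN.
exists (phi N), (phi (S N)); split; first exact: Hphi.
apply: Rle_lt_trans (vnorm_tri _ l _) _.
have A := HN N (le_n _); have B := HN (S N) ltac:(lia).
rewrite (vnorm_sub_sym l); lra.
Qed.

Definition subsp (V : X -> Prop) := V 0v /\ (forall x y, V x -> V y -> V (x +v y)) /\ (forall c x, V x -> V (c *v x)).

Lemma closed_subsp V : closed_subspace V -> subsp V.
Proof. by move=> [H0 [Ha [Hs _]]]. Qed.

Lemma subsp_opp V x : subsp V -> V x -> V (-v x).
Proof. by move=> [_ [_ H]] Vx; rewrite vopp_scal; exact: H. Qed.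
Lemma subsp_sub V x y : subsp V -> V x -> V y -> V (x -v y).
Proof. by move=> H Vx Vy; apply: (proj1 (proj2 H)) => //; exact: subsp_opp. Qed.

Fixpoint span (l : list X) (x : X) : Prop :=
  match l with [] => x = 0v | v :: l => exists c y, span l y /\ x = c *v v +v y end.

Lemma span_subsp l : subsp (span l).
Proof.
elim: l => [|v l [I0 [Ia Is]]].
  split=> //; split; first by move=> x y /= -> ->; vring.
  by move=> c x /= ->; vring.
split; first by exists C0, 0v; split=> //; vring.
split.
  move=> x y [c [x' [Hx ->]]] [d [y' [Hy ->]]]; exists (Cadd c d), (x' +v y').
  by split; [exact: Ia|vring].
move=> a x [c [x' [Hx ->]]]; exists (Cmul a c), (a *v x'); split; [exact: Is|vring].
Qed.

Lemma span_In l v : In v l -> span l v.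
Proof.
elim: l => [|w l IH] //= [->|/IH H].
  by exists C1, 0v; split; [exact: (proj1 (span_subsp l))|vring].
by exists C0, v; split=> //; vring.
Qed.

Lemma span_min l V : subsp V -> (forall v, In v l -> V v) -> forall x, span l x -> V x.
Proof.
move=> [V0 [Va Vs]]; elim: l => [|v l IH] H x /=; first by move=> ->.
move=> [c [y [Hy ->]]]; apply: Va; first by apply: Vs; apply: H; left.
by apply: IH => // w Hw; apply: H; right.
Qed.

Lemma span_cons l v x : span l x -> span (v :: l) x.
Proof. by move=> H; exists C0, x; split=> //; vring. Qed.

(** This dichotomy takes the place of dimension: a subspace that is not the whole span has a
    strictly shorter spanning list of its own elements. The lists need not be independent. *)
Lemma subspan (E : X -> Prop) l : subsp E -> (forall x, E x -> span l x) ->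
  (forall x, span l x -> E x) \/
  exists l', (length l' < length l)%nat /\ (forall x, E x -> span l' x) /\ (forall x, In x l' -> E x).
Proof.
elim: l E => [|v l IH] E HE HEl.
  by left=> x ->; exact: (proj1 HE).
case: (classic (forall x, E x -> span l x)) => [H|H].
  right; case: (IH E HE H) => [H2|[l' [L1 [L2 L3]]]]; last by exists l'; split=> //=; lia.
  by exists l; split=> //=; split=> // x Hx; apply: H2; exact: span_In.
have [u [Eu Hu]] : exists u, E u /\ ~ span l u.
  by apply: NNPP => K; apply: H => x Ex; apply: NNPP => K2; apply: K; exists x.
case: (HEl u Eu) => c [y [Hy Eqy]].
have Hc : c <> C0.
  by move=> E0; apply: Hu; rewrite Eqy E0; have -> : C0 *v v +v y = y by vring.
(* Elimination with pivot [u], whose coefficient at [v] is nonzero: subtracting a multiple of [u]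
   moves every element of [E] into the span of the tail. *)
have Hred x : E x -> exists d, span l (x -v d *v u) /\ E (x -v d *v u).
  move=> Ex; case: (HEl x Ex) => a [z [Hz Eqz]]; exists (Cmul a (Cinv c)).
  have -> : x -v Cmul a (Cinv c) *v u = z -v Cmul a (Cinv c) *v y.
    rewrite Eqz {1}Eqy vscal_distr_v vscal_assoc.
    rewrite CmulVK //; vring.
  split.
    by apply: subsp_sub => //; [exact: span_subsp|apply: (proj2 (proj2 (span_subsp l)))].
  have -> : z -v Cmul a (Cinv c) *v y = x -v Cmul a (Cinv c) *v u.
    rewrite Eqz {1}Eqy vscal_distr_v vscal_assoc.
    rewrite CmulVK //; vring.
  by apply: subsp_sub => //; apply: (proj2 (proj2 HE)).
have Hsub : subsp (fun x => E x /\ span l x).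
  case: HE => [E0 [Ea Es]]; case: (span_subsp l) => [S0 [Sa Ss]].
  split; first by []. split; first by move=> x1 x2 [? ?] [? ?]; split; [exact: Ea|exact: Sa].
  by move=> d x [? ?]; split; [exact: Es|exact: Ss].
have Hexp d x : x = d *v u +v (x -v d *v u) by vring.
case: (IH _ Hsub) => [x [] //|H2|[l' [L1 [L2 L3]]]].
- left=> x [d [z [Hz ->]]]; case: (HE) => [E0 [Ea Es]].
  apply: Ea; last by apply: (proj1 (H2 z Hz)).
  apply: (Es); have -> : v = Cinv c *v (u -v y).
    have -> : u -v y = c *v v by rewrite Eqy; vring.
    by rewrite vscal_assoc Cinv_l // vscal_1.
  by apply: Es; apply: subsp_sub => //; apply: (proj1 (H2 y Hy)).
- right; exists (u :: l'); split; first by simpl; lia.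
  split.
    move=> x Ex; case: (Hred x Ex) => d [H1 H3]; exists d, (x -v d *v u); split=> //; exact: L2.
  by move=> x /= [<-|/L3 []].
Qed.

Lemma dist_pos (V : X -> Prop) (y : X) : closed_subspace V -> ~ V y -> exists2 d, 0 < d & forall v, V v -> d <= <|y -v v|>.
Proof.
move=> [V0 [Va [Vs Vc]]] Hy; apply: NNPP => K; apply: Hy.
have H k : exists v, V v /\ <|y -v v|> < (/ 2) ^ k.
  apply: NNPP => K2; apply: K; exists ((/ 2) ^ k); first by apply: pow_lt; lra.
  by move=> v Vv; apply: Rnot_lt_le => Hlt; apply: K2; exists v.
pose f k := proj1_sig (constructive_indefinite_description _ (H k)).
have Hf k : V (f k) /\ <|y -v f k|> < (/ 2) ^ k by rewrite /f; case: (constructive_indefinite_description _ _).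
apply: (Vc f); first by move=> n; case: (Hf n).
move=> e e0; case: (@pow_lt_small (/ 2) ltac:(lra) e e0) => N HN; exists N => n Hn.
rewrite vnorm_sub_sym; have := HN n Hn; have := proj2 (Hf n); lra.
Qed.

(** The vector is y - v0 normalised, with [v0] in [V] optimal up to a factor 2. Such a [v0] exists,
    since halving the distance forever would contradict the positive distance of [y] from [V]. *)
Lemma riesz_lemma (V W : X -> Prop) (y : X) : closed_subspace V -> subsp W -> (forall x, V x -> W x) -> W y -> ~ V y ->
  exists u, W u /\ <|u|> <= 1 /\ forall v, V v -> / 2 <= <|u -v v|>.
Proof.
move=> HV HW HVW Wy Hy; case: (dist_pos HV Hy) => d d0 Hd.
have [v0 [Vv0 Hv0]] : exists v0 : X, V v0 /\ forall v, V v -> <|y -v v0|> / 2 <= <|y -v v|>.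
  apply: NNPP => K.
  have H n : exists v, V v /\ <|y -v v|> <= <|y|> * (/ 2) ^ n.
    elim: n => [|n [v [Vv Hv]]].
      exists 0v; split; first exact: (proj1 HV).
      have -> : y -v 0v = y by vring.
      by rewrite /=; lra.
    have [w [Vw Hw]] : exists w, V w /\ <|y -v w|> < <|y -v v|> / 2.
      apply: NNPP => K2; apply: K; exists v; split=> // w Vw; apply: Rnot_lt_le => Hlt; apply: K2; by exists w.
    exists w; split=> //=; lra.
  have P := vnorm_nonneg y.
  case: (@inv_pow2_small (d / (<|y|> + 1))); first by apply: Rdiv_lt_0_compat; lra.
  move=> k Hk; case: (H k) => v [Vv Hv]; have := Hd v Vv.
  have : d = d / (<|y|> + 1) * (<|y|> + 1) by field; lra.
  have : 0 < (/ 2) ^ k by apply: pow_lt; lra.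
  nra.
have Hp : 0 < <|y -v v0|> by have := Hd v0 Vv0; lra.
have Hc : RtoC <|y -v v0|> <> C0 by apply: RtoC_neq0; lra.
have Hcab : Cabs (Cinv (RtoC <|y -v v0|>)) = / <|y -v v0|>.
  by rewrite Cabs_inv // Cabs_RtoC Rabs_right //; lra.
exists (Cinv (RtoC <|y -v v0|>) *v (y -v v0)); split; last split.
- by apply: (proj2 (proj2 HW)); apply: subsp_sub => //; exact: HVW.
- by rewrite vnorm_scal Hcab; right; field; lra.
- move=> v Vv; set c := Cinv _.
  have -> : c *v (y -v v0) -v v = c *v (y -v (v0 +v RtoC <|y -v v0|> *v v)).
    rewrite [in RHS]vopp_scal !vscal_distr_v !vscal_assoc.
    have -> : Cmul (Cmul c (Copp C1)) (RtoC <|y -v v0|>) = Copp C1.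
      by transitivity (Cmul (Copp C1) (Cmul c (RtoC <|y -v v0|>))); [ring|rewrite /c Cinv_l //; ring].
    vring.
  have Vw : V (v0 +v RtoC <|y -v v0|> *v v).
    by case: HV => [_ [Va [Vs _]]]; apply: Va => //; exact: Vs.
  rewrite vnorm_scal Hcab; have := Hv0 _ Vw.
  move=> H; apply: (Rmult_le_reg_l <|y -v v0|>) => //.
  by rewrite -Rmult_assoc Rinv_r ?Rmult_1_l; lra.
Qed.
End Precompact.

(** * Finite dimension, the Fredholm alternative and eigenvalues of compact operators *)

Lemma fchoice (A B : Type) (R : A -> B -> Prop) : (forall x, exists y, R x y) ->
  exists f, forall x, R x (f x).
Proof.
move=> H; exists (fun x => proj1_sig (constructive_indefinite_description _ (H x))) => x.
by case: (constructive_indefinite_description _ _).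
Qed.

Lemma Rabs_le_inv' x M : Rabs x <= M -> - M <= x <= M.
Proof. by rewrite /Rabs; case: Rcase_abs; lra. Qed.

Lemma R_BW (u : nat -> R) M : (forall n, Rabs (u n) <= M) ->
  exists phi l, incr phi /\ forall e, 0 < e -> exists N, forall n, (N <= n)%nat -> Rabs (u (phi n) - l) < e.
Proof.
move=> HM.
have [l Hl] := @Bolzano_Weierstrass u (fun c => - M <= c <= M) (compact_P3 (- M) M)
  (fun n => Rabs_le_inv' (HM n)).
have Hinf k : infinite (fun n => Rabs (u n - l) < (/ 2) ^ k).
  move=> N.
  case: (Hl (fun y => Rabs (y - l) < (/ 2) ^ k) N).
    exists (mkposreal _ (pow_lt (/ 2) k ltac:(lra))) => y; exact.
  by move=> p [Hp Hd]; exists p.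
case: (@seq_dec (fun k n => Rabs (u n - l) < (/ 2) ^ k)) => //.
  move=> k n /= H; have : 0 < (/ 2) ^ k by apply: pow_lt; lra. lra.
move=> phi [Hi Hphi]; exists phi, l; split=> // e e0.
case: (inv_pow2_small e0) => k Hk; exists k => n Hn; have := Hphi k n Hn; lra.
Qed.

Lemma Cabs_re a : Rabs (Cre a) <= Cabs a.
Proof.
rewrite -sqrt_Rsqr_abs /Cabs; apply: sqrt_le_1_alt; rewrite /Rsqr /=; nra.
Qed.
Lemma Cabs_im a : Rabs (Cim a) <= Cabs a.
Proof.
rewrite -sqrt_Rsqr_abs /Cabs; apply: sqrt_le_1_alt; rewrite /Rsqr /=; nra.
Qed.
Lemma Cabs_le_sum a : Cabs a <= Rabs (Cre a) + Rabs (Cim a).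
Proof.
apply: Cabs_le; first by have := Rabs_pos (Cre a); have := Rabs_pos (Cim a); lra.
have -> : Cre a ^ 2 = Rabs (Cre a) * Rabs (Cre a) by rewrite -Rabs_mult Rabs_right /=; nra.
have -> : Cim a ^ 2 = Rabs (Cim a) * Rabs (Cim a) by rewrite -Rabs_mult Rabs_right /=; nra.
have := Rabs_pos (Cre a); have := Rabs_pos (Cim a); nra.
Qed.

Definition Cconv (c : nat -> C) l := forall e, 0 < e -> exists N, forall n, (N <= n)%nat -> Cabs (Cminus (c n) l) < e.

Lemma C_BW (c : nat -> C) M : (forall n, Cabs (c n) <= M) ->
  exists phi l, incr phi /\ Cconv (fun n => c (phi n)) l.
Proof.
move=> HM; have [phi [a [Hphi Ha]]] := @R_BW (fun n => Cre (c n)) M (fun n => Rle_trans _ _ _ (Cabs_re _) (HM n)).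
have [psi [b [Hpsi Hb]]] := @R_BW (fun n => Cim (c (phi n))) M (fun n => Rle_trans _ _ _ (Cabs_im _) (HM (phi n))).
exists (fun n => phi (psi n)), (mkC a b); split; first exact: incr_comp.
move=> e e0; case: (Ha (e / 2)); first lra. move=> N1 H1; case: (Hb (e / 2)); first lra. move=> N2 H2.
exists (max N1 N2) => n Hn; apply: Rle_lt_trans (Cabs_le_sum _) _ => /=.
have := H1 (psi n); have := H2 n ltac:(lia); have := subseq_ge Hpsi n => ? ? /(_ ltac:(lia)) ?.
rewrite -!/(Rminus _ _); lra.
Qed.

Section FiniteDim.
Variable X : CBanach.

Lemma converges_cscal (c : nat -> C) a (v : X) : Cconv c a -> converges (fun n => c n *v v) (a *v v).
Proof.
move=> H e e0; have P := vnorm_nonneg v.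
case: (H (e / (<|v|> + 1))); first by apply: Rdiv_lt_0_compat; lra.
move=> N HN; exists N => n Hn; have -> : c n *v v -v a *v v = Cminus (c n) a *v v.
  rewrite /Cminus; vring.
rewrite vnorm_scal; have := HN n Hn; have := Cabs_nonneg (Cminus (c n) a).
have : e = e / (<|v|> + 1) * (<|v|> + 1) by field; lra.
nra.
Qed.

(** Induction on the list: the span of the tail is closed by the induction hypothesis, so [v] has
    positive distance d from it, and this bounds the coefficients of [v] by M / d. *)
Lemma span_compact (l : list X) (u : nat -> X) M : (forall n, span l (u n)) -> (forall n, <|u n|> <= M) ->
  exists phi x, incr phi /\ converges (fun n => u (phi n)) x /\ span l x.
Proof.
elim: l u M => [|v l IH] u M Hs HM.
  exists (fun n => n), 0v; split; first by move=> n; lia. split=> //.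
  have -> : (fun n => u n) = (fun _ => 0v) by apply: functional_extensionality.
  exact: converges_const.
case: (classic (span l v)) => Hv.
  have Hs' n : span l (u n).
    by apply: (@span_min X (v :: l)) (Hs n) => //; [exact: span_subsp|move=> w /= [<-|/span_In]].
  case: (IH u M Hs' HM) => phi [x [H1 [H2 H3]]]; exists phi, x; split=> //; split=> //.
  exact: span_cons.
have Hcl : closed_subspace (span l).
  case: (span_subsp l) => [S0 [Sa Ss]]; split=> //; split=> //; split=> // w x Hw Hx.
  case: (converges_bounded Hx) => M' HM'.
  case: (IH w M' Hw HM') => phi [y [H1 [H2 H3]]].
  by rewrite (converges_unique (converges_subseq H1 Hx) H2).
case: (dist_pos Hcl Hv) => d d0 Hd.
have [c Hc] := @fchoice nat C (fun n c => exists y, span l y /\ u n = c *v v +v y) Hs.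
have [y Hy] := @fchoice nat X (fun n y => span l y /\ u n = c n *v v +v y) Hc.
have Hcb n : Cabs (c n) <= M / d.
  apply: (Rmult_le_reg_r d) => //; have -> : M / d * d = M by field; lra.
  apply: Rle_trans (HM n); case: (classic (c n = C0)) => [->|Hn0].
    by rewrite Cabs_C0 Rmult_0_l; exact: vnorm_nonneg.
  case: (Hy n) => Sy ->.
  have -> : c n *v v +v y n = c n *v (v -v (Copp (Cinv (c n)) *v y n)).
    rewrite [in RHS]vopp_scal vscal_distr_v !vscal_assoc.
    have -> : Cmul (Cmul (c n) (Copp C1)) (Copp (Cinv (c n))) = C1 by field.
    vring.
  rewrite vnorm_scal; apply: Rmult_le_compat_l; first exact: Cabs_nonneg.
  by apply: Hd; apply: (proj2 (proj2 (span_subsp l))).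
case: (C_BW Hcb) => phi [a [Hphi Ha]].
case: (IH (fun n => y (phi n)) (M + M / d * <|v|>)).
- by move=> n; case: (Hy (phi n)).
- move=> n; have -> : y (phi n) = u (phi n) -v c (phi n) *v v by rewrite (proj2 (Hy (phi n))); vring.
  apply: Rle_trans (vnorm_sub_le _ _) _; rewrite vnorm_scal.
  have := HM (phi n); have := Hcb (phi n); have := vnorm_nonneg v; nra.
- move=> psi [z [Hpsi [Hz Sz]]]; exists (fun n => phi (psi n)), (a *v v +v z).
  split; first exact: incr_comp.
  split; last by exists a, z.
  have -> : (fun n => u (phi (psi n))) = (fun n => c (phi (psi n)) *v v +v y (phi (psi n))).
    by apply: functional_extensionality => n; case: (Hy (phi (psi n))).
  apply: converges_add => //; apply: converges_cscal => e e0.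
  case: (Ha e e0) => N HN; exists N => n Hn; apply: HN; have := subseq_ge Hpsi n; lia.
Qed.

Lemma span_closed (l : list X) : closed_subspace (span l).
Proof.
case: (span_subsp l) => [S0 [Sa Ss]]; split=> //; split=> //; split=> // w x Hw Hx.
case: (converges_bounded Hx) => M' HM'.
case: (span_compact Hw HM') => phi [y [H1 [H2 H3]]].
by rewrite (converges_unique (converges_subseq H1 Hx) H2).
Qed.

(** Riesz's criterion: in infinite dimension, vectors from [riesz_lemma] chosen greedily would form
    a 1/2-separated sequence in the unit ball of [Y]. *)
Lemma fd_of_pairs (Y : X -> Prop) : subsp Y ->
  (forall u : nat -> X, (forall n, Y (u n) /\ <|u n|> <= 1) -> exists i j, (i < j)%nat /\ <|u i -v u j|> < / 2) ->
  exists l, (forall x, In x l -> Y x) /\ forall x, Y x -> span l x.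
Proof.
move=> HY H; apply: NNPP => K.
case: (@greedy X (fun l a => (forall x, In x l -> Y x) -> Y a /\ <|a|> <= 1 /\ forall v, span l v -> / 2 <= <|a -v v|>)).
  move=> l; case: (classic (forall x, In x l -> Y x)) => [Hl|Hl]; last by exists 0v.
  have [y [Yy Ny]] : exists y, Y y /\ ~ span l y.
    apply: NNPP => K2; apply: K; exists l; split=> // x Yx; apply: NNPP => K3; apply: K2; by exists x.
  case: (riesz_lemma (span_closed l) HY (span_min HY Hl) Yy Ny) => w [H1 [H2 H3]].
  by exists w.
move=> f Hf.
have Yf n : forall x, In x (flist f n) -> Y x.
  elim: n => [|n IH] //= x [<-|/IH] //; by case: (Hf n IH).
case: (H f) => [n|i [j [Hij Hlt]]].
  by case: (Hf n (Yf n)) => [? [? _]].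
case: (Hf j (Yf j)) => _ [_ /(_ (f i) (span_In (In_flist f Hij)))].
rewrite vnorm_sub_sym; lra.
Qed.

Lemma bij_inv (A : Bop X) b : 0 < b -> (forall x, b * <|x|> <= <|A x|>) -> (forall y, exists x, A x = y) ->
  exists R, inv A R.
Proof.
move=> b0 Hb Hs; case: (@fchoice X X (fun y x => A x = y) Hs) => f Hf.
have inj x y : A x = A y -> x = y.
  move=> E; apply: vsub_eq0; apply: vnorm_small => e e0.
  have := Hb (x -v y); rewrite bopD bopN E vadd_opp vnorm_0.
  have := vnorm_nonneg (x -v y); nra.
have bf : bounded_op f.
  split; first by move=> x y; apply: inj; rewrite bopD !Hf.
  split; first by move=> a x; apply: inj; rewrite bopZ !Hf.
  exists (/ b) => y; apply: (Rmult_le_reg_l b) => //.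
  rewrite -Rmult_assoc Rinv_r ?Rmult_1_l; last lra.
  by have := Hb (f y); rewrite Hf.
exists (mkBop bf); split; apply: Bop_ext => x /=; first exact: Hf.
by apply: inj; rewrite Hf.
Qed.

Lemma compact_scal (K : Bop X) a : compact_op K -> compact_op (a *v K : Bop X).
Proof.
move=> [HK H]; split; first exact: (bprf (a *v K)).
move=> u Hu; case: (H u Hu) => phi [l [H1 H2]]; exists phi, (a *v l); split=> //.
exact: (converges_scal a H2).
Qed.

(** Unit vectors with x - K x tending to 0 accumulate, by compactness, at a fixed vector of norm at
    least 1. *)
Lemma bounded_below (K : Bop X) : compact_op K -> (forall x, x = K x -> x = 0v) ->
  exists2 b, 0 < b & forall x, b * <|x|> <= <|x -v K x|>.
Proof.
move=> HK Hinj; apply: NNPP => H.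
have [u Hu] : exists u : nat -> X, forall n, <|u n|> = 1 /\ <|u n -v K (u n)|> < (/ 2) ^ n.
  apply: (@fchoice nat X (fun n x => <|x|> = 1 /\ <|x -v K x|> < (/ 2) ^ n)) => n; apply: NNPP => Kn.
  have p0 : 0 < (/ 2) ^ n by apply: pow_lt; lra.
  apply: H; exists ((/ 2) ^ n) => // x; apply: Rnot_lt_le => Hlt; apply: Kn.
  have Hx : 0 < <|x|>.
    have := vnorm_nonneg x; case=> // E; move: Hlt; rewrite -E Rmult_0_r.
    by have := vnorm_nonneg (x -v K x); lra.
  have Hc : RtoC <|x|> <> C0 by apply: RtoC_neq0; lra.
  have Hcab : Cabs (Cinv (RtoC <|x|>)) = / <|x|> by rewrite Cabs_inv // Cabs_RtoC Rabs_right //; lra.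
  exists (Cinv (RtoC <|x|>) *v x); split.
    by rewrite vnorm_scal Hcab; field; lra.
  have -> : Cinv (RtoC <|x|>) *v x -v K (Cinv (RtoC <|x|>) *v x) = Cinv (RtoC <|x|>) *v (x -v K x) by rewrite bopZ; vring.
  rewrite vnorm_scal Hcab; apply: (Rmult_lt_reg_l <|x|>) => //.
  rewrite -Rmult_assoc Rinv_r ?Rmult_1_l; lra.
case: (compact_precomp (M := 1) HK (u := u)); first by move=> n; rewrite (proj1 (Hu n)); lra.
move=> phi [l [Hphi Hl]].
have Hz : converges (fun n => u (phi n) -v K (u (phi n))) 0v.
  move=> e e0; case: (@pow_lt_small (/ 2) ltac:(lra) e e0) => N HN; exists N => n Hn.
  have -> : u (phi n) -v K (u (phi n)) -v 0v = u (phi n) -v K (u (phi n)) by vring.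
  apply: Rlt_trans (proj2 (Hu (phi n))) _; apply: HN; have := subseq_ge Hphi n; lia.
have Hul : converges (fun n => u (phi n)) l.
  have -> : l = 0v +v l by vring.
  have -> : (fun n => u (phi n)) = (fun n => (u (phi n) -v K (u (phi n))) +v K (u (phi n))).
    by apply: functional_extensionality => n; vring.
  exact: converges_add.
have El : l = K l by apply: (converges_unique Hl); exact: conv_bop.
have := converges_norm_ge (B := 1) Hul; rewrite (Hinj l El) vnorm_0 => A.
have : 1 <= 0 by apply: A; exists 0%nat => n _; rewrite (proj1 (Hu (phi n))); lra.
lra.
Qed.

(** If A = 1 - K is not onto, the ranges of A^n are closed (A^n is bounded below) and strictly
    decreasing. For Riesz vectors u_i of this sequence and i < j, K u_i - K u_j is u_i minus an
    element of the range of A^(i+1), so it has norm at least 1/2, against compactness. *)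
Lemma fredholm (K : Bop X) : compact_op K -> (forall x, x = K x -> x = 0v) -> exists R, inv (idB -v K) R.
Proof.
move=> HK Hinj; case: (bounded_below HK Hinj) => b b0 Hb.
set A := idB -v K : Bop X.
have HA x : b * <|x|> <= <|A x|> by have := Hb x; rewrite /A; autorewrite with bop.
apply: (bij_inv b0 HA); apply: NNPP => Hsur.
have [y0 Hy0] : exists y, forall x, A x <> y.
  apply: NNPP => K1; apply: Hsur => y; apply: NNPP => K2; apply: K1; exists y => x E; apply: K2; by exists x.
have inj x : A x = 0v -> x = 0v.
  move=> E; apply: Hinj; apply: vsub_eq0; move: E; rewrite /A; by autorewrite with bop.
have Hbn n x : b ^ n * <|x|> <= <|pw A n x|>.
  elim: n => [|n IH]; first by rewrite /= Rmult_1_l; lra.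
  rewrite pw_app; apply: Rle_trans (HA _); rewrite /= Rmult_assoc; apply: Rmult_le_compat_l => //; lra.
pose RR n (y : X) := exists x, y = pw A n x.
have RRs n : subsp (RR n).
  split; first by exists 0v; rewrite bop0.
  split; first by move=> x y [a ->] [c ->]; exists (a +v c); rewrite bopD.
  by move=> a x [c ->]; exists (a *v c); rewrite bopZ.
have RRc n : closed_subspace (RR n).
  case: (RRs n) => [S0 [Sa Ss]]; split=> //; split=> //; split=> // u l Hu Hl.
  case: (@fchoice nat X (fun k x => u k = pw A n x) Hu) => w Hw.
  have [z Hz] : exists z, converges w z.
    apply: vcomplete => e e0; have bp : 0 < b ^ n by apply: pow_lt.
    case: (Hl (b ^ n * e / 2)); first by apply: Rdiv_lt_0_compat; [apply: Rmult_lt_0_compat|lra].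
    move=> N HN; exists N => i j Hi Hj; apply: (Rmult_lt_reg_l (b ^ n)) => //.
    apply: Rle_lt_trans (Hbn n _) _; rewrite bopD bopN -!Hw.
    apply: Rle_lt_trans (vnorm_tri _ l _) _; rewrite (vnorm_sub_sym l).
    have := HN i Hi; have := HN j Hj; lra.
  exists z; apply: (converges_unique Hl).
  have -> : u = (fun k => pw A n (w k)) by apply: functional_extensionality.
  exact: conv_bop.
have RRi n x : RR (S n) x -> RR n x by move=> [y ->]; exists (A y); rewrite pwSr.
have RRle m n x : (m <= n)%nat -> RR n x -> RR m x.
  by move=> H; elim: n / H => [|n Hn IH] //= /RRi.
have [u Hu] : exists u : nat -> X, forall n, RR n (u n) /\ <|u n|> <= 1 /\ forall v, RR (S n) v -> / 2 <= <|u n -v v|>.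
  apply: (@fchoice nat X (fun n w => RR n w /\ <|w|> <= 1 /\ forall v, RR (S n) v -> / 2 <= <|w -v v|>)) => n; apply: (riesz_lemma (y := pw A n y0)) => //; first by move=> x; exact: RRi.
    by exists y0.
  move=> [z Ez]; apply: (Hy0 z); apply: vsub_eq0; rewrite pwSr cmp_app in Ez.
  have E : pw A n (A z -v y0) = 0v by rewrite bopD bopN Ez vadd_opp.
  apply: vnorm_eq0; have := Hbn n (A z -v y0); rewrite E vnorm_0.
  have : 0 < b ^ n by apply: pow_lt. have := vnorm_nonneg (A z -v y0); nra.
have [i [j [Hij Hlt]]] := precomp_pair (compact_precomp HK (fun n => proj1 (proj2 (Hu n)))) (ltac:(lra) : 0 < / 2).
case: (Hu i) => [Ri [_ /(_ (A (u i) +v K (u j)))]] H.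
have : / 2 <= <|u i -v (A (u i) +v K (u j))|>.
  apply: H; apply: (proj1 (proj2 (RRs (S i)))).
    by case: Ri => w Ew; exists w; rewrite Ew.
  have -> : K (u j) = u j -v A (u j) by rewrite /A; autorewrite with bop; vring.
  apply: subsp_sub => //.
    by case: (Hu j) => Rj _; apply: (RRle _ j).
  apply: (RRle _ (S j)); first lia.
  by case: (Hu j) => [[w Ew] _]; exists w; rewrite Ew.
have -> : u i -v (A (u i) +v K (u j)) = K (u i) -v K (u j) by rewrite /A; autorewrite with bop; vring.
lra.
Qed.

Definition eigenvalue (K : X -> X) (a : C) := exists v, v <> 0v /\ K v = a *v v.

Lemma fredholm_eig (K : Bop X) a : compact_op K -> a <> C0 -> ~ eigenvalue K a -> exists R, inv (K -v a *v idB) R.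
Proof.
move=> HK Ha He; case: (@fredholm (Cinv a *v K)).
- exact: compact_scal.
- move=> x; autorewrite with bop => Ex; apply: NNPP => Hx; apply: He; exists x; split=> //.
  by rewrite {2}Ex vscal_assoc Cinv_r // vscal_1.
- move=> R HR; exists (Cinv (Copp a) *v R).
  have -> : K -v a *v idB = Copp a *v (idB -v Cinv a *v K).
    by bext x; vring; field.
  apply: inv_scal => // E; apply: Ha; have -> : a = Copp (Copp a) by ring.
  by rewrite E; ring.
Qed.

(** Eigenvectors for distinct eigenvalues span strictly increasing invariant subspaces; Riesz
    vectors in these have images under [K] that are d/2-separated, which compactness forbids. *)
Lemma eig_finite (K : Bop X) d : compact_op K -> 0 < d ->
  exists L : list C, forall a, d <= Cabs a -> eigenvalue K a -> In a L.
Proof.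
move=> HK d0; apply: NNPP => H.
case: (@greedy C (fun L a => ~ In a L /\ d <= Cabs a /\ eigenvalue K a)).
  move=> L; apply: NNPP => K1; apply: H; exists L => a Ha He; apply: NNPP => K2; apply: K1; by exists a.
move=> f Hf.
have [v Hv] := @fchoice nat X (fun n v => v <> 0v /\ K v = f n *v v) (fun n => proj2 (proj2 (Hf n))).
pose V n := span (flist v n).
(* [q n] is the product of the K - f i for i < n. It kills the first n eigenvectors and multiplies
   [v n] by the nonzero scalar [p n (f n)], which shows independence. *)
pose q := fix q n : Bop X := match n with O => idB | S n => (K -v f n *v idB) ∘ q n end.
pose p := fix p n a : C := match n with O => C1 | S n => Cmul (Cminus a (f n)) (p n a) end.
have Hq n m : q n (v m) = p n (f m) *v v m.
  elim: n => [|n IH]; first by cbn [q p]; rewrite vscal_1.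
  cbn [q p]; rewrite cmp_app IH; autorewrite with bop; rewrite (proj2 (Hv m)) /Cminus; vring.
have p0 n m : (m < n)%nat -> p n (f m) = C0.
  elim: n => [|n IH] Hm; first lia. cbn [p]; case: (Nat.eq_dec m n) => [->|Hne].
    by rewrite /Cminus; ring.
  by rewrite IH; [ring|lia].
have p1 n m : (n <= m)%nat -> p n (f m) <> C0.
  elim: n => [|n IH] Hm; first exact: C1_neq0.
  cbn [p]; apply: Cmul_neq0; last by apply: IH; lia.
  apply: Cminus_neq0 => E; case: (Hf m) => Hm2 _; apply: Hm2; rewrite E; apply: In_flist; lia.
have Vn n : ~ V n (v n).
  move=> Hvn; have : q n (v n) = 0v.
    apply: (@span_min X (flist v n) (fun x => q n x = 0v)) Hvn.
      split; first exact: bop0. split; first by move=> x y Ex Ey; rewrite bopD Ex Ey vadd_0.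
      by move=> c x Ex; rewrite bopZ Ex vscal_v0.
    by move=> x Hx; case: (flist_In Hx) => i Hi ->; rewrite Hq p0 // vscal_0.
  rewrite Hq => E; apply: (proj1 (Hv n)); exact: (vscal_eq0 (p1 n n (le_n _)) E).
have VK n x : V n x -> V n (K x).
  apply: (@span_min X (flist v n) (fun x => V n (K x))).
    case: (span_subsp (flist v n)) => [S0 [Sa Ss]].
    split; first by rewrite bop0. split; first by move=> a b Ha Hb; rewrite bopD; exact: Sa.
    by move=> c a Ha; rewrite bopZ; exact: Ss.
  by move=> y Hy; case: (flist_In Hy) => i Hi ->; rewrite (proj2 (Hv i)); apply: (proj2 (proj2 (span_subsp _))); apply: span_In; exact: In_flist.
have Vmono m n x : (m <= n)%nat -> V m x -> V n x.
  move=> Hmn; elim: n / Hmn => [|n Hn IH] // Hx; apply: span_cons; exact: IH.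
have [u Hu] : exists u : nat -> X, forall n, V (S n) (u n) /\ <|u n|> <= 1 /\ forall w, V n w -> / 2 <= <|u n -v w|>.
  apply: (@fchoice nat X (fun n z => V (S n) z /\ <|z|> <= 1 /\ forall w, V n w -> / 2 <= <|z -v w|>)) => n; apply: (riesz_lemma (y := v n)) => //.
  exact: span_closed.
  exact: span_subsp.
  by move=> x; exact: span_cons.
  by apply: span_In; left.
have [i [j [Hij Hlt]]] := precomp_pair (compact_precomp HK (fun n => proj1 (proj2 (Hu n)))) (ltac:(lra) : 0 < d / 2).
have fj : f j <> C0.
  by move=> E; case: (Hf j) => _ []; rewrite E Cabs_C0; lra.
case: (Hu j) => [[c [y [Hy Ey]]] [_ H2]].
(* K - f j kills the new eigenvector [v j], so it sends [u j] into the smaller space; hence K u_j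
   agrees with f j u_j modulo that space. *)
have Hw : V j (Cinv (f j) *v (K (u i) -v (K (u j) -v f j *v u j))).
  apply: (proj2 (proj2 (span_subsp _))); apply: subsp_sub; first exact: span_subsp.
    by apply: VK; apply: (Vmono (S i)) => //; case: (Hu i).
  have -> : K (u j) -v f j *v u j = K y -v f j *v y.
    by rewrite Ey bopD bopZ (proj2 (Hv j)); vring.
  apply: subsp_sub; [exact: span_subsp|exact: VK|by apply: (proj2 (proj2 (span_subsp _)))].
have := H2 _ Hw.
have -> : u j -v Cinv (f j) *v (K (u i) -v (K (u j) -v f j *v u j)) = Cinv (f j) *v (K (u j) -v K (u i)).
  have {1}-> : u j = Cinv (f j) *v (f j *v u j) by rewrite vscal_assoc Cinv_l // vscal_1.
  vring.
rewrite vnorm_scal Cabs_inv //; have Dj : d <= Cabs (f j) by case: (Hf j) => _ [].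
rewrite vnorm_sub_sym => A; have : / Cabs (f j) <= / d by apply: Rinv_le_contravar.
have P := vnorm_nonneg (K (u i) -v K (u j)) => B.
have : / d * <|K (u i) -v K (u j)|> < / 2.
  apply: (Rmult_lt_reg_l d) => //; rewrite -Rmult_assoc Rinv_r; lra.
have : 0 < / Cabs (f j) by apply: Rinv_0_lt_compat; lra.
nra.
Qed.
End FiniteDim.

(** * Spectral projections *)

Lemma Csqrt_unit a : Cabs a = 1 -> exists b, Cabs b = 1 /\ Cmul b b = a.
Proof.
move=> Ha; have H1 : Cre a ^ 2 + Cim a ^ 2 = 1 by rewrite -Cabs_sq Ha; ring.
have Hr : -1 <= Cre a <= 1 by split; nra.
pose x := sqrt ((1 + Cre a) / 2); pose y := sqrt ((1 - Cre a) / 2).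
have Hx : x * x = (1 + Cre a) / 2 by rewrite sqrt_sqrt //; lra.
have Hy : y * y = (1 - Cre a) / 2 by rewrite sqrt_sqrt //; lra.
have x0 : 0 <= x by exact: sqrt_pos.
have y0 : 0 <= y by exact: sqrt_pos.
have Hxy : (2 * (x * y)) * (2 * (x * y)) = Cim a * Cim a.
  have -> : (2 * (x * y)) * (2 * (x * y)) = 4 * (x * x) * (y * y) by ring.
  rewrite Hx Hy; nra.
have P : 0 <= x * y by apply: Rmult_le_pos.
case: (Rle_lt_dec 0 (Cim a)) => Hi.
  exists (mkC x y); split; first by apply: Cabs_unique; [lra|cbn; lra].
  apply: C_ext; cbn; first lra.
  have : 2 * (x * y) = Cim a by nra. lra.
exists (mkC x (- y)); split; first by apply: Cabs_unique; [lra|cbn; lra].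
apply: C_ext; cbn; first lra.
have : 2 * (x * y) = - Cim a by nra. lra.
Qed.

(** For unit roots c, d one has |c-d|^2 + |c+d|^2 = 4 and |c-d| |c+d| = |a-b|. Changing the sign of
    d if necessary gives |c+d| >= 4/3, whence the factor 3/4 that makes the levels below
    contract. *)
Lemma Csqrt_pair a b : Cabs a = 1 -> Cabs b = 1 -> exists c d, Cabs c = 1 /\ Cabs d = 1 /\
  Cmul c c = a /\ Cmul d d = b /\ Cabs (Cminus c d) <= 3 / 4 * Cabs (Cminus a b).
Proof.
move=> /Csqrt_unit [c [Hc Ec]] /Csqrt_unit [d [Hd Ed]].
have par : Cabs (Cminus c d) * Cabs (Cminus c d) + Cabs (Cadd c d) * Cabs (Cadd c d) = 4.
  have C1' := Cabs_sq c; have C2' := Cabs_sq d; rewrite Hc in C1'; rewrite Hd in C2'.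
  rewrite !Cabs_sq; cbn in *; lra.
have prod : Cabs (Cminus c d) * Cabs (Cadd c d) = Cabs (Cminus a b).
  by rewrite -Cabs_mul -Ec -Ed; congr Cabs; rewrite /Cminus; ring.
have p1 := Cabs_nonneg (Cminus c d); have p2 := Cabs_nonneg (Cadd c d).
case: (Rle_lt_dec (4 / 3) (Cabs (Cadd c d))) => H.
  by exists c, d; repeat split=> //; nra.
exists c, (Copp d); rewrite Cabs_opp; repeat split=> //.
  by rewrite -Ed; ring.
have -> : Cminus c (Copp d) = Cadd c d by rewrite /Cminus; ring.
nra.
Qed.

Lemma pow_nbhd t N a : 0 < t -> a < t ^ N -> exists t', 0 < t' < t /\ a < t' ^ N.
Proof.
move=> t0 H; have : continuity_pt (fun x => x ^ N) t by apply: derivable_continuous_pt; exact: derivable_pt_pow.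
move=> /(_ (t ^ N - a)) [|d [d0 Hd]]; first lra.
pose m := Rmin d t; have m0 : 0 < m by apply: Rmin_glb_lt; lra.
have md : m <= d by exact: Rmin_l. have mt : m <= t by exact: Rmin_r.
exists (t - m / 2); split; first lra.
have := Hd (t - m / 2); rewrite /D_x /no_cond /= /R_dist.
have -> : t - m / 2 - t = - (m / 2) by ring.
rewrite Rabs_Ropp Rabs_right; last lra.
move=> H1; have : Rabs ((t - m / 2) ^ N - t ^ N) < t ^ N - a.
  by apply: H1; split; [split=> //; lra|lra].
move=> /Rabs_def2; lra.
Qed.

Lemma pow_nbhd_up t N a : 0 < t -> t ^ N < a -> exists d, 0 < d /\ forall t', t < t' < t + d -> t' ^ N < a.
Proof.
move=> t0 H; have : continuity_pt (fun x => x ^ N) t by apply: derivable_continuous_pt; exact: derivable_pt_pow.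
move=> /(_ (a - t ^ N)) [|d [d0 Hd]]; first lra.
exists d; split=> // t' Ht; have := Hd t'; rewrite /D_x /no_cond /= /R_dist.
rewrite (Rabs_right (t' - t)); last lra.
move=> H1; have : Rabs (t' ^ N - t ^ N) < a - t ^ N by apply: H1; split; [split=> //; lra|lra].
move=> /Rabs_def2; lra.
Qed.

Lemma vnorm_half (X : CBanach) (x y : X) b : <|x|> <= b -> <|y|> <= b -> <|RtoC (/ 2) *v (x +v y)|> <= b.
Proof.
move=> Hx Hy; rewrite vnorm_scal Cabs_RtoC Rabs_right; last lra.
have := vnorm_triangle x y; lra.
Qed.

Section Spectral.
Variable X : CBanach.
Implicit Types (A B D T R S P Q : Bop X) (x y : X).

(** The spectrum of [S] misses the unit circle, with [M] a uniform bound for the resolvents; every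
    estimate on projections below depends on [M] alone. *)
Definition circ S M := forall a, Cabs a = 1 -> exists R, inv (idB -v a *v S) R /\ <|R|> <= M.

(** Were the inverses unbounded, [inv_perturb] at a cluster point of the parameters would still
    bound those nearby. *)
Lemma circ_bound S : (forall a, Cabs a = 1 -> exists R, inv (idB -v a *v S) R) -> exists2 M, 0 < M & circ S M.
Proof.
move=> H; apply: NNPP => K.
have [c Hc] : exists c : nat -> C, forall n, Cabs (c n) = 1 /\ forall R, inv (idB -v c n *v S) R -> INR n < <|R|>.
  apply: (@fchoice nat C (fun n a => Cabs a = 1 /\ forall R, inv (idB -v a *v S) R -> INR n < <|R|>)) => n.
  apply: NNPP => K2; apply: K; exists (INR n + 1); first by have := pos_INR n; lra.
  move=> a Ha; case: (H a Ha) => R HR; exists R; split=> //; apply: Rnot_lt_le => Hlt.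
  apply: K2; exists a; split=> // R' HR'; rewrite (inv_uniq HR' HR); lra.
have [phi [a [Hphi Ha]]] := @C_BW c 1 (fun n => Req_le _ _ (proj1 (Hc n))).
have Ha1 : Cabs a = 1.
  have tri n : Rabs (Cabs a - 1) <= Cabs (Cminus (c (phi n)) a).
    have [E _] := Hc (phi n).
    have := Cabs_triangle (Cminus (c (phi n)) a) a; have := Cabs_triangle (Copp (Cminus (c (phi n)) a)) (c (phi n)).
    have -> : Cadd (Cminus (c (phi n)) a) a = c (phi n) by rewrite /Cminus; ring.
    have -> : Cadd (Copp (Cminus (c (phi n)) a)) (c (phi n)) = a by rewrite /Cminus; ring.
    rewrite Cabs_opp E => *; apply: Rabs_le; lra.
  apply: NNPP => Hne; have p : 0 < Rabs (Cabs a - 1) by apply: Rabs_pos_lt; lra.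
  case: (Ha _ p) => N /(_ N (le_n _)); have := tri N; lra.
case: (H a Ha1) => R HR.
have PR := vnorm_nonneg R; have PS := vnorm_nonneg S.
have p : 0 < / (2 * ((<|S|> + 1) * (<|R|> + 1))) by apply: Rinv_0_lt_compat; nra.
case: (Ha _ p) => N HN.
have [m Hm] := INR_unbounded (2 * (<|R|> + 1)).
pose n := max N m; have Hn := HN n ltac:(lia).
have Hsm : <|(idB -v c (phi n) *v S) -v (idB -v a *v S)|> * (<|R|> + 1) <= / 2.
  have -> : (idB -v c (phi n) *v S) -v (idB -v a *v S) = Copp (Cminus (c (phi n)) a) *v S by rewrite /Cminus; vring.
  rewrite vnorm_scal Cabs_opp; have Q := Cabs_nonneg (Cminus (c (phi n)) a).
  have E : / 2 = / (2 * ((<|S|> + 1) * (<|R|> + 1))) * ((<|S|> + 1) * (<|R|> + 1)) by field; lra.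
  rewrite E Rmult_assoc; apply: Rmult_le_compat; [done|nra|lra|nra].
have Rle : <|R|> <= <|R|> + 1 by lra.
case: (inv_perturb HR Rle Hsm) => R' [HR' [HR'n _]].
have := proj2 (Hc (phi n)) R' HR'.
have : INR m <= INR (phi n) by apply: le_INR; have := subseq_ge Hphi n; lia.
lra.
Qed.

Lemma circ_perturb S S' M : 0 < M -> circ S M -> <|S' -v S|> * M <= / 2 -> circ S' (2 * M).
Proof.
move=> M0 H Hs a Ha; case: (H a Ha) => R [HR HRM].
case: (@inv_perturb _ _ (idB -v a *v S') _ M HR HRM).
  have -> : (idB -v a *v S') -v (idB -v a *v S) = Copp a *v (S' -v S) by vring.
  by rewrite vnorm_scal Cabs_opp Ha Rmult_1_l.
by move=> R' [H1 [H2 _]]; exists R'.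
Qed.

(** Partial fractions: 1/(1 - a^2 T^2) is half the sum, and aT/(1 - a^2 T^2) half the difference, of
    1/(1 - aT) and 1/(1 + aT). *)
Lemma inv_double T a P Q : inv (idB -v a *v T) P -> inv (idB -v Copp a *v T) Q ->
  inv (idB -v Cmul a a *v (T ∘ T)) (RtoC (/ 2) *v (P +v Q)) /\
  a *v (T ∘ (RtoC (/ 2) *v (P +v Q))) = RtoC (/ 2) *v (P -v Q).
Proof.
set A := idB -v a *v T; set B := idB -v Copp a *v T => HA HB.
have AB : A ∘ B = idB -v Cmul a a *v (T ∘ T) by rewrite /A /B; bext x.
have BA : B ∘ A = idB -v Cmul a a *v (T ∘ T) by rewrite /A /B; bext x.
have half : Cadd (RtoC (/ 2)) (RtoC (/ 2)) = C1 by apply: C_ext; cbn; field.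
have hsum : RtoC (/ 2) *v (A +v B) = idB.
  have -> : RtoC (/ 2) *v (A +v B) = Cadd (RtoC (/ 2)) (RtoC (/ 2)) *v (idB : Bop X) by rewrite /A /B; vring.
  by rewrite half vscal_1.
have hdif : RtoC (/ 2) *v (B -v A) = a *v T.
  have -> : RtoC (/ 2) *v (B -v A) = Cmul (Cadd (RtoC (/ 2)) (RtoC (/ 2))) a *v T by rewrite /A /B; vring.
  by rewrite half; congr (_ *v _); ring.
have I : inv (idB -v Cmul a a *v (T ∘ T)) (RtoC (/ 2) *v (P +v Q)).
  split.
    rewrite cmpZr cmpDr -{1}BA -AB -!cmpA (proj1 HA) (proj1 HB) !cmp1r -hsum; vring.
  rewrite cmpZl cmpDl -{1}AB -BA !cmpA (proj2 HA) (proj2 HB) !cmp1l -hsum; vring.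
split=> //.
have E : (idB -v Cmul a a *v (T ∘ T)) ∘ (RtoC (/ 2) *v (P -v Q)) = a *v T.
  rewrite cmpZr cmpDr cmpNr -{1}BA -AB -!cmpA (proj1 HA) (proj1 HB) !cmp1r -hdif; vring.
set W := RtoC (/ 2) *v (P +v Q) in I *.
have cW : comm W T.
  apply: (inv_comm I); rewrite /comm; bext x.
have -> : T ∘ W = W ∘ T by rewrite cW.
by rewrite -cmpZr -E cmpA (proj2 I) cmp1l.
Qed.

Definition lev S j a R := inv (idB -v a *v pw S (2 ^ j)) R.

Lemma pw_dbl S j : pw S (2 ^ Datatypes.S j) = pw S (2 ^ j) ∘ pw S (2 ^ j).
Proof. by rewrite -pwD; congr pw; cbn; lia. Qed.

Section Circle.
Variables (S : Bop X) (M : R).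
Hypothesis HS : circ S M.

(** A Lipschitz constant for a -> (1 - aS)^-1 on the circle: two values R, R' differ by (a - b) R S
    R', and |S R'| <= M + 1 because b S R' = R' - 1. *)
Let L0 := M * (M + 1).

Lemma circ_M0 : 0 <= M.
Proof. by case: (HS Cabs_C1) => R [_ H]; apply: Rle_trans H; exact: vnorm_nonneg. Qed.

(** By [inv_double] the inverse at level j + 1 is the mean of two at level j, taken at the square
    roots of [a]. Norm bounds and invariant closed subspaces survive averaging, and [Csqrt_pair]
    improves the Lipschitz constant by 3/4 at each level. *)
Lemma lev_all j : (forall a, Cabs a = 1 -> exists R, lev S j a R) /\
  (forall a R, Cabs a = 1 -> lev S j a R -> <|R|> <= M) /\
  (forall a b R R', Cabs a = 1 -> Cabs b = 1 -> lev S j a R -> lev S j b R' ->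
     <|R -v R'|> <= L0 * (3 / 4) ^ j * Cabs (Cminus a b)) /\
  (forall a R n, (n < 2 ^ j)%nat -> Cabs a = 1 -> lev S j a R -> <|pw S n ∘ R|> <= M) /\
  (forall V a R, closed_subspace V -> (forall b Q, Cabs b = 1 -> inv (idB -v b *v S) Q -> forall x, V x -> V (Q x)) ->
     Cabs a = 1 -> lev S j a R -> forall x, V x -> V (R x)) /\
  (forall B a R, comm S B -> lev S j a R -> comm R B).
Proof.
have M0 := circ_M0.
have last_part i B a R : comm S B -> lev S i a R -> comm R B.
  move=> H HR; apply: (inv_comm HR); have H2 := comm_pw (2 ^ i) (comm_sym H).
  by rewrite /comm in H2 *; rewrite cmpDl cmpDr cmpNl cmpNr cmpZl cmpZr cmp1l cmp1r H2.
elim: j => [|j [I1 [I2 [I3 [I4 [I5 _]]]]]].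
{ have E0 a R : lev S 0 a R <-> inv (idB -v a *v S) R by rewrite /lev /= cmp1r.
  split; first by move=> a Ha; case: (HS Ha) => R [HR _]; exists R; apply/E0.
  have N a R : Cabs a = 1 -> lev S 0 a R -> <|R|> <= M.
    move=> Ha /E0 HR; case: (HS Ha) => R' [HR' HM]; by rewrite (inv_uniq HR HR').
  split=> //; split; last split; last split.
  - move=> a b R R' Ha Hb HR HR'; have nR := N _ _ Ha HR; have nR' := N _ _ Hb HR'.
    move/E0: HR => HR; move/E0: HR' => HR'.
    have E : R -v R' = Cminus a b *v (R ∘ (S ∘ R')).
      have -> : R -v R' = R ∘ ((idB -v b *v S) -v (idB -v a *v S)) ∘ R'.
        rewrite cmpDr cmpNr cmpDl cmpNl -(cmpA R) (proj1 HR') (proj2 HR) cmp1l cmp1r //.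
      by rewrite /Cminus; bext x.
    have F : <|S ∘ R'|> <= M + 1.
      have -> : <|S ∘ R'|> = <|b *v (S ∘ R')|> by rewrite vnorm_scal Hb Rmult_1_l.
      have -> : b *v (S ∘ R') = R' -v idB.
        by rewrite -(proj1 HR'); bext x.
      apply: Rle_trans (vnorm_sub_le _ _) _; have := bnorm_id X; lra.
    rewrite E vnorm_scal /= Rmult_1_r Rmult_comm; apply: Rmult_le_compat_r; first exact: Cabs_nonneg.
    apply: Rle_trans (bnorm_cmp _ _) _; apply: Rmult_le_compat => //; exact: vnorm_nonneg.
  - move=> a R n Hn Ha HR; have -> : n = 0%nat by cbn in Hn; lia.
    by rewrite cmp1l; apply: N HR.
  - move=> V a R HV Hinv Ha /E0 HR; exact: (Hinv a).
  - by move=> B a R; exact: last_part. }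
have split_lev a R : Cabs a = 1 -> lev S (Datatypes.S j) a R -> forall b, Cabs b = 1 -> Cmul b b = a ->
  exists P Q, lev S j b P /\ lev S j (Copp b) Q /\ R = RtoC (/ 2) *v (P +v Q) /\
    b *v (pw S (2 ^ j) ∘ R) = RtoC (/ 2) *v (P -v Q).
  move=> Ha HR b Hb E; case: (I1 b Hb) => P HP; case: (I1 (Copp b)); first by rewrite Cabs_opp.
  move=> Q HQ; exists P, Q; split=> //; split=> //.
  case: (inv_double HP HQ); rewrite -pw_dbl E => H1 H2.
  by rewrite (inv_uniq HR H1).
split.
  move=> a Ha; case: (Csqrt_unit Ha) => b [Hb E].
  case: (I1 b Hb) => P HP; case: (I1 (Copp b)); first by rewrite Cabs_opp.
  move=> Q HQ; case: (inv_double HP HQ); rewrite -pw_dbl E => H1 H2.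
  by exists (RtoC (/ 2) *v (P +v Q)).
split.
  move=> a R Ha HR; case: (Csqrt_unit Ha) => b [Hb E].
  case: (split_lev a R Ha HR b Hb E) => P [Q [HP [HQ [-> _]]]].
  by apply: vnorm_half; [apply: I2 HP|apply: I2 HQ; rewrite Cabs_opp].
split.
  move=> a b R R' Ha Hb HR HR'; case: (Csqrt_pair Ha Hb) => c [d [Hc [Hd [Ec [Ed H]]]]].
  case: (split_lev a R Ha HR c Hc Ec) => P [Q [HP [HQ [-> _]]]].
  case: (split_lev b R' Hb HR' d Hd Ed) => P' [Q' [HP' [HQ' [-> _]]]].
  have -> : RtoC (/ 2) *v (P +v Q) -v RtoC (/ 2) *v (P' +v Q') = RtoC (/ 2) *v ((P -v P') +v (Q -v Q')) by vring.
  have B0 : 0 <= L0 * (3 / 4) ^ j by apply: Rmult_le_pos; [rewrite /L0; nra|apply: pow_le; lra].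
  apply: Rle_trans (_ : L0 * (3 / 4) ^ j * Cabs (Cminus c d) <= _); last first.
    rewrite /=; have := Rmult_le_compat_l _ _ _ B0 H; lra.
  apply: vnorm_half; first exact: (I3 c d).
  have -> : Cabs (Cminus c d) = Cabs (Cminus (Copp c) (Copp d)).
    by rewrite -Cabs_opp; congr Cabs; rewrite /Cminus; ring.
  by apply: I3 => //; rewrite Cabs_opp.
split.
  move=> a R n Hn Ha HR; case: (Csqrt_unit Ha) => b [Hb E].
  case: (split_lev a R Ha HR b Hb E) => P [Q [HP [HQ [ER EB]]]].
  have Hb' : Cabs (Copp b) = 1 by rewrite Cabs_opp.
  case: (Nat.lt_ge_cases n (2 ^ j)) => Hlt.
    rewrite ER cmpZr cmpDr; apply: vnorm_half; [exact: (I4 b)|exact: (I4 (Copp b))].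
  (* For the upper half of the exponents, S^(2^j) R is up to a unit scalar half the difference of
     two level-j inverses, and the remaining exponent is below 2^j. *)
  have -> : n = (n - 2 ^ j + 2 ^ j)%nat by lia.
  have Hm : (n - 2 ^ j < 2 ^ j)%nat by cbn in Hn; lia.
  rewrite pwD -cmpA.
  have -> : <|pw S (n - 2 ^ j) ∘ (pw S (2 ^ j) ∘ R)|> = <|pw S (n - 2 ^ j) ∘ (b *v (pw S (2 ^ j) ∘ R))|>.
    by rewrite cmpZr vnorm_scal Hb Rmult_1_l.
  rewrite EB cmpZr cmpDr cmpNr; apply: vnorm_half; first exact: (I4 b).
  by rewrite vnorm_opp; apply: (I4 (Copp b)).
split; last by move=> B a R; exact: last_part.
move=> V a R HV Hinv Ha HR; case: (Csqrt_unit Ha) => b [Hb E].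
case: (split_lev a R Ha HR b Hb E) => P [Q [HP [HQ [-> _]]]] x Vx; autorewrite with bop.
case: (HV) => [V0 [Va [Vs _]]]; apply: (Vs); apply: Va.
  by apply: (I5 V b).
by apply: (I5 V (Copp b)) => //; rewrite Cabs_opp.
Qed.

(** Up to a unit scalar the operator is half the difference of the level-j inverses at the two
    opposite roots of [a], which the Lipschitz estimate makes small. *)
Lemma circ_half j a R : Cabs a = 1 -> lev S (Datatypes.S j) a R -> <|pw S (2 ^ j) ∘ R|> <= L0 * (3 / 4) ^ j.
Proof.
move=> Ha HR; case: (lev_all j) => I1 [I2 [I3 _]].
case: (Csqrt_unit Ha) => b [Hb E].
case: (I1 b Hb) => P HP; case: (I1 (Copp b)); first by rewrite Cabs_opp.
move=> Q HQ; case: (inv_double HP HQ); rewrite -pw_dbl E => H1 H2.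
have -> : <|pw S (2 ^ j) ∘ R|> = <|b *v (pw S (2 ^ j) ∘ R)|> by rewrite vnorm_scal Hb Rmult_1_l.
rewrite (inv_uniq HR H1) H2 vnorm_scal Cabs_RtoC Rabs_right; last lra.
have := I3 b (Copp b) P Q Hb ltac:(by rewrite Cabs_opp) HP HQ.
have -> : Cabs (Cminus b (Copp b)) = 2.
  have -> : Cminus b (Copp b) = Cmul (RtoC 2) b by rewrite /Cminus; apply: C_ext; cbn; ring.
  by rewrite Cabs_mul Hb Cabs_RtoC Rabs_right; lra.
lra.
Qed.

(* The operators (1 - S^(2^j))^-1 are averages of resolvents over the 2^j-th roots of unity,
   hence Riemann sums of the contour integral of the Riesz projection. *)
Lemma circle_proj : exists P (A : nat -> Bop X), converges A P /\
  (forall j, lev S j C1 (A j)) /\ (forall j, <|A j|> <= M) /\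
  (forall j, <|P -v A j|> <= 4 * (M * (M + 1)) * (3 / 4) ^ j) /\
  (forall n, <|pw S n ∘ P|> <= M) /\ P ∘ P = P /\
  (forall n e, 0 < e -> exists Y, <|Y|> <= M /\ <|(idB -v P) -v pw S (Datatypes.S n) ∘ Y|> <= e /\ comm Y S) /\
  (forall V, closed_subspace V -> (forall b Q, Cabs b = 1 -> inv (idB -v b *v S) Q -> forall x, V x -> V (Q x)) ->
     forall x, V x -> V (P x)) /\
  (forall B, comm S B -> comm P B).
Proof.
have M0 := circ_M0.
have [A HA] : exists A : nat -> Bop X, forall j, lev S j C1 (A j).
  apply: (@fchoice nat (Bop X) (fun j R => lev S j C1 R)) => j; exact: (proj1 (lev_all j) _ Cabs_C1).
have LB j : <|A j|> <= M by exact: (proj1 (proj2 (lev_all j)) _ _ Cabs_C1 (HA j)).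
have L00 : 0 <= L0 by rewrite /L0; nra.
have step j : <|A (Datatypes.S j) -v A j|> <= L0 * (3 / 4) ^ j.
  case: (lev_all j) => I1 [_ [I3 _]]; have Hm1 : Cabs (Copp C1) = 1 by rewrite Cabs_opp Cabs_C1.
  case: (I1 (Copp C1) Hm1) => Q HQ; case: (inv_double (HA j) HQ).
  have -> : Cmul C1 C1 = C1 by ring. rewrite -pw_dbl => H1 _.
  rewrite (inv_uniq (HA (Datatypes.S j)) H1).
  have -> : RtoC (/ 2) *v (A j +v Q) -v A j = RtoC (/ 2) *v (Q -v A j).
    have E : RtoC (/ 2) = Cminus C1 (RtoC (/ 2)) by apply: C_ext; cbn; field.
    have {2}-> : A j = Cadd (RtoC (/ 2)) (RtoC (/ 2)) *v A j.
      by rewrite -{1}(vscal_1 (A j)); congr (_ *v _); apply: C_ext; cbn; field.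
    vring.
  rewrite vnorm_scal Cabs_RtoC Rabs_right; last lra.
  have := I3 _ _ _ _ Hm1 Cabs_C1 HQ (HA j).
  have -> : Cabs (Cminus (Copp C1) C1) = 2 by apply: Cabs_unique; [lra|cbn; ring].
  lra.
case: (geom_cauchy (ltac:(lra) : 0 <= 3 / 4 < 1) step) => P [HP HB].
have HB' j : <|P -v A j|> <= 4 * L0 * (3 / 4) ^ j by apply: Rle_trans (HB j) _; right; field.
have pow2big n : exists j0, forall j, (j0 <= j)%nat -> (n < 2 ^ j)%nat.
  exists n => j Hj; apply: Nat.lt_le_trans (Nat.pow_gt_lin_r 2 j _); lia.
have SnP n : <|pw S n ∘ P|> <= M.
  apply: (converges_norm_le (u := fun j => pw S n ∘ A j)).
    by apply: conv_cmp => //; exact: converges_const.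
  case: (pow2big n) => j0 Hj0; exists j0 => j Hj.
  case: (lev_all j) => _ [_ [_ [I4 _]]]; exact: (I4 C1 _ _ (Hj0 j Hj) Cabs_C1).
have commP B : comm S B -> comm P B.
  move=> HSB; apply: (converges_unique (u := fun j => A j ∘ B)).
    by apply: conv_cmp => //; exact: converges_const.
  have -> : (fun j => A j ∘ B) = (fun j => B ∘ A j).
    apply: functional_extensionality => j; case: (lev_all j) => _ [_ [_ [_ [_ I6]]]]; exact: (I6 B C1).
  by apply: conv_cmp => //; exact: converges_const.
have one_minus j : idB -v A j = -v (pw S (2 ^ j) ∘ A j).
  by rewrite -(proj1 (HA j)) cmpDl cmpNl cmpZl vscal_1 cmp1l; vring.
have geo_small K e : 0 <= K -> 0 < e -> exists j0, forall j, (j0 <= j)%nat -> K * (3 / 4) ^ j < e.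
  move=> K0 e0; case: (@pow_lt_small (3 / 4) ltac:(lra) (e / (K + 1))); first by apply: Rdiv_lt_0_compat; lra.
  move=> N HN; exists N => j Hj; have := HN j Hj.
  have : 0 < (3 / 4) ^ j by apply: pow_lt; lra.
  have : e = e / (K + 1) * (K + 1) by field; lra.
  nra.
exists P, A; split=> //; split=> //; split=> //; split=> //; split=> //; split; last split; last split=> //.
- apply: vsub_eq0; apply: vnorm_small => e e0.
  case: (geo_small (4 * L0 * M + M * L0) (e)) => //; first nra.
  move=> j0 Hj0; pose j := j0; have Hj := Hj0 j (le_n _).
  (* Since 1 - A (j+1) is -S^(2^(j+1)) A (j+1), splitting the power in two leaves the bounded factor
     P S^(2^j) and the factor S^(2^j) A (j+1), which tends to 0 by [circ_half]. *)
  have -> : P ∘ P -v P = P ∘ (P -v A (Datatypes.S j)) -v P ∘ (idB -v A (Datatypes.S j)).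
    by bext x.
  rewrite one_minus pw_dbl cmpNr; apply: Rle_trans (vnorm_sub_le _ _) _.
  rewrite vnorm_opp -(cmpA (pw S (2 ^ j))) (cmpA P).
  have E1 := bnorm_cmp P (P -v A (Datatypes.S j)).
  have E2 := bnorm_cmp (P ∘ pw S (2 ^ j)) (pw S (2 ^ j) ∘ A (Datatypes.S j)).
  have F1 := HB' (Datatypes.S j); have F2 := circ_half Cabs_C1 (HA (Datatypes.S j)).
  have F3 : <|P ∘ pw S (2 ^ j)|> <= M.
    have -> : P ∘ pw S (2 ^ j) = pw S (2 ^ j) ∘ P by apply: comm_pw; apply: commP.
    exact: SnP.
  have F4 : <|P|> <= M by have := SnP 0%nat; rewrite cmp1l.
  have p1 : 0 < (3 / 4) ^ j by apply: pow_lt; lra.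
  have G1 : <|P|> * <|P -v A (Datatypes.S j)|> <= M * (4 * L0 * (3 / 4) ^ j).
    apply: Rmult_le_compat => //; try exact: vnorm_nonneg.
    apply: Rle_trans F1 _; apply: Rmult_le_compat_l; first nra. rewrite /=; lra.
  have G2 : <|P ∘ pw S (2 ^ j)|> * <|pw S (2 ^ j) ∘ A (Datatypes.S j)|> <= M * (L0 * (3 / 4) ^ j).
    by apply: Rmult_le_compat => //; exact: vnorm_nonneg.
  lra.
- move=> n e e0; case: (pow2big (Datatypes.S n)) => j1 Hj1; case: (geo_small (4 * L0) e) => //; first nra.
  move=> j2 Hj2; pose j := max j1 j2.
  have Hj := Hj1 j ltac:(lia).
  (* As 1 - A j = -S^(2^j) A j, splitting off S^(n+1) shows that 1 - P is nearly a multiple of any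
     given power of [S], with a cofactor bounded by [M]. *)
  exists (-v (pw S (2 ^ j - Datatypes.S n) ∘ A j)); split; last split.
  + rewrite vnorm_opp; case: (lev_all j) => _ [_ [_ [I4 _]]]; apply: (I4 C1) => //; [lia|exact: Cabs_C1].
  + have -> : pw S (Datatypes.S n) ∘ -v (pw S (2 ^ j - Datatypes.S n) ∘ A j) = idB -v A j.
      rewrite cmpNr cmpA -pwD one_minus; by have -> : (Datatypes.S n + (2 ^ j - Datatypes.S n) = 2 ^ j)%nat by lia.
    have -> : idB -v P -v (idB -v A j) = -v (P -v A j) by vring.
    rewrite vnorm_opp; have := HB' j; have := Hj2 j ltac:(lia); lra.
  + case: (lev_all j) => _ [_ [_ [_ [_ I6]]]].
    have c1 : comm (A j) S by apply: (I6 S C1).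
    rewrite /comm cmpNl cmpNr -cmpA c1 !cmpA; congr (-v _); congr (_ ∘ _).
    exact: (comm_sym (comm_pw _ (eq_refl : comm S S))).
- move=> V HV Hinv x Vx; case: (HV) => [_ [_ [_ Vc]]].
  apply: (Vc (fun j => A j x)); last exact: conv_app.
  move=> j; case: (lev_all j) => _ [_ [_ [_ [I5 _]]]]; exact: (I5 V C1 _ HV Hinv Cabs_C1 (HA j) _ Vx).
Qed.
End Circle.
End Spectral.

Lemma avoid_list (L : list R) a b : a < b -> exists t, a < t < b /\ ~ In t L.
Proof.
elim: L a b => [|x L IH] a b Hab; first by exists ((a + b) / 2); split; [lra|].
case: (Rle_lt_dec x ((a + b) / 2)) => Hx.
  case: (IH ((a + b) / 2) b); first lra. move=> t [Ht HL]; exists t; split; first lra.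
  by move=> /= [E|]; [lra|].
case: (IH a ((a + b) / 2)); first lra. move=> t [Ht HL]; exists t; split; first lra.
by move=> /= [E|]; [lra|].
Qed.

(** * Gelfand's formula and limits of quasinilpotent operators *)

Section Growth.
Variable X : CBanach.
Implicit Types (A B D T R S P Q K : Bop X) (x y : X).

(** Division of n by N + 1 with remainder: full blocks contribute powers of t, and the finitely many
    remainders give the constant. *)
Lemma growth_of_power T N t : 0 < t -> <|pw T (Datatypes.S N)|> <= t ^ Datatypes.S N ->
  exists K : R, 0 <= K /\ forall n, <|pw T n|> <= K * t ^ n.
Proof.
move=> t0 H.
have [K [K0 HK]] : exists K : R, 0 <= K /\ forall r, (r <= N)%nat -> <|pw T r|> <= K * t ^ r.
  elim: N {H} => [|N [K [K0 HK]]].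
    exists <|pw T 0|>; split; first exact: vnorm_nonneg.
    move=> r Hr; have -> : r = 0%nat by lia.
    by rewrite pow_O Rmult_1_r; lra.
  have p : 0 < t ^ Datatypes.S N by apply: pow_lt.
  exists (Rmax K (<|pw T (Datatypes.S N)|> / t ^ Datatypes.S N)); split.
    by apply: Rle_trans K0 (Rmax_l _ _).
  move=> r Hr; case: (Nat.eq_dec r (Datatypes.S N)) => [->|Hne].
    apply: Rle_trans (_ : (<|pw T (Datatypes.S N)|> / t ^ Datatypes.S N) * t ^ Datatypes.S N <= _).
      by right; field; lra.
    by apply: Rmult_le_compat_r; [lra|exact: Rmax_r].
  apply: Rle_trans (HK r _) _; first lia.
  by apply: Rmult_le_compat_r; [apply: pow_le; lra|exact: Rmax_l].
exists K; split=> // n; elim/(well_founded_induction Wf_nat.lt_wf): n => n IH.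
case: (Nat.le_gt_cases n N) => Hn; first exact: HK.
have -> : n = (Datatypes.S N + (n - Datatypes.S N))%nat by lia.
rewrite pwD pow_add; apply: Rle_trans (bnorm_cmp _ _) _.
have -> : K * (t ^ Datatypes.S N * t ^ (n - Datatypes.S N)) = t ^ Datatypes.S N * (K * t ^ (n - Datatypes.S N)) by ring.
apply: Rmult_le_compat => //; try exact: vnorm_nonneg.
apply: IH; lia.
Qed.

Lemma pw_vanish T N : <|pw T (Datatypes.S N)|> < 1 ->
  forall e, 0 < e -> exists n0, forall n, (n0 <= n)%nat -> <|pw T n|> < e.
Proof.
move=> H e e0; case: (@pow_nbhd 1 (Datatypes.S N) <|pw T (Datatypes.S N)|>); first lra.
  by rewrite pow1.
move=> t [Ht1 Ht2]; case: (@growth_of_power T N t); [lra|lra|].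
move=> K [K0 HK]; case: (@pow_lt_small t ltac:(lra) (e / (K + 1))); first by apply: Rdiv_lt_0_compat; lra.
move=> n0 Hn0; exists n0 => n Hn; apply: Rle_lt_trans (HK n) _.
have := Hn0 n Hn; have : e = e / (K + 1) * (K + 1) by field; lra.
have : 0 < t ^ n by apply: pow_lt; lra.
nra.
Qed.

Lemma pw_scal_norm T (t : R) n : 0 < t -> <|pw (RtoC (/ t) *v T) n|> = <|pw T n|> / t ^ n.
Proof.
move=> t0; case: (pwZ (RtoC (/ t)) T n) => c [-> Hc]; rewrite vnorm_scal Hc Cabs_RtoC Rabs_right.
  by rewrite pow_inv /Rdiv Rmult_comm.
by left; exact: Rinv_0_lt_compat.
Qed.

Lemma scal_RtoC_one (t : R) T : t <> 0 -> RtoC t *v (RtoC (/ t) *v T) = T.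
Proof.
move=> t0; rewrite vscal_assoc -{2}(vscal_1 T); congr (_ *v _); apply: C_ext; cbn; field; lra.
Qed.

(* Gelfand's formula: an inverse of 1 - aT/t for all |a| = 1, t >= tau bounds the spectral radius strictly. *)
Lemma gelfand T tau : 0 < tau ->
  (forall t a, tau <= t -> Cabs a = 1 -> exists R, inv (idB -v a *v (RtoC (/ t) *v T)) R) ->
  exists N, <|pw T (Datatypes.S N)|> < tau ^ Datatypes.S N.
Proof.
move=> tau0 H; apply: NNPP => HG.
pose G t := exists N, <|pw T (Datatypes.S N)|> < t ^ Datatypes.S N.
have Gup s t : 0 < s -> s <= t -> G s -> G t.
  move=> s0 st [N HN]; exists N; apply: Rlt_le_trans HN _; apply: pow_incr; lra.
(* If the formula fails at [tau], take the supremum [ts] of the radii where it fails. The condition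
   [G] is open to the left, so it fails at [ts] as well; the rest shows that it cannot. *)
pose E t := tau <= t /\ ~ G t.
have Ebd : bound E.
  exists (<|T|> + 1) => t [Ht HnG]; apply: Rnot_lt_le => Hlt; apply: HnG; exists 0%nat.
  by rewrite pw1 pow_1; lra.
have Ein : exists t, E t by exists tau; split; [lra|].
have [ts [ub lu]] := completeness E Ebd Ein.
have Hts : tau <= ts by apply: ub; split; [lra|].
have Gab t : ts < t -> G t.
  by move=> Ht; apply: NNPP => K; have := ub t (conj (ltac:(lra) : tau <= t) K); lra.
have GnG : ~ G ts.
  move=> [N HN]; case: (pow_nbhd (ltac:(lra) : 0 < ts) HN) => t [Ht1 Ht2].
  have Gt : G t by exists N.
  case: (Rle_lt_dec tau t) => Htau; last by apply: HG; apply: (Gup t tau) => //; lra.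
  have : is_upper_bound E t.
    move=> s [Hs HnG]; apply: Rnot_lt_le => Hlt; apply: HnG; apply: (Gup t s) => //; lra.
  move=> /lu; lra.
case: (@circ_bound X (RtoC (/ ts) *v T)); first by move=> a; exact: H.
move=> M M0 HM.
pose eps (j : nat) := 4 * ((2 * M) * (2 * M + 1)) * (3 / 4) ^ j.
have [j Hj] : exists j, eps j < / 4.
  case: (@pow_lt_small (3 / 4) ltac:(lra) (/ (16 * ((2 * M) * (2 * M + 1))))).
    by apply: Rinv_0_lt_compat; nra.
  move=> N HN; exists N; rewrite /eps; have := HN N (le_n _) => Hlt.
  have p : 0 < 4 * (2 * M * (2 * M + 1)) by nra.
  have := Rmult_lt_compat_l _ _ _ p Hlt.
  have -> : 4 * (2 * M * (2 * M + 1)) * / (16 * (2 * M * (2 * M + 1))) = / 4 by field; nra.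
  lra.
(* Just above [ts] the powers of T / t vanish, so the projection is the identity and the level-j
   inverse is within 1/4 of it. The index j was fixed before t, thanks to the uniform bound 2 M, and
   so the estimate survives t -> ts. *)
have key t : ts < t -> <|RtoC (/ t) *v T -v RtoC (/ ts) *v T|> * M <= / 2 -> <|pw T (2 ^ j)|> <= t ^ (2 ^ j) / 3.
  move=> Ht Hd; have HC := circ_perturb M0 HM Hd.
  case: (circle_proj HC) => P [A [HA [HL [_ [Hdist _]]]]].
  set S := RtoC (/ t) *v T in HC HA HL Hdist.
  have t0 : 0 < t by lra.
  have Hvan : forall e, 0 < e -> exists n0, forall n, (n0 <= n)%nat -> <|pw S n|> < e.
    case: (Gab t Ht) => N HN; apply: (@pw_vanish S N); rewrite /S pw_scal_norm //.
    have p : 0 < t ^ Datatypes.S N by apply: pow_lt.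
    by apply: (Rmult_lt_reg_r (t ^ Datatypes.S N)) => //; rewrite /Rdiv Rmult_assoc Rinv_l ?Rmult_1_r ?Rmult_1_l; lra.
  have HP : P = idB.
    apply: vsub_eq0; apply: vnorm_small => e e0.
    apply: (converges_norm_le (u := fun i => A i -v idB)).
      by apply: converges_sub => //; exact: converges_const.
    case: (circle_proj HC) => _ [A' [_ [HL' [HM' _]]]].
    case: (Hvan (e / (2 * M + 1))); first by apply: Rdiv_lt_0_compat; lra.
    move=> n0 Hn0; exists n0 => n Hn.
    have -> : A n -v idB = pw S (2 ^ n) ∘ A n.
      by rewrite -(proj1 (HL n)) cmpDl cmpNl cmpZl vscal_1 cmp1l; vring.
    apply: Rle_trans (bnorm_cmp _ _) _; rewrite (inv_uniq (HL n) (HL' n)).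
    have := Hn0 (2 ^ n)%nat ltac:(have := Nat.pow_gt_lin_r 2 n; lia).
    have := HM' n; have := vnorm_nonneg (A' n); have := vnorm_nonneg (pw S (2 ^ n)).
    have : e = e / (2 * M + 1) * (2 * M + 1) by field; lra.
    nra.
  have HAj : <|idB -v A j|> <= / 4 by rewrite -HP; have := Hdist j; rewrite -/(eps j); lra.
  set U := pw S (2 ^ j).
  (* This gives |U| <= (1 + |U|) / 4, hence |U| <= 1/3. *)
  have EU : U = (idB -v U) ∘ (A j -v idB).
    rewrite cmpDr cmpNr cmp1r; have := proj1 (HL j); rewrite -/U vscal_1 => ->; vring.
  have HU : <|U|> <= / 3.
    have : <|U|> <= (1 + <|U|>) * / 4.
      rewrite {1}EU; apply: Rle_trans (bnorm_cmp _ _) _; apply: Rmult_le_compat; try exact: vnorm_nonneg.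
        by apply: Rle_trans (vnorm_sub_le _ _) _; have := bnorm_id X; lra.
      by rewrite vnorm_sub_sym.
    lra.
  have p : 0 < t ^ (2 ^ j) by apply: pow_lt.
  move: HU; rewrite /U /S pw_scal_norm // => HU.
  apply: (Rmult_le_reg_r (/ t ^ (2 ^ j))); first exact: Rinv_0_lt_compat.
  apply: Rle_trans HU _; right; field; lra.
have ts0 : 0 < ts by lra.
have pj : 0 < ts ^ (2 ^ j) by apply: pow_lt.
(* For t close to [ts] one has t^(2^j) < 2 ts^(2^j), so the bound by a third of t^(2^j) is strictly
   below ts^(2^j). *)
case: (@pow_nbhd_up ts (2 ^ j) (2 * ts ^ (2 ^ j))); [done|lra|].
move=> d [d0 Hd].
pose d2 := ts * ts / (2 * (<|T|> + 1) * (M + 1)).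
have PT := vnorm_nonneg T.
have d20 : 0 < d2 by apply: Rdiv_lt_0_compat; nra.
pose t := ts + Rmin d d2 / 2.
have m1 : Rmin d d2 <= d by exact: Rmin_l. have m2 : Rmin d d2 <= d2 by exact: Rmin_r.
have m0 : 0 < Rmin d d2 by apply: Rmin_glb_lt.
have Ht : ts < t < ts + d by rewrite /t; lra.
apply: GnG; exists (2 ^ j - 1)%nat.
have -> : Datatypes.S (2 ^ j - 1) = (2 ^ j)%nat by have := Nat.pow_nonzero 2 j; lia.
have := Hd t Ht; have := key t (proj1 Ht).
suff Hq : <|RtoC (/ t) *v T -v RtoC (/ ts) *v T|> * M <= / 2 by move=> /(_ Hq); lra.
have -> : RtoC (/ t) *v T -v RtoC (/ ts) *v T = RtoC (/ t - / ts) *v T.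
  have -> : RtoC (/ t - / ts) = Cminus (RtoC (/ t)) (RtoC (/ ts)) by apply: C_ext; cbn; ring.
  by rewrite /Cminus; vring.
rewrite vnorm_scal Cabs_RtoC.
have t0 : 0 < t by lra.
have E1 : / t - / ts = - ((t - ts) / (t * ts)) by field; lra.
rewrite E1 Rabs_Ropp Rabs_right; last by apply: Rle_ge; apply: Rlt_le; apply: Rdiv_lt_0_compat; nra.
have E2 : (t - ts) / (t * ts) <= (t - ts) / (ts * ts).
  apply: Rmult_le_compat_l; first lra.
  by apply: Rinv_le_contravar; nra.
have E3 : (t - ts) / (ts * ts) <= / (2 * (<|T|> + 1) * (M + 1)).
  apply: (Rmult_le_reg_r (ts * ts)); first nra.
  have -> : (t - ts) / (ts * ts) * (ts * ts) = t - ts by field; lra.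
  have -> : / (2 * (<|T|> + 1) * (M + 1)) * (ts * ts) = d2 by rewrite /d2; field; lra.
  by rewrite /t; lra.
have E4 : / (2 * (<|T|> + 1) * (M + 1)) * ((<|T|> + 1) * (M + 1)) = / 2 by field; lra.
have E5 : 0 <= (t - ts) / (t * ts) by apply: Rlt_le; apply: Rdiv_lt_0_compat; nra.
apply: Rle_trans (_ : (/ (2 * (<|T|> + 1) * (M + 1))) * ((<|T|> + 1) * (M + 1)) <= _); last lra.
rewrite Rmult_assoc; apply: Rmult_le_compat; [done|nra|lra|nra].
Qed.

(* Spectral radius 0 in terms of the growth of powers. *)
Definition gz T := forall t, 0 < t -> exists K : R, 0 <= K /\ forall n, <|pw T n|> <= K * t ^ n.
Definition qn T := forall a, a <> C0 -> exists R, inv (T -v a *v idB) R.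

Lemma quasinilpotent_qn T : quasinilpotent T -> qn T.
Proof.
move=> H a Ha; case: (H a Ha) => S [HS HE]; exists (mkBop HS).
by split; apply: Bop_ext => x; case: (HE x); rewrite /=.
Qed.

Lemma unit_neq0 a : Cabs a = 1 -> a <> C0.
Proof. by move=> H E; move: H; rewrite E Cabs_C0; lra. Qed.

Lemma inv_resolvent T a (t : R) R : Cabs a = 1 -> 0 < t -> inv (T -v Cmul (RtoC t) (Cinv a) *v idB) R ->
  exists R', inv (idB -v a *v (RtoC (/ t) *v T)) R'.
Proof.
move=> Ha t0 HR; have a0 := unit_neq0 Ha; have tc : RtoC t <> C0 by apply: RtoC_neq0; lra.
have tc' : RtoC (/ t) <> C0 by apply: RtoC_neq0; have := Rinv_0_lt_compat _ t0; lra.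
have tt : Cmul (RtoC (/ t)) (RtoC t) = C1 by apply: C_ext; cbn; field; lra.
exists (Cinv (Copp (Cmul a (RtoC (/ t)))) *v R).
have -> : idB -v a *v (RtoC (/ t) *v T) = Copp (Cmul a (RtoC (/ t))) *v (T -v Cmul (RtoC t) (Cinv a) *v idB).
  have E : Cmul (Cmul a (RtoC (/ t))) (Cmul (RtoC t) (Cinv a)) = C1.
    have -> : Cmul (Cmul a (RtoC (/ t))) (Cmul (RtoC t) (Cinv a)) = Cmul (Cmul (RtoC (/ t)) (RtoC t)) (Cmul a (Cinv a)) by ring.
    by rewrite tt Cinv_r //; ring.
  have {1}-> : (idB : Bop X) = Cmul (Cmul a (RtoC (/ t))) (Cmul (RtoC t) (Cinv a)) *v idB by rewrite E vscal_1.
  vring.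
apply: inv_scal => // E; have : Cmul a (RtoC (/ t)) = C0.
  have -> : Cmul a (RtoC (/ t)) = Copp (Copp (Cmul a (RtoC (/ t)))) by ring.
  by rewrite E; ring.
exact: Cmul_neq0.
Qed.

Lemma qn_gz T : qn T -> gz T.
Proof.
move=> H t t0; case: (@gelfand T t t0).
  move=> s a Hs Ha; have s0 : 0 < s by lra.
  case: (H (Cmul (RtoC s) (Cinv a))).
    by apply: Cmul_neq0; [apply: RtoC_neq0; lra|apply: Cinv_neq0; exact: unit_neq0].
  by move=> R HR; apply: (inv_resolvent Ha s0 HR).
by move=> N HN; apply: (@growth_of_power T N t) => //; lra.
Qed.

Lemma compact_limit (u : nat -> Bop X) T : (forall n, compact_op (u n)) -> converges u T -> compact_op T.
Proof.
move=> Hu HT; split; first exact: (bprf T).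
move=> w [M HM].
have M0 : 0 <= M by apply: Rle_trans (HM 0%nat); exact: vnorm_nonneg.
case: (@precompP X (fun n => T (w n))).
{ move=> P HP e e0; case: (HT (e / (4 * (M + 1)))); first by apply: Rdiv_lt_0_compat; lra.
  move=> N HN; have {}HN := HN N (le_n _).
  have close n : <|T (w n) -v u N (w n)|> <= e / 4.
    have -> : T (w n) -v u N (w n) = -v ((u N -v T) (w n)) by autorewrite with bop; vring.
    rewrite vnorm_opp; apply: Rle_trans (bop_le _ _) _.
    have : e / 4 = e / (4 * (M + 1)) * (M + 1) by field; lra.
    have := HM n; have := vnorm_nonneg (w n); have := vnorm_nonneg (u N -v T); nra.
  case: (@precomp_close X (fun n => u N (w n)) P _ HP (e / 2)); last 2 first.
  - lra.
  - move=> i [j [Hij [Pi [Pj Hlt]]]]; exists i, j; split=> //; split=> //; split=> //.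
    have -> : T (w i) -v T (w j) = (T (w i) -v u N (w i)) +v (u N (w i) -v u N (w j)) -v (T (w j) -v u N (w j)) by vring.
    apply: Rle_lt_trans (vnorm_sub_le _ _) _; have := vnorm_triangle (T (w i) -v u N (w i)) (u N (w i) -v u N (w j)).
    have := close i; have := close j; lra.
  - by move=> phi Hphi _; apply: (compact_precomp (Hu N)) => n; exact: HM. }
by move=> phi [l [H1 H2]]; exists phi, l.
Qed.

Lemma compact_cmp_l A T : compact_op T -> compact_op (A ∘ T).
Proof.
move=> [_ H]; split; first exact: (bprf (A ∘ T)).
move=> u Hu; case: (H u Hu) => phi [l [H1 H2]]; exists phi, (A l); split=> //; exact: (conv_bop A H2).
Qed.
Lemma compact_cmp_r A T : compact_op T -> compact_op (T ∘ A).
Proof.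
move=> [_ H]; split; first exact: (bprf (T ∘ A)).
move=> u [M HM]; case: (H (fun n => A (u n))).
  exists (<|A|> * M) => n; apply: Rle_trans (bop_le _ _) _; apply: Rmult_le_compat_l => //; exact: vnorm_nonneg.
by move=> phi [l [H1 H2]]; exists phi, l.
Qed.
Lemma compact_add A B : compact_op A -> compact_op B -> compact_op (A +v B : Bop X).
Proof.
move=> [_ HA] [_ HB]; split; first exact: (bprf (A +v B)).
move=> u [M HM]; case: (HA u); first by exists M. move=> phi [l [H1 H2]].
case: (HB (fun n => u (phi n))); first by exists M. move=> psi [m [H3 H4]].
exists (fun n => phi (psi n)), (l +v m); split; first exact: (incr_comp H1 H3).
apply: converges_add => //; exact: (converges_subseq H3 H2).
Qed.
Lemma compact_zero : compact_op (0v : Bop X).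
Proof.
split; first exact: (bprf 0v).
move=> u _; exists (fun n => n), 0v; split; [by move=> n; lia|exact: converges_const].
Qed.
(** Given an eigenvector v of T at a <> 0, rescale a small circle around a, free of eigenvalues of
    T, to the unit circle. The rescaled [u n] have their spectrum in {-a/d}, outside the circle, so
    their projections vanish and their level-j inverses have norm at most 1/4, with j independent of
    n. The rescaled T kills v, so the limit gives |v| <= |v| / 4. *)
Lemma qn_limit (u : nat -> Bop X) T : (forall n, qn (u n)) -> converges u T -> compact_op T -> qn T.
Proof.
move=> Hu HT Tc a Ha; apply: (fredholm_eig Tc Ha) => -[v [v0 Ev]].
have pa := Cabs_pos Ha.
case: (@eig_finite X T (Cabs a / 2) Tc); first lra. move=> L HL.
case: (@avoid_list (map (fun b => Cabs (Cminus b a)) L) 0 (Cabs a / 2)); first lra.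
move=> d [Hd HdL]; have d0 : 0 < d by lra.
have dc : RtoC d <> C0 by apply: RtoC_neq0; lra.
pose S := RtoC (/ d) *v (T -v a *v idB); pose Sn n := RtoC (/ d) *v (u n -v a *v idB).
case: (@circ_bound X S).
{ move=> b Hb; have b0 := unit_neq0 Hb.
  pose c := Cmul (RtoC d) (Cinv b).
  have Hc : Cabs c = d by rewrite /c Cabs_mul Cabs_inv // Hb Cabs_RtoC Rabs_right; [field|lra].
  case: (@fredholm_eig X T (Cadd a c) Tc).
  - move=> E; have := Hc; have -> : c = Copp a.
      by have -> : c = Cminus (Cadd a c) a by [rewrite /Cminus; ring]; rewrite E /Cminus; ring.
    rewrite Cabs_opp; lra.
  - move=> He; apply: HdL; apply/in_map_iff; exists (Cadd a c); split.
      by rewrite -Hc; congr Cabs; rewrite /Cminus; ring.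
    apply: HL => //; have := Cabs_triangle (Cadd a c) (Copp c); rewrite Cabs_opp Hc.
    have -> : Cadd (Cadd a c) (Copp c) = a by ring. lra.
  - move=> R HR; apply: (@inv_resolvent (T -v a *v idB) b d R) => //.
    have -> : T -v a *v idB -v Cmul (RtoC d) (Cinv b) *v idB = T -v Cadd a c *v idB by rewrite /c; vring.
    exact: HR. }
move=> M M0 HM.
pose eps (j : nat) := 4 * ((2 * M) * (2 * M + 1)) * (3 / 4) ^ j.
have [j Hj] : exists j, eps j < / 4.
  case: (@pow_lt_small (3 / 4) ltac:(lra) (/ (16 * ((2 * M) * (2 * M + 1))))).
    by apply: Rinv_0_lt_compat; nra.
  move=> N HN; exists N; rewrite /eps; have := HN N (le_n _) => Hlt.
  have p : 0 < 4 * (2 * M * (2 * M + 1)) by nra.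
  have := Rmult_lt_compat_l _ _ _ p Hlt.
  have -> : 4 * (2 * M * (2 * M + 1)) * / (16 * (2 * M * (2 * M + 1))) = / 4 by field; nra.
  lra.
have cS : converges Sn S.
  by apply: converges_scal; apply: converges_sub => //; exact: converges_const.
case: (cS (/ (2 * M))); first by apply: Rinv_0_lt_compat; lra. move=> N0 HN0.
have key n : (N0 <= n)%nat -> <|v|> <= / 4 * <|(idB -v pw (Sn n) (2 ^ j)) v|>.
  move=> Hn; have HC : circ (Sn n) (2 * M).
    apply: (circ_perturb M0 HM); have := HN0 n Hn => Hlt.
    have -> : / 2 = / (2 * M) * M by field; lra.
    by apply: Rmult_le_compat_r; lra.
  case: (circle_proj HC) => P [A [HA [HL' [HM' [Hdist _]]]]].
  case: (Hu n a Ha) => R0 HR0; pose Q := RtoC d *v R0.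
  have HQ : inv (Sn n) Q.
    have -> : Q = Cinv (RtoC (/ d)) *v R0.
      congr (_ *v _); rewrite -(_ : Cmul (Cmul (RtoC d) (RtoC (/ d))) (Cinv (RtoC (/ d))) = RtoC d).
        have -> : Cmul (RtoC d) (RtoC (/ d)) = C1 by apply: C_ext; cbn; field; lra.
        by ring.
      by rewrite -{2}(_ : Cmul (RtoC d) C1 = RtoC d); [|ring]; rewrite -(@Cinv_r (RtoC (/ d)));
        [ring|apply: RtoC_neq0; have := Rinv_0_lt_compat _ d0; lra].
    apply: inv_scal => //; apply: RtoC_neq0; have := Rinv_0_lt_compat _ d0; lra.
  (* The inverse [Q] of [Sn n] has spectral radius below 1, because Sn n - c is invertible for 0 <
     |c| <= 1: there a + d c cannot vanish, as d < |a|. *)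
  have Hgel : exists N, <|pw Q (Datatypes.S N)|> < 1 ^ Datatypes.S N.
    apply: gelfand; first lra. move=> t b Ht Hb.
    have b0 := unit_neq0 Hb; have t0 : 0 < t by lra.
    pose c := Cmul b (RtoC (/ t)).
    have c0 : c <> C0 by apply: Cmul_neq0 => //; apply: RtoC_neq0; have := Rinv_0_lt_compat _ t0; lra.
    have Hc : Cabs c <= 1.
      rewrite /c Cabs_mul Hb Cabs_RtoC Rabs_right ?Rmult_1_l; last by left; exact: Rinv_0_lt_compat.
      by rewrite -Rinv_1; apply: Rinv_le_contravar; lra.
    case: (Hu n (Cadd a (Cmul (RtoC d) c))).
      move=> E; have : Cabs a <= d.
        have -> : a = Copp (Cmul (RtoC d) c).
          by rewrite -(_ : Cminus (Cadd a (Cmul (RtoC d) c)) (Cmul (RtoC d) c) = a); [rewrite E /Cminus; ring|rewrite /Cminus; ring].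
        rewrite Cabs_opp Cabs_mul Cabs_RtoC Rabs_right; [nra|lra].
      lra.
    move=> R1 HR1.
    have E : idB -v b *v (RtoC (/ t) *v Q) = Q ∘ (RtoC (/ d) *v (u n -v Cadd a (Cmul (RtoC d) c) *v idB)).
      have -> : RtoC (/ d) *v (u n -v Cadd a (Cmul (RtoC d) c) *v idB) = Sn n -v c *v idB.
        have E1 : Cmul (RtoC (/ d)) (RtoC d) = C1 by apply: C_ext; cbn; field; lra.
        have {2}-> : c = Cmul (Cmul (RtoC (/ d)) (RtoC d)) c by rewrite E1; ring.
        rewrite /Sn; vring.
      by rewrite cmpDr cmpNr cmpZr cmp1r (proj2 HQ) vscal_assoc.
    rewrite E; eexists; apply: inv_cmp; first exact: (inv_sym HQ).
    apply: inv_scal HR1; apply: RtoC_neq0; have := Rinv_0_lt_compat _ d0; lra.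
  case: Hgel => N1; rewrite pow1 => HN1.
  have Hvan := pw_vanish HN1.
  have QS k : pw Q k ∘ pw (Sn n) k = idB.
    by elim: k => [|k IH]; [rewrite cmp1l|rewrite pwSr pwS -!cmpA (cmpA Q) (proj2 HQ) cmp1l].
  have HP : P = 0v.
    apply: vnorm_small => e e0; apply: (converges_norm_le HA).
    case: (Hvan (e / (2 * M + 1))); first by apply: Rdiv_lt_0_compat; lra.
    move=> n0 Hn0; exists n0 => i Hi.
    have EA : A i = pw Q (2 ^ i) ∘ (A i -v idB).
      have := proj1 (HL' i); rewrite cmpDl cmpNl cmpZl vscal_1 cmp1l => E1.
      have -> : A i -v idB = pw (Sn n) (2 ^ i) ∘ A i by rewrite -E1; vring.
      by rewrite cmpA QS cmp1l.
    rewrite EA; apply: Rle_trans (bnorm_cmp _ _) _.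
    have := Hn0 (2 ^ i)%nat ltac:(have := Nat.pow_gt_lin_r 2 i; lia).
    have := vnorm_sub_le (A i) idB; have := bnorm_id X; have := HM' i.
    have := vnorm_nonneg (A i -v idB); have := vnorm_nonneg (pw Q (2 ^ i)).
    have : e = e / (2 * M + 1) * (2 * M + 1) by field; lra.
    nra.
  have HAj : <|A j|> <= / 4.
    have := Hdist j; rewrite HP vadd_0l vnorm_opp -/(eps j); lra.
  have Ev2 : v = A j ((idB -v pw (Sn n) (2 ^ j)) v).
    by rewrite -cmp_app; have := proj2 (HL' j); rewrite vscal_1 => ->.
  rewrite {1}Ev2; apply: Rle_trans (bop_le _ _) _; apply: Rmult_le_compat_r => //; exact: vnorm_nonneg.
have Sv : S v = 0v by rewrite /S; autorewrite with bop; rewrite Ev; vring.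
have cpw k : converges (fun n => pw (Sn n) k) (pw S k).
  elim: k => [|k IH]; first exact: converges_const.
  exact: conv_cmp.
have lim : <|v|> <= / 4 * <|v|>.
  have C : converges (fun n => RtoC (/ 4) *v ((idB -v pw (Sn n) (2 ^ j)) v)) (RtoC (/ 4) *v v).
    have {2}-> : v = (idB -v pw S (2 ^ j)) v.
      have -> : (2 ^ j = Datatypes.S (2 ^ j - 1))%nat by have := Nat.pow_nonzero 2 j; lia.
      by rewrite pwSr; autorewrite with bop; rewrite Sv bop0; vring.
    apply: converges_scal; apply: conv_app; apply: converges_sub; [exact: converges_const|exact: cpw].
  have := converges_norm_ge (B := <|v|>) C; rewrite vnorm_scal Cabs_RtoC Rabs_right; last lra.
  apply; exists N0 => n Hn; rewrite vnorm_scal Cabs_RtoC Rabs_right; last lra. exact: key.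
have := vnorm_pos v0; lra.
Qed.
End Growth.

(** Cantor's nested intervals: step n passes to a subinterval strictly inside the half that avoids
    [f n]. *)
Lemma avoid_seq (f : nat -> R) a b : a < b -> exists t, a < t < b /\ forall n, f n <> t.
Proof.
move=> Hab.
pose step (n : nat) (I : R * R) : R * R :=
  let: (l, r) := I in
  match Rle_lt_dec (f n) ((l + r) / 2) with
  | left _ => (l + 5 / 8 * (r - l), l + 7 / 8 * (r - l))
  | right _ => (l + 1 / 8 * (r - l), l + 3 / 8 * (r - l))
  end.
pose I := fix I n := match n with O => (a, b) | S n => step n (I n) end.
have stepP n J : fst J < snd J -> fst J < fst (step n J) /\ fst (step n J) < snd (step n J) /\
   snd (step n J) < snd J /\ ~ (fst (step n J) <= f n <= snd (step n J)).
  case: J => l r /= Hlr; case: Rle_lt_dec => H /=; repeat split; lra.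
have Ilt n : fst (I n) < snd (I n) by elim: n => [|n IH] //=; case: (stepP n _ IH) => _ [].
have mono m n : (m <= n)%nat -> fst (I m) <= fst (I n) /\ snd (I n) <= snd (I m).
  move=> H; elim: n / H => [|n H [IH1 IH2]]; first lra.
  case: (stepP n _ (Ilt n)) => /= ? [? [? _]]; lra.
have lr m n : fst (I m) < snd (I n).
  case: (Nat.le_ge_cases m n) => H.
    case: (mono _ _ H) => ? _; have := Ilt n; lra.
  case: (mono _ _ H) => _ ?; have := Ilt m; lra.
case: (completeness (fun x => exists n, x = fst (I n))).
- by exists b => x [n ->]; have := lr n 0%nat; rewrite /=; lra.
- by exists a, 0%nat.
- move=> t [ub lu].
  have H1 n : fst (I n) <= t by apply: ub; exists n.
  have H2 n : t <= snd (I n) by apply: lu => x [m ->]; have := lr m n; lra.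
  exists t; split.
    have := H1 1%nat; have := H2 1%nat.
    have := Ilt 1%nat; case: (stepP 0%nat (I 0%nat) (Ilt 0%nat)) => ? [? [? _]]; cbn [I fst snd] in *; lra.
  move=> n En; case: (stepP n _ (Ilt n)) => _ [_ [_]]; apply; rewrite En; split; [exact: (H1 (S n))|exact: (H2 (S n))].
Qed.

(** * The Riesz decomposition of compact operators and local spectral radius zero *)

Section Riesz.
Variable X : CBanach.
Implicit Types (A B D T S P Q K : Bop X) (x y : X).

(** Only finitely many eigenvalues have modulus at least eta/2, so some circle of radius r below eta
    meets none, and [circle_proj] applies to K / r. The complement 1 - P is nearly a multiple of the
    compact [K], which makes its range finite-dimensional. *)
Lemma riesz_decomp K (eta : R) : compact_op K -> 0 < eta -> exists (r M : R) P (l : list X),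
  0 < r < eta /\ 0 <= M /\ (forall n, <|pw K n ∘ P|> <= M * r ^ n) /\ P ∘ P = P /\
  (forall B, comm K B -> comm P B) /\ forall x, span l (x -v P x).
Proof.
move=> HK e0; case: (@eig_finite X K (eta / 2) HK); first lra. move=> L HL.
case: (@avoid_list (map Cabs L) (eta / 2) eta); first lra. move=> r [Hr HrL].
have r0 : 0 < r by lra.
case: (@circ_bound X (RtoC (/ r) *v K)).
{ move=> a Ha; have a0 := unit_neq0 Ha.
  have Hc : Cabs (Cmul (RtoC r) (Cinv a)) = r.
    by rewrite Cabs_mul Cabs_inv // Ha Cabs_RtoC Rabs_right; [field|lra].
  case: (@fredholm_eig X K (Cmul (RtoC r) (Cinv a)) HK).
  - by move=> E; move: Hc; rewrite E Cabs_C0; lra.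
  - move=> He; apply: HrL; apply/in_map_iff; exists (Cmul (RtoC r) (Cinv a)); split=> //.
    by apply: HL => //; lra.
  - by move=> R HR; exact: (inv_resolvent Ha r0 HR). }
move=> M M0 HM.
case: (circle_proj HM) => P [A [_ [_ [_ [_ [HSP [PP [HY [_ HC]]]]]]]]].
have cK B : comm K B -> comm (RtoC (/ r) *v K) B.
  by rewrite /comm cmpZl cmpZr => ->.
have HQ : subsp (fun x => (idB -v P) x = x).
  split; first by rewrite bop0.
  split; first by move=> x y Hx Hy; rewrite bopD Hx Hy.
  by move=> c x Hx; rewrite bopZ Hx.
have idem : (idB -v P) ∘ (idB -v P) = idB -v P.
  by rewrite cmpDl cmp1l cmpNl cmpDr cmpNr cmp1r PP; vring.
case: (fd_of_pairs HQ).
  (* On the range of 1 - P the identity is within 1/16 of a compact operator, so two unit-ball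
     vectors whose images are 1/8-close are themselves within 1/4. *)
  move=> u Hu; case: (HY 0%nat (/ 16)); first lra. move=> Y [HYM [HYd _]].
  rewrite pw1 in HYd.
  have Kc : compact_op ((RtoC (/ r) *v K : Bop X) ∘ Y) by apply: compact_cmp_r; exact: compact_scal.
  have [i [j [Hij Hlt]]] := precomp_pair (compact_precomp Kc (fun n => proj2 (Hu n))) (ltac:(lra) : 0 < / 8).
  exists i, j; split=> //.
  have cl n : <|u n -v ((RtoC (/ r) *v K : Bop X) ∘ Y) (u n)|> <= / 16.
    have [Eu Hn] := Hu n.
    have -> : u n -v ((RtoC (/ r) *v K : Bop X) ∘ Y) (u n) = (idB -v P -v (RtoC (/ r) *v K : Bop X) ∘ Y) (u n).
      by rewrite -{1}Eu.
    apply: Rle_trans (bop_le _ _) _; have := vnorm_nonneg (u n); nra.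
  set F := (RtoC (/ r) *v K : Bop X) ∘ Y in cl Hlt.
  have -> : u i -v u j = (u i -v F (u i)) +v (F (u i) -v F (u j)) -v (u j -v F (u j)) by vring.
  apply: Rle_lt_trans (vnorm_sub_le _ _) _.
  have := vnorm_triangle (u i -v F (u i)) (F (u i) -v F (u j)); have := cl i; have := cl j; lra.
move=> l [_ Hl]; exists r, M, P, l; split; first lra. split; first lra.
split.
  move=> n; have p : 0 < r ^ n by apply: pow_lt.
  have := HSP n; case: (pwZ (RtoC (/ r)) K n) => c [-> Hc].
  rewrite cmpZl vnorm_scal Hc Cabs_RtoC Rabs_right; last by left; exact: Rinv_0_lt_compat.
  rewrite pow_inv => H; apply: (Rmult_le_reg_l (/ r ^ n)); first exact: Rinv_0_lt_compat.
  by apply: Rle_trans H _; right; field; lra.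
split=> //; split; first by move=> B /cK; exact: HC.
move=> x; apply: Hl; change ((idB -v P) ((idB -v P) x) = (idB -v P) x).
by rewrite -cmp_app idem.
Qed.

(* The vectors at which S has local spectral radius 0. *)
Definition NN S (u : X) := forall t, 0 < t -> exists K : R, 0 <= K /\ forall n, <|pw S n u|> <= K * t ^ n.

Lemma NN_subsp S : subsp (NN S).
Proof.
split; first by move=> t t0; exists 0; split; [lra|move=> n; rewrite bop0 vnorm_0; lra].
split.
  move=> x y Hx Hy t t0; case: (Hx t t0) => K1 [P1 H1]; case: (Hy t t0) => K2 [P2 H2].
  exists (K1 + K2); split; first lra. move=> n; rewrite bopD.
  apply: Rle_trans (vnorm_triangle _ _) _; have := H1 n; have := H2 n; lra.
move=> c x Hx t t0; case: (Hx t t0) => K1 [P1 H1]; have := Cabs_nonneg c => P2.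
exists (Cabs c * K1); split; first nra. move=> n; rewrite bopZ vnorm_scal Rmult_assoc.
by apply: Rmult_le_compat_l.
Qed.

(** On a circle of radius d < |c|/2 around 0 the resolvent of S = c + K involves only eigenvalues of
    K of modulus at least |c|/2, so a suitable d exists. The projection inside it fixes every vector
    of [NN S], whence |S^n u| <= M d^n |u|. But S^n is c^n plus a compact operator, so for large n
    the identity on [NN S] is close to a compact operator. *)
Lemma NN_fd K c : compact_op K -> c <> C0 -> exists l, forall u, NN (c *v idB +v K) u -> span l u.
Proof.
move=> HK c0; have pc := Cabs_pos c0; set S := c *v idB +v K.
case: (@eig_finite X K (Cabs c / 2) HK); first lra. move=> L HL.
case: (@avoid_list (map (fun b => Cabs (Cadd b c)) L) (Cabs c / 4) (Cabs c / 2)); first lra.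
move=> d [Hd HdL]; have d0 : 0 < d by lra.
case: (@circ_bound X (RtoC (/ d) *v S)).
{ move=> a Ha; have a0 := unit_neq0 Ha; pose w := Cmul (RtoC d) (Cinv a).
  have Hw : Cabs w = d by rewrite /w Cabs_mul Cabs_inv // Ha Cabs_RtoC Rabs_right; [field|lra].
  have tri : Cabs c / 2 <= Cabs (Cminus w c).
    have := Cabs_triangle (Copp (Cminus w c)) w; rewrite Cabs_opp.
    have -> : Cadd (Copp (Cminus w c)) w = c by rewrite /Cminus; ring. lra.
  case: (@fredholm_eig X K (Cminus w c) HK).
  - move=> E; move: tri; rewrite E Cabs_C0; lra.
  - move=> He; apply: HdL; apply/in_map_iff; exists (Cminus w c); split; last exact: HL.
    by rewrite -Hw; congr Cabs; rewrite /Cminus; ring.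
  - move=> R HR; apply: (inv_resolvent Ha d0).
    have -> : S -v Cmul (RtoC d) (Cinv a) *v idB = K -v Cminus w c *v idB by rewrite /S /Cminus /w; vring.
    exact: HR. }
move=> M M0 HM; case: (circle_proj HM) => P [A [HA [HL' [HM' [_ [HSP _]]]]]].
set S' := (RtoC (/ d) *v S : Bop X) in HM HL' HSP.
(* A j u - u equals A j applied to the 2^j-th power of S / d at u, and these vectors tend to 0. *)
have NNP u : NN S u -> P u = u.
  move=> Hu; apply: vsub_eq0; apply: vnorm_small => e e0.
  apply: (converges_norm_le (u := fun j => A j u -v u)).
    by apply: converges_sub; [exact: conv_app|exact: converges_const].
  case: (Hu (d / 2)); first lra. move=> K1 [K10 HK1].
  case: (@pow_lt_small (/ 2) ltac:(lra) (e / (M * K1 + 1))); first by apply: Rdiv_lt_0_compat; nra.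
  move=> n0 Hn0; exists n0 => j Hj.
  have -> : A j u -v u = A j (pw S' (2 ^ j) u).
    have E := proj2 (HL' j); rewrite vscal_1 cmpDr cmpNr cmp1r in E.
    have -> : A j (pw S' (2 ^ j) u) = (A j -v (A j -v A j ∘ pw S' (2 ^ j))) u by autorewrite with bop; vring.
    by rewrite E; autorewrite with bop.
  apply: Rle_trans (bop_le _ _) _.
  have H1 : <|pw S' (2 ^ j) u|> <= K1 * (/ 2) ^ (2 ^ j).
    case: (pwZ (RtoC (/ d)) S (2 ^ j)) => b [Eb Hb]; rewrite /S' Eb bscal_app vnorm_scal Hb.
    rewrite Cabs_RtoC Rabs_right; last by left; exact: Rinv_0_lt_compat.
    have p : 0 < d ^ (2 ^ j) by apply: pow_lt.
    rewrite (pow_inv d); have := HK1 (2 ^ j)%nat; rewrite /Rdiv Rpow_mult_distr => H.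
    apply: (Rmult_le_reg_l (d ^ (2 ^ j))) => //; rewrite -Rmult_assoc Rinv_r ?Rmult_1_l; last lra.
    apply: Rle_trans H _; right; ring.
  have H2 := Hn0 (2 ^ j)%nat ltac:(have := Nat.pow_gt_lin_r 2 j; lia).
  have : 0 < (/ 2) ^ (2 ^ j) by apply: pow_lt; lra.
  have : e = e / (M * K1 + 1) * (M * K1 + 1) by field; nra.
  have := HM' j; have := vnorm_nonneg (A j); have := vnorm_nonneg (pw S' (2 ^ j) u) => q1 q2 q3 q4 q5.
  apply: Rle_trans (_ : M * (K1 * (/ 2) ^ (2 ^ j)) <= _); first by apply: Rmult_le_compat.
  have : (/ 2) ^ (2 ^ j) * (M * K1 + 1) < e.
    rewrite q4; apply: Rmult_lt_compat_r => //; nra.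
  nra.
have growth u n : NN S u -> <|pw S n u|> <= M * d ^ n * <|u|>.
  move=> /NNP Hu; have p : 0 < d ^ n by apply: pow_lt.
  have H := bop_le (pw S' n ∘ P) u; rewrite cmp_app Hu in H.
  have H2 := HSP n; move: H; case: (pwZ (RtoC (/ d)) S n) => b [Eb Hb].
  rewrite /S' in H2 *; rewrite {1}Eb bscal_app vnorm_scal Hb Cabs_RtoC Rabs_right; last by left; exact: Rinv_0_lt_compat.
  rewrite pow_inv => H; have q := vnorm_nonneg u.
  apply: (Rmult_le_reg_l (/ d ^ n)); first exact: Rinv_0_lt_compat.
  apply: Rle_trans H _; apply: Rle_trans (_ : M * <|u|> <= _); first by apply: Rmult_le_compat_r.
  by right; field; lra.
have expand n : exists Q, pw S n = pw (c *v idB) n +v K ∘ Q.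
  elim: n => [|n [Q EQ]]; first by exists 0v; rewrite cmp0r; cbn [pw]; vring.
  exists (pw S n +v c *v Q).
  rewrite pwS {1}EQ [in RHS]EQ [in RHS]pwS /S; bext x.
have pwc n : exists b, pw (c *v (idB : Bop X)) n = b *v idB /\ Cabs b = Cabs c ^ n.
  elim: n => [|n [b [E Eb]]]; first by exists C1; rewrite vscal_1 Cabs_C1.
  by exists (Cmul c b); rewrite pwS E; split; [bext x|rewrite Cabs_mul Eb].
case: (fd_of_pairs (NN_subsp S)); last by move=> l [_ Hl]; exists l.
move=> u Hu.
have dc : 0 <= d / Cabs c < 1.
  split; first by apply: Rlt_le; apply: Rdiv_lt_0_compat.
  by apply: (Rmult_lt_reg_r (Cabs c)) => //; rewrite /Rdiv Rmult_assoc Rinv_l; lra.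
case: (@pow_lt_small _ dc (/ (16 * M))); first by apply: Rinv_0_lt_compat; lra.
move=> n /(_ n (le_n _)) Hn.
case: (expand n) => Q EQ; case: (pwc n) => b [Eb Hb].
have pcn : 0 < Cabs c ^ n by apply: pow_lt.
have b0 : b <> C0 by move=> E; move: Hb; rewrite E Cabs_C0; lra.
pose F := Copp (Cinv b) *v (K ∘ Q) : Bop X.
have Fc : compact_op F by apply: compact_scal; exact: compact_cmp_r.
have cl i : <|u i -v F (u i)|> <= / 16.
  have -> : u i -v F (u i) = Cinv b *v pw S n (u i).
    have -> : Cinv b *v pw S n (u i) = (Cinv b *v pw S n : Bop X) (u i) by [].
    rewrite EQ Eb /F; autorewrite with bop; vring; field; exact: b0.
  rewrite vnorm_scal Cabs_inv // Hb.
  have := growth (u i) n (proj1 (Hu i)); have := proj2 (Hu i) => q1 q2.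
  have p : 0 < d ^ n by apply: pow_lt.
  have mp : 0 < M * d ^ n by apply: Rmult_lt_0_compat.
  have : <|pw S n (u i)|> <= M * d ^ n by apply: Rle_trans q2 _; nra.
  move=> q3; apply: Rle_trans (_ : / Cabs c ^ n * (M * d ^ n) <= _).
    by apply: Rmult_le_compat_l => //; left; exact: Rinv_0_lt_compat.
  have E : d ^ n = (d / Cabs c) ^ n * Cabs c ^ n by rewrite -Rpow_mult_distr; congr (_ ^ _); field; lra.
  rewrite E; apply: Rle_trans (_ : M * (d / Cabs c) ^ n <= _); first by right; field; lra.
  have := Rmult_lt_compat_l _ _ _ M0 Hn; have -> : M * / (16 * M) = / 16 by field; lra. lra.
have [i [j [Hij Hlt]]] := precomp_pair (compact_precomp Fc (fun n => proj2 (Hu n))) (ltac:(lra) : 0 < / 8).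
exists i, j; split=> //.
have -> : u i -v u j = (u i -v F (u i)) +v (F (u i) -v F (u j)) -v (u j -v F (u j)) by vring.
apply: Rle_lt_trans (vnorm_sub_le _ _) _.
have := vnorm_triangle (u i -v F (u i)) (F (u i) -v F (u j)); have := cl i; have := cl j; lra.
Qed.
End Riesz.

(** * Operators on finite-dimensional subspaces *)

Section Sub.
Variables (X : CBanach) (E : X -> Prop).
Hypothesis HE : closed_subspace E.

Let S0 := proj1 (closed_subsp HE).
Let Sa := proj1 (proj2 (closed_subsp HE)).
Let Ss := proj2 (proj2 (closed_subsp HE)).

Definition subT := {x : X | E x}.
Lemma subT_ext (x y : subT) : proj1_sig x = proj1_sig y -> x = y.
Proof. by case: x => x Hx; case: y => y Hy /= Exy; subst y; congr exist; apply: proof_irrelevance. Qed.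

Definition subB : CBanach.
Proof.
refine (@Build_CBanach subT (exist _ _ S0) (fun x y => exist _ _ (Sa (proj2_sig x) (proj2_sig y)))
  (fun x => exist _ _ (subsp_opp (closed_subsp HE) (proj2_sig x)))
  (fun c x => exist _ _ (Ss c (proj2_sig x))) (fun x => <|proj1_sig x|>) _ _ _ _ _ _ _ _ _ _ _ _ _).
- by move=> x y z; apply: subT_ext => /=; exact: vadd_assoc.
- by move=> x y; apply: subT_ext => /=; exact: vadd_comm.
- by move=> x; apply: subT_ext => /=; exact: vadd_0.
- by move=> x; apply: subT_ext => /=; exact: vadd_opp.
- by move=> x; apply: subT_ext => /=; exact: vscal_1.
- by move=> a b x; apply: subT_ext => /=; exact: vscal_assoc.
- by move=> a x y; apply: subT_ext => /=; exact: vscal_distr_v.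
- by move=> a b x; apply: subT_ext => /=; exact: vscal_distr_s.
- by move=> x; exact: vnorm_nonneg.
- by move=> x H; apply: subT_ext => /=; exact: vnorm_eq0.
- by move=> x y /=; exact: vnorm_triangle.
- by move=> a x /=; exact: vnorm_scal.
- move=> u Hu; case: (@vcomplete X (fun n => proj1_sig (u n)) Hu) => l Hl.
  have El : E l by case: HE => _ [_ [_ Hc]]; apply: (Hc (fun n => proj1_sig (u n))) => // n; exact: (proj2_sig (u n)).
  by exists (exist _ l El).
Defined.

Lemma restr_bounded (K : Bop X) (HK : forall x, E x -> E (K x)) :
  bounded_op (fun x : subB => exist _ _ (HK _ (proj2_sig x)) : subB).
Proof.
split; first by move=> x y; apply: subT_ext => /=; exact: bopD.
split; first by move=> a x; apply: subT_ext => /=; exact: bopZ.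
by exists <|K|> => x /=; exact: bop_le.
Qed.
Definition restr (K : Bop X) HK : Bop subB := mkBop (@restr_bounded K HK).

Lemma sub_compact (l : list X) (T : Bop subB) : (forall x, E x -> span l x) -> compact_op T.
Proof.
move=> Hl; split; first exact: (bprf T).
move=> u [M HM].
case: (@span_compact X l (fun n => proj1_sig (T (u n))) (<|T|> * M)).
- by move=> n; apply: Hl; exact: (proj2_sig (T (u n))).
- move=> n; apply: Rle_trans (bop_le T (u n)) _; apply: Rmult_le_compat_l => //; exact: vnorm_nonneg.
- move=> phi [x [H1 [H2 _]]].
  have Ex : E x by case: HE => _ [_ [_ Hc]]; apply: (Hc _ _ _ H2) => n; exact: (proj2_sig (T (u (phi n)))).
  by exists phi, (exist _ x Ex).
Qed.

(* Without eigenvalues both K and its inverse would be quasinilpotent. *)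
Lemma eig_exists (l : list X) (K : Bop X) : (forall x, E x -> span l x) -> (forall x, E x -> E (K x)) ->
  (exists x, E x /\ x <> 0v) -> exists a v, E v /\ v <> 0v /\ K v = a *v v.
Proof.
move=> Hl HK [x0 [Ex0 x00]]; apply: NNPP => Hno.
set K' := restr HK.
have Hinv a : exists R, inv (K' -v a *v idB) R.
{ case: (@fredholm subB (idB -v (K' -v a *v idB))); first exact: (sub_compact _ Hl).
  - move=> v Ev; apply: NNPP => v0; apply: Hno; exists a, (proj1_sig v); split; first exact: (proj2_sig v).
    split; first by move=> E0; apply: v0; apply: subT_ext.
    have : K' v -v a *v v = 0v.
      have -> : K' v -v a *v v = v -v (idB -v (K' -v a *v idB)) v by autorewrite with bop; vring.
      by rewrite -Ev vadd_opp.
    move=> /vsub_eq0 H; exact: (f_equal (@proj1_sig _ _) H).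
  - move=> R HR; exists R; have -> : K' -v a *v idB = idB -v (idB -v (K' -v a *v idB)) by vring. exact: HR. }
have [Q HQ] := Hinv C0.
have {}HQ : inv K' Q by have -> : K' = K' -v C0 *v idB by vring.
case: (@qn_gz _ K' (fun a _ => Hinv a) (/ 2)); first lra. move=> K1 [K10 HK1].
case: (@gelfand _ Q (/ 2)); first lra.
  move=> t b Ht Hb; have b0 := unit_neq0 Hb.
  case: (Hinv (Cmul b (RtoC (/ t)))) => R HR.
  have -> : idB -v b *v (RtoC (/ t) *v Q) = Q ∘ (K' -v Cmul b (RtoC (/ t)) *v idB).
    by rewrite cmpDr cmpNr cmpZr cmp1r (proj2 HQ) vscal_assoc.
  by eexists; apply: inv_cmp; [exact: (inv_sym HQ)|exact: HR].
move=> N HN; case: (@growth_of_power _ Q N (/ 2)); [lra|lra|].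
move=> K2 [K20 HK2].
have Z : (idB : Bop subB) = 0v.
  apply: vnorm_small => e e0; case: (@pow_lt_small (/ 4) ltac:(lra) (e / (K1 * K2 + 1))).
    by apply: Rdiv_lt_0_compat; nra.
  move=> n /(_ n (le_n _)) Hn.
  have -> : (idB : Bop subB) = pw K' n ∘ pw Q n.
    by rewrite -pw_cmp; [rewrite (proj1 HQ); elim: n {Hn} => [|n IH] //; rewrite pwS -IH cmp1l|rewrite /comm (proj1 HQ) (proj2 HQ)].
  apply: Rle_trans (bnorm_cmp _ _) _; apply: Rle_trans (_ : K1 * (/ 2) ^ n * (K2 * (/ 2) ^ n) <= _).
    by apply: Rmult_le_compat; try exact: vnorm_nonneg.
  have -> : K1 * (/ 2) ^ n * (K2 * (/ 2) ^ n) = K1 * K2 * (/ 4) ^ n.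
    by have -> : / 4 = / 2 * / 2 by [field]; rewrite Rpow_mult_distr; ring.
  have p : 0 < (/ 4) ^ n by apply: pow_lt; lra.
  have : e = e / (K1 * K2 + 1) * (K1 * K2 + 1) by field; nra.
  nra.
apply: x00; have := f_equal (fun T : Bop subB => T (exist _ x0 Ex0)) Z => /= H.
exact: (f_equal (@proj1_sig _ _) H).
Qed.
End Sub.

Section Annihilate.
Variable X : CBanach.
Implicit Types (A B D T S P Q K : Bop X) (x y : X).

Lemma span_drop (l : list X) T v : span l v -> v <> 0v -> T v = 0v ->
  exists l', (length l' < length l)%nat /\ forall x, span l x -> span l' (T x).
Proof.
move=> Hv v0 Tv; elim: l v Hv v0 Tv => [|w l IH] v /=; first by move=> ->.
move=> [c [y [Hy ->]]] v0 Tv.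
case: (classic (c = C0)) => Hc.
  subst c; have Ey : C0 *v w +v y = y by vring.
  rewrite Ey in v0 Tv; case: (IH y Hy v0 Tv) => l' [H1 H2].
  exists (T w :: l'); split; first by simpl; lia.
  move=> x [d [z [Hz ->]]]; exists d, (T z); rewrite bopD bopZ; split=> //; exact: H2.
exists (map T l); split; first by rewrite length_map; lia.
have Hm z : span l z -> span (map T l) (T z).
  elim: l z {IH Hy} => [|u l IH] z /=; first by move=> ->; rewrite bop0.
  by move=> [d [z' [Hz' ->]]]; exists d, (T z'); rewrite bopD bopZ; split=> //; exact: IH.
have [S0 [Sa Ss]] := span_subsp (map T l).
move=> x [d [z [Hz ->]]]; rewrite bopD bopZ; apply: (Sa); last exact: Hm.
apply: (Ss); have -> : T w = Copp (Cinv c) *v T y; last by apply: (Ss); exact: Hm.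
move: Tv; rewrite bopD bopZ => Tv.
have -> : T w = Cinv c *v ((c *v T w +v T y) -v T y).
  by vring; field.
by rewrite Tv; vring.
Qed.

Fixpoint prodK K (L : list C) : Bop X :=
  match L with [] => idB | a :: L => prodK K L ∘ (K -v a *v idB) end.

(** An eigenvector for a is killed by K - a, so (K - a) E has a shorter spanning list and the
    induction continues there. A polynomial split into eigenvalue factors replaces the Jordan
    form. *)
Lemma annihilate (l : list X) (E : X -> Prop) K : subsp E -> (forall x, E x -> span l x) ->
  (forall x, E x -> E (K x)) -> exists L, (forall a, In a L -> eigenvalue K a) /\ forall x, E x -> prodK K L x = 0v.
Proof.
have [n Hn] : exists n, (length l <= n)%nat by exists (length l).
elim: n l E Hn => [|n IH] l E Hn HE Hl HK.
  exists []; split=> // x Ex; case: l Hn Hl => [|w l] /= Hn Hl; last by lia.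
  by rewrite (Hl x Ex).
case: (classic (exists x, E x /\ x <> 0v)) => [Hne|Hz]; last first.
  by exists []; split=> // x Ex; apply: NNPP => x0; apply: Hz; exists x.
have Ecl : closed_subspace E.
  case: (subspan HE Hl) => [H|[l' [_ [H1 H2]]]].
    case: (HE) => [S0 [Sa Ss]]; split=> //; split=> //; split=> // u x Hu Hx; apply: H.
    by case: (span_closed l) => _ [_ [_ Hc]]; apply: (Hc u) => // k; exact: Hl.
  case: (HE) => [S0 [Sa Ss]]; split=> //; split=> //; split=> // u x Hu Hx; apply: (span_min HE H2).
  by case: (span_closed l') => _ [_ [_ Hc]]; apply: (Hc u) => // k; exact: H1.
case: (eig_exists Ecl Hl HK Hne) => a [v [Ev [v0 Kv]]].
have Tv : (K -v a *v idB) v = 0v by autorewrite with bop; rewrite Kv vadd_opp.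
case: (span_drop (Hl v Ev) v0 Tv) => l' [H1 H2].
case: (IH l' (fun y => exists x, E x /\ y = (K -v a *v idB) x)).
- lia.
- case: (HE) => [S0 [Sa Ss]]; split; first by exists 0v; rewrite bop0.
  split; first by move=> x y [x' [Ex ->]] [y' [Ey ->]]; exists (x' +v y'); rewrite bopD; split=> //; exact: Sa.
  by move=> c x [x' [Ex ->]]; exists (c *v x'); rewrite bopZ; split=> //; exact: Ss.
- by move=> x [x' [Ex ->]]; apply: H2; exact: Hl.
- move=> x [x' [Ex ->]]; exists (K x'); split; first exact: HK.
  by autorewrite with bop.
- move=> L [HL1 HL2]; exists (a :: L); split; first by move=> b /= [<-|/HL1] //; exists v.
  by move=> x Ex; cbn [prodK]; rewrite cmp_app; apply: HL2; exists x.
Qed.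
End Annihilate.

(** * Two-sided multiplications *)

Section LR.
Variable X : CBanach.
Implicit Types (A B D T S P Q K k y : Bop X).

Lemma lr_bounded A B : bounded_op (fun T : opB X => (A ∘ T ∘ B : Bop X) : opB X).
Proof.
split; first by move=> S T; rewrite cmpDr cmpDl.
split; first by move=> a T; rewrite cmpZr cmpZl.
exists (<|A|> * <|B|>) => T; apply: Rle_trans (bnorm_cmp _ _) _.
have := bnorm_cmp A T; have := vnorm_nonneg B; nra.
Qed.
Definition lr A B : Bop (opB X) := mkBop (lr_bounded A B).

Lemma lr_app A B T : lr A B T = A ∘ T ∘ B. Proof. by []. Qed.

Lemma lr_norm A B : <|lr A B|> <= <|A|> * <|B|>.
Proof.
apply: bop_lub; first by apply: Rmult_le_pos; exact: vnorm_nonneg.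
move=> T; rewrite lr_app; apply: Rle_trans (bnorm_cmp _ _) _.
have := bnorm_cmp A T; have := vnorm_nonneg B; nra.
Qed.

Lemma lr_pw A B n : pw (lr A B) n = lr (pw A n) (pw B n).
Proof.
elim: n => [|n IH]; first by apply: Bop_ext => T; rewrite lr_app cmp1l cmp1r.
by rewrite pwS IH; apply: Bop_ext => T; rewrite cmp_app !lr_app (pwSr B) pwS !cmpA.
Qed.

(** If K acted on y as the scalar a, the solution would be y (1 - ak)^-1. In general this leaves the
    error (K - a) y (1 - ak)^-1 k, which the remaining factors kill, and the induction solves for
    it. The solution depends on y through a bounded operator. *)
Lemma sylv_sol K k (L : list C) : (forall a, In a L -> exists R, inv (idB -v a *v k) R) ->
  exists B : Bop (opB X), forall y, prodK K L ∘ y = 0v -> B y -v K ∘ (B y) ∘ k = y.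
Proof.
elim: L => [|a L IH] H.
  exists 0v => y; cbn [prodK]; rewrite cmp1l => ->; rewrite bzero_app cmp0r cmp0l; vring.
case: IH => [b Hb|B HB]; first by apply: H; right.
case: (H a (or_introl eq_refl)) => R HR.
exists (lr idB R +v B ∘ lr (K -v a *v idB) (R ∘ k)) => y Hy.
set y' := (K -v a *v idB) ∘ y ∘ (R ∘ k).
have := HB y'; have -> : prodK K L ∘ y' = 0v.
  by rewrite /y' !cmpA; cbn [prodK] in Hy; rewrite Hy !cmp0l.
move=> /(_ eq_refl); set u := B y' => Hu.
have -> : (lr idB R +v B ∘ lr (K -v a *v idB) (R ∘ k)) y = y ∘ R +v u.
  by rewrite badd_app cmp_app !lr_app cmp1l.
have E1 : y ∘ R = y +v a *v (y ∘ (R ∘ k)).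
  have cR : R ∘ k = k ∘ R.
    by apply: (inv_comm HR); rewrite /comm; bext x.
  rewrite cR; have := f_equal (fun T => y ∘ T) (proj1 HR); rewrite /= cmp1r cmpDl cmp1l cmpNl cmpZl cmpDr cmpNr cmpZr => E.
  have -> : y ∘ R = (y ∘ R -v a *v (y ∘ (k ∘ R))) +v a *v (y ∘ (k ∘ R)) by vring.
  by rewrite E.
rewrite cmpDr cmpDl; have -> : K ∘ (y ∘ R) ∘ k = y' +v a *v (y ∘ (R ∘ k)).
  rewrite /y' cmpDl cmpDl cmpNl cmpNl cmpZl cmpZl cmp1l !cmpA; vring.
have -> : y ∘ R +v u -v (y' +v a *v (y ∘ (R ∘ k)) +v K ∘ u ∘ k) = (y ∘ R -v a *v (y ∘ (R ∘ k))) +v ((u -v K ∘ u ∘ k) -v y') by vring.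
by rewrite Hu E1; vring.
Qed.

Lemma sylv_inj K k (L : list C) u : (forall a, In a L -> exists R, inv (idB -v a *v k) R) ->
  prodK K L ∘ u = 0v -> u = K ∘ u ∘ k -> u = 0v.
Proof.
elim: L u => [|a L IH] u H; first by cbn [prodK]; rewrite cmp1l.
cbn [prodK]; rewrite -cmpA => Hp Hu.
have Z : (K -v a *v idB) ∘ u = 0v.
  apply: IH => //; first by move=> b Hb; apply: H; right.
  rewrite cmpDl cmpNl cmpZl cmp1l cmpDr cmpNr cmpZr cmpDl cmpNl cmpZl -Hu.
  by rewrite {1}Hu !cmpA.
have Ku : K ∘ u = a *v u.
  by apply: vsub_eq0; rewrite -Z cmpDl cmpNl cmpZl cmp1l.
case: (H a (or_introl eq_refl)) => R HR.
have E : u ∘ (idB -v a *v k) = 0v.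
  by rewrite cmpDr cmpNr cmpZr cmp1r {1}Hu Ku cmpZl vadd_opp.
by rewrite -(cmp1r u) -(proj1 HR) cmpA E cmp0l.
Qed.

(* Split by the Riesz projection P of K at a small radius: a Neumann series on the range of P,
   finitely many one-sided resolvents of k on the finite-dimensional complement. *)
Lemma sylv_inv K k : compact_op K -> (forall a, eigenvalue K a -> exists R, inv (idB -v a *v k) R) ->
  exists R : Bop (opB X), inv (idB -v lr K k) R.
Proof.
move=> HK Hk; have pk := vnorm_nonneg k.
(* The radius is chosen so that r |k| < 1, the ratio of the Neumann series on the range of [P]. *)
case: (@riesz_decomp X K (/ (<|k|> + 1)) HK); first by apply: Rinv_0_lt_compat; lra.
move=> r [M [P [l [Hr [M0 [HM [PP [HC Hl]]]]]]]].
have rk : 0 <= r * <|k|> < 1.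
  split; first by apply: Rmult_le_pos; lra.
  apply: Rle_lt_trans (_ : r * <|k|> <= r * (<|k|> + 1)) _; first nra.
  have := Rmult_lt_compat_r (<|k|> + 1) _ _ ltac:(lra) (proj2 Hr); rewrite Rinv_l; lra.
have PK : comm P K by apply: HC.
pose E x := (idB -v P) x = x.
have ES : subsp E.
  split; first by rewrite /E bop0.
  split; first by move=> x y Hx Hy; rewrite /E bopD Hx Hy.
  by move=> c x Hx; rewrite /E bopZ Hx.
have idem : (idB -v P) ∘ (idB -v P) = idB -v P.
  by rewrite cmpDl cmp1l cmpNl cmpDr cmpNr cmp1r PP; vring.
have EK x : E x -> E (K x).
  move=> Hx; rewrite /E -{2}Hx.
  have := f_equal (fun T : Bop X => T x) PK; autorewrite with bop => ->; vring.
case: (@annihilate X l E K ES _ EK).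
  by move=> x <-; exact: Hl.
move=> L [HL1 HL2].
have LP : prodK K L ∘ (idB -v P) = 0v.
  by apply: Bop_ext => x; apply: HL2; rewrite /E -cmp_app idem.
have HLk a : In a L -> exists R, inv (idB -v a *v k) R by move=> /HL1; exact: Hk.
case: (sylv_sol K HLk) => B HB.
have pwP n : pw P (S n) = P by elim: n => [|n IH]; [exact: cmp1r|rewrite pwS IH PP].
have cKP : comm K P by exact: comm_sym.
(* The extra 1 covers the power 0, which is the identity and not a multiple of [P]. *)
case: (@neumann (opB X) (lr (K ∘ P) k) (M + 1) (r * <|k|>)) => //.
  move=> n; rewrite lr_pw; apply: Rle_trans (lr_norm _ _) _.
  rewrite Rpow_mult_distr -Rmult_assoc; apply: Rmult_le_compat; try exact: vnorm_nonneg; last exact: bnorm_pw.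
  have pr : 0 < r ^ n by apply: pow_lt; lra.
  case: n pr => [|n] pr.
    by apply: Rle_trans (bnorm_id X) _; rewrite /=; lra.
  rewrite pw_cmp // pwP; apply: Rle_trans (HM (S n)) _; nra.
move=> R1 [HR1 _].
have sol1 y : P ∘ y = y -> R1 y -v K ∘ (R1 y) ∘ k = y.
  move=> Hy; set u := R1 y.
  have Hu : u -v K ∘ P ∘ u ∘ k = y.
    have := f_equal (fun T : Bop (opB X) => T y) (proj1 HR1).
    by rewrite cmp_app badd_app bopp_app !idB_app lr_app.
  have Pu : P ∘ u = u.
    have Eu : u = y +v K ∘ P ∘ u ∘ k by rewrite -Hu; vring.
    rewrite {1}Eu cmpDr Hy !cmpA PK -(cmpA K) PP -Eu //.
  by move: Hu; rewrite -(cmpA K P u) Pu.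
(* Iterating gives P u = K^n P u k^n, which tends to 0; so u lies in the finite-dimensional part,
   where [sylv_inj] applies. *)
have inj u : u = K ∘ u ∘ k -> u = 0v.
  move=> Hu; have Pu : P ∘ u = 0v.
    have it n : P ∘ u = pw K n ∘ P ∘ u ∘ pw k n.
      elim: n => [|n IH]; first by rewrite cmp1l cmp1r.
      rewrite {1}IH {1}Hu pwSr pwS -!cmpA; congr (_ ∘ _); rewrite !cmpA; congr (_ ∘ _).
      by rewrite PK.
    apply: vnorm_small => e e0.
    have pu := vnorm_nonneg u.
    case: (@pow_lt_small _ rk (e / (M * <|u|> + 1))); first by apply: Rdiv_lt_0_compat; nra.
    move=> n /(_ n (le_n _)) Hn; rewrite (it n).
    apply: Rle_trans (bnorm_cmp _ _) _.
    apply: Rle_trans (_ : (M * r ^ n * <|u|>) * <|k|> ^ n <= _).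
      apply: Rmult_le_compat; try exact: vnorm_nonneg; last exact: bnorm_pw.
      apply: Rle_trans (bnorm_cmp _ _) _; apply: Rmult_le_compat_r => //.
    have -> : M * r ^ n * <|u|> * <|k|> ^ n = (M * <|u|>) * (r * <|k|>) ^ n by rewrite Rpow_mult_distr; ring.
    have p : 0 <= (r * <|k|>) ^ n by apply: pow_le; lra.
    have : e = e / (M * <|u|> + 1) * (M * <|u|> + 1) by field; nra.
    nra.
  apply: (sylv_inj HLk) Hu.
  have -> : u = (idB -v P) ∘ u by rewrite cmpDl cmp1l cmpNl Pu; vring.
  by rewrite cmpA LP cmp0l.
pose BB := R1 ∘ lr P idB +v B ∘ lr (idB -v P) idB.
have right y : BB y -v K ∘ (BB y) ∘ k = y.
  have := sol1 (P ∘ y); rewrite cmpA PP => /(_ eq_refl) H1.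
  have := HB ((idB -v P) ∘ y); rewrite cmpA LP cmp0l => /(_ eq_refl) H2.
  have E0 : BB y = R1 (P ∘ y) +v B ((idB -v P) ∘ y).
    by rewrite /BB badd_app !cmp_app !lr_app !cmp1r.
  rewrite E0; clear E0; rewrite cmpDr (cmpDl _ _ k).
  set a1 := R1 _ in H1 *; set a2 := B _ in H2 *.
  have -> : a1 +v a2 -v (K ∘ a1 ∘ k +v K ∘ a2 ∘ k) = (a1 -v K ∘ a1 ∘ k) +v (a2 -v K ∘ a2 ∘ k) by vring.
  by rewrite H1 H2 cmpDl cmp1l cmpNl; vring.
exists BB; split; apply: Bop_ext => y.
  rewrite cmp_app badd_app bopp_app lr_app !idB_app; exact: right.
rewrite cmp_app idB_app; apply: vsub_eq0; apply: inj.
set z := (idB -v lr K k) y.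
have Ez : z = y -v K ∘ y ∘ k by [].
have := right z; rewrite {2}Ez => H.
apply: vsub_eq0; rewrite cmpDr cmpDl cmpNr cmpNl.
have -> : BB z -v y -v (K ∘ BB z ∘ k -v K ∘ y ∘ k) = (BB z -v K ∘ BB z ∘ k) -v (y -v K ∘ y ∘ k) by vring.
by rewrite H vadd_opp.
Qed.

(** * The spectrum of y -> (1 + K) y (1 + K') and its invariant subspaces *)

Definition sp K a := a = C0 \/ eigenvalue K a.

Lemma scaled_resolvent K z w : compact_op K -> z <> C0 -> (forall b, sp K b -> z <> Cmul w (Cadd C1 b)) ->
  exists R, inv (z *v idB -v w *v (idB +v K)) R.
Proof.
move=> HK z0 H; case: (classic (w = C0)) => [->|w0].
  exists (Cinv z *v idB); have -> : z *v idB -v C0 *v (idB +v K) = z *v (idB : Bop X) by vring.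
  by apply: inv_scal => //; split; rewrite cmp1l.
pose b := Cminus (Cmul z (Cinv w)) C1.
have Eb : z = Cmul w (Cadd C1 b) by rewrite /b /Cminus; field.
case: (@fredholm_eig X K b HK).
- by move=> E; apply: (H b) => //; left.
- by move=> He; apply: (H b) => //; right.
- move=> R HR; exists (Cinv (Copp w) *v R).
  have -> : z *v idB -v w *v (idB +v K) = Copp w *v (K -v b *v idB) by rewrite {1}Eb; vring.
  apply: inv_scal => // E; apply: w0; have -> : w = Copp (Copp w) by ring.
  by rewrite E; ring.
Qed.

(** A countable set that contains the spectrum of y -> (1 + K) y (1 + K'): 0 and all products of a
    value from 1 + [sp K] and one from 1 + [sp K']. It need not be the exact spectrum. *)
Definition weight K K' z := z = C0 \/ exists a b, sp K a /\ sp K' b /\ z = Cmul (Cadd C1 a) (Cadd C1 b).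

(** With h = 1 + K' and Rz = (z - h)^-1, the image of y under z - Phi is (y - K y h Rz)(z - h),
    which reduces the claim to [sylv_inv]. For an eigenvalue a of K, 1 - a h Rz is (z - (1 + a) h)
    Rz, invertible because z is no weight. *)
Lemma phi_inv K K' z : compact_op K -> compact_op K' -> ~ weight K K' z ->
  exists R : Bop (opB X), inv (z *v idB -v lr (idB +v K) (idB +v K')) R.
Proof.
move=> HK HK' Hz; set h := idB +v K'.
have z0 : z <> C0 by move=> E; apply: Hz; left.
have res a : sp K a -> exists R, inv (z *v idB -v Cadd C1 a *v h) R.
  by move=> Ha; apply: scaled_resolvent => // b Hb E; apply: Hz; right; exists a, b.
case: (res C0); first by left.
have -> : Cadd C1 C0 = C1 by ring. rewrite vscal_1 => Rz HRz.
have cRz : comm Rz h.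
  by apply: (inv_comm HRz); rewrite /comm; bext x.
case: (@sylv_inv K (h ∘ Rz) HK).
  move=> a Ha; case: (res a); first by right. move=> R HR.
  have -> : idB -v a *v (h ∘ Rz) = (z *v idB -v Cadd C1 a *v h) ∘ Rz.
    by rewrite -{1}(proj1 HRz); bext x.
  by eexists; apply: inv_cmp; [exact: HR|exact: (inv_sym HRz)].
move=> R HR; exists (R ∘ lr idB Rz).
have -> : z *v idB -v lr (idB +v K) h = lr idB (z *v idB -v h) ∘ (idB -v lr K (h ∘ Rz)).
  apply: Bop_ext => T; rewrite cmp_app !badd_app !bopp_app !lr_app bscal_app !idB_app !cmp1l.
  set A := z *v idB -v h in HRz *.
  have -> : (T -v K ∘ T ∘ (h ∘ Rz)) ∘ A = T ∘ A -v K ∘ T ∘ h.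
    by rewrite cmpDl cmpNl -!cmpA (proj2 HRz) cmp1r.
  by rewrite /A /h !cmpDr cmpNr cmpZr cmp1r !cmpDl cmp1l ?cmp1r ?cmpDr ?cmp1r; vring.
refine (inv_cmp _ HR). split; apply: Bop_ext => T; rewrite cmp_app !lr_app !cmp1l -cmpA.
  by rewrite (proj2 HRz) cmp1r.
by rewrite (proj1 HRz) cmp1r.
Qed.
End LR.

(** Far out on the half-line the resolvent is a Neumann series in [D] and keeps [W]. By
    [inv_perturb] the parameters with this property form an open and closed set, so the property
    travels back to s = 0. *)
Lemma ray_invariant (Z : CBanach) (D : Bop Z) (W : Z -> Prop) z0 w : closed_subspace W ->
  (forall x, W x -> W (D x)) -> w <> C0 ->
  (forall s, 0 <= s -> exists R, inv (Cadd z0 (Cmul (RtoC s) w) *v idB -v D) R) ->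
  forall R, inv (z0 *v idB -v D) R -> forall x, W x -> W (R x).
Proof.
move=> HW HD w0 Hinv; have pw0 := Cabs_pos w0.
pose zz s := Cadd z0 (Cmul (RtoC s) w).
have [W0 [Wa Ws]] := closed_subsp HW.
pose Good s := forall R, inv (zz s *v idB -v D) R -> forall x, W x -> W (R x).
have zdiff s s' : zz s' *v (idB : Bop Z) -v D -v (zz s *v idB -v D) = Cmul (RtoC (s' - s)) w *v idB.
  have -> : RtoC (s' - s) = Cminus (RtoC s') (RtoC s) by apply: C_ext; cbn; ring.
  by rewrite /zz /Cminus; vring.
have stepG s s' R M : inv (zz s *v idB -v D) R -> <|R|> <= M -> Rabs (s' - s) * Cabs w * M <= / 2 -> Good s -> Good s'.
  move=> HR HM Hs HG R' HR'.
  have M0 : 0 <= M by apply: Rle_trans HM; exact: vnorm_nonneg.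
  case: (@inv_perturb _ _ (zz s' *v idB -v D) _ M HR HM).
    rewrite zdiff vnorm_scal Cabs_mul Cabs_RtoC; have := bnorm_id Z => Hid.
    have P : 0 <= Rabs (s' - s) * Cabs w by apply: Rmult_le_pos; [exact: Rabs_pos|lra].
    have Q := vnorm_nonneg (idB : Bop Z).
    apply: Rle_trans Hs; apply: Rmult_le_compat_r => //; nra.
  move=> R'' [HR'' [_ HV]]; rewrite (inv_uniq HR' HR''); apply: HV => //; first exact: HG.
  by move=> x Wx; rewrite zdiff; autorewrite with bop; exact: Ws.
have big s : 2 * (<|D|> + 1) + Cabs z0 <= s * Cabs w -> 0 <= s -> Good s.
  move=> Hs s0 R HR.
  have PD := vnorm_nonneg D.
  have Hz : 2 * (<|D|> + 1) <= Cabs (zz s).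
    have := Cabs_triangle (zz s) (Copp z0); rewrite Cabs_opp.
    have -> : Cadd (zz s) (Copp z0) = Cmul (RtoC s) w by rewrite /zz; ring.
    rewrite Cabs_mul Cabs_RtoC Rabs_right; lra.
  have zn0 : zz s <> C0 by move=> E; move: Hz; rewrite E Cabs_C0; lra.
  case: (@neumann_half Z (Cinv (zz s) *v D)).
    rewrite vnorm_scal Cabs_inv //; apply: (Rmult_le_reg_l (Cabs (zz s))); first lra.
    rewrite -Rmult_assoc Rinv_r; lra.
  move=> Q [HQ [_ HV]].
  have E : zz s *v idB -v D = zz s *v (idB -v Cinv (zz s) *v D).
    rewrite vscal_distr_v; congr (_ +v _).
    have -> : zz s *v -v (Cinv (zz s) *v D) = -v (Cmul (zz s) (Cinv (zz s)) *v D) by vring.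
    by rewrite Cinv_r // vscal_1.
  have HQ2 : inv (zz s *v idB -v D) (Cinv (zz s) *v Q) by rewrite E; exact: inv_scal.
  rewrite (inv_uniq HR HQ2) => x Wx; rewrite bscal_app; apply: (Ws); apply: HV => // y Wy.
  by rewrite bscal_app; apply: Ws; exact: HD.
suff G0 : Good 0.
  move=> R HR; apply: G0; have -> : zz 0 = z0 by rewrite /zz; apply: C_ext; cbn; ring.
  exact: HR.
apply: NNPP => nG0.
pose E s := 0 <= s /\ ~ Good s.
have Ebd : bound E.
  exists ((2 * (<|D|> + 1) + Cabs z0) / Cabs w) => s [s0 Hs]; apply: Rnot_lt_le => Hlt; apply: Hs; apply: big => //.
  apply: Rlt_le; have := Rmult_lt_compat_r _ _ _ pw0 Hlt.
  by rewrite /Rdiv Rmult_assoc Rinv_l ?Rmult_1_r //; lra.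
have [ss [ub lu]] := completeness E Ebd (ex_intro _ 0 (conj (Rle_refl 0) nG0)).
have ss0 : 0 <= ss by apply: ub; split; [lra|].
have Gab s : ss < s -> Good s.
  by move=> Hs; apply: NNPP => K; have := ub s (conj (ltac:(lra) : 0 <= s) K); lra.
have [R HR] : exists R, inv (zz ss *v idB -v D) R := Hinv ss ss0.
pose M := <|R|> + 1; have M1 : 1 <= M by have := vnorm_nonneg R; rewrite /M; lra.
pose d := / (4 * M * Cabs w).
have d0 : 0 < d by apply: Rinv_0_lt_compat; nra.
have dE : d * Cabs w * M = / 4 by rewrite /d; field; lra.
have HRM : <|R|> <= M by rewrite /M; lra.
have Gss : Good ss.
  case: (@inv_perturb _ _ (zz (ss + d) *v idB -v D) _ M HR HRM).
    rewrite zdiff vnorm_scal Cabs_mul Cabs_RtoC; have := bnorm_id Z => Hid.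
    have -> : ss + d - ss = d by ring. rewrite Rabs_right; last lra.
    have Q := vnorm_nonneg (idB : Bop Z).
    have : d * Cabs w * <|(idB : Bop Z)|> * M <= d * Cabs w * M; last lra.
    apply: Rmult_le_compat_r; first lra. 
    have : 0 <= d * Cabs w by nra. nra.
  move=> R' [HR' [HR'M _]].
  apply: (stepG (ss + d) ss R' (2 * M) HR' HR'M) (Gab _ _); last lra.
  have -> : ss - (ss + d) = - d by ring. rewrite Rabs_Ropp Rabs_right; lra.
have : is_upper_bound E (ss - d).
  move=> s [s0 Hs]; apply: Rnot_lt_le => Hlt; apply: Hs.
  case: (Rle_lt_dec s ss) => Hss; last exact: Gab.
  apply: (stepG ss s R M HR HRM) Gss.
  have : Rabs (s - ss) <= d by apply: Rabs_le; lra.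
  move=> Hab; apply: Rle_trans (_ : d * Cabs w * M <= _); last lra.
  apply: Rmult_le_compat_r; first lra. apply: Rmult_le_compat_r; lra.
move=> /lu; lra.
Qed.

(** For each n finitely many eigenvalues have modulus at least 1/(n+1); the pairing function merges
    these lists. The default [C0] of [nth], reached by an index past the end, supplies the value
    0. *)
Lemma sp_enum (X : CBanach) (K : Bop X) : compact_op K -> exists f : nat -> C, forall a, sp K a -> exists n, f n = a.
Proof.
move=> HK.
have [L HL] : exists L : nat -> list C, forall n a, / INR (S n) <= Cabs a -> eigenvalue K a -> In a (L n).
  apply: (@fchoice nat (list C) (fun n L => forall a, / INR (S n) <= Cabs a -> eigenvalue K a -> In a L)) => n.
  by apply: eig_finite => //; apply: Rinv_0_lt_compat; exact: lt_0_INR (Nat.lt_0_succ n).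
exists (fun p => let: (n, i) := Cantor.of_nat p in nth i (L n) C0) => a Ha.
case: (classic (a = C0)) => [->|a0].
  by exists (Cantor.to_nat (0%nat, length (L 0%nat))); rewrite Cantor.cancel_of_to nth_overflow.
case: Ha => // Ha.
have [[|n] [Hn n0]] := archimed_cor1 _ (Cabs_pos a0); first by lia.
have Hin : In a (L n) by apply: HL => //; exact: Rlt_le.
case: (In_nth _ _ C0 Hin) => i [_ Hi].
by exists (Cantor.to_nat (n, i)); rewrite Cantor.cancel_of_to.
Qed.

Lemma weight_enum (X : CBanach) (K K' : Bop X) : compact_op K -> compact_op K' ->
  exists g : nat -> C, forall z, weight K K' z -> exists n, g n = z.
Proof.
move=> /sp_enum [f Hf] /sp_enum [f' Hf'].
exists (fun p => match p with O => C0 | S p => let: (i, j) := Cantor.of_nat p in Cmul (Cadd C1 (f i)) (Cadd C1 (f' j)) end).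
move=> z [->|[a [b [/Hf [i Hi] [/Hf' [j Hj] ->]]]]]; first by exists 0%nat.
by exists (S (Cantor.to_nat (i, j))); rewrite Cantor.cancel_of_to Hi Hj.
Qed.

(* The half-line from z in a generic direction misses the countably many weights. *)
Lemma phi_resolvent_invariant (X : CBanach) (K K' : Bop X) (W : opB X -> Prop) z :
  compact_op K -> compact_op K' -> closed_subspace W -> (forall y, W y -> W (lr (idB +v K) (idB +v K') y)) ->
  ~ weight K K' z ->
  forall R, inv (z *v idB -v lr (idB +v K) (idB +v K')) R -> forall y, W y -> W (R y).
Proof.
move=> HK HK' HW HD Hz; have [g Hg] := weight_enum HK HK'.
(* A weight on the half-line at s <> 0 would be seen from z under the slope t, and t avoids the
   slopes of all weights. *)
case: (@avoid_seq (fun n => Cim (Cminus (g n) z) / Cre (Cminus (g n) z)) 0 1); first lra.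
move=> t [_ Ht]; pose w := mkC 1 t.
apply: (@ray_invariant _ _ _ z w) => //.
  by move=> /(f_equal Cre) /=; lra.
move=> s s0; apply: phi_inv => // Hw.
case: (Hg _ Hw) => n Hn.
case: (Req_dec s 0) => Hs.
  by apply: Hz; move: Hw; rewrite Hs; have -> : Cadd z (Cmul (RtoC 0) w) = z by apply: C_ext; cbn; ring.
apply: (Ht n); rewrite Hn; cbn; field; lra.
Qed.

Definition finrank (X : CBanach) (T : Bop X) := exists l, forall x, span l (T x).

Lemma span_app (X : CBanach) (l1 l2 : list X) x y : span l1 x -> span l2 y -> span (l1 ++ l2) (x +v y).
Proof.
move=> H1 H2; case: (span_subsp (l1 ++ l2)) => _ [Ha _]; apply: Ha.
  apply: (span_min (span_subsp _) _ H1) => v Hv; apply: span_In; apply: in_or_app; by left.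
apply: (span_min (span_subsp _) _ H2) => v Hv; apply: span_In; apply: in_or_app; by right.
Qed.

Lemma span_map (X : CBanach) (l : list X) (T : Bop X) x : span l x -> span (map T l) (T x).
Proof.
elim: l x => [|v l IH] x /=; first by move=> ->; exact: bop0.
by move=> [c [y [/IH H ->]]]; exists c, (T y); split=> //; rewrite bopD bopZ.
Qed.

(** When P z P' = 0, z is (1 - P) z + P z (1 - P'), and both summands have finite rank. *)
Lemma finrank_corner (X : CBanach) (P P' z : Bop X) l l' : (forall x, span l (x -v P x)) ->
  (forall x, span l' (x -v P' x)) -> P ∘ z ∘ P' = 0v -> finrank z.
Proof.
move=> Hl Hl' H; exists (l ++ map (P ∘ z) l') => x.
have -> : z x = (z x -v P (z x)) +v (P ∘ z) (x -v P' x).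
  have := f_equal (fun T : Bop X => T x) H; rewrite !cmp_app !bopD !bopN bzero_app => ->; vring.
by apply: span_app => //; apply: span_map.
Qed.

Section Compress.
Variables (X : CBanach) (K K' P P' : Bop X) (r M r' M' : R).
Hypotheses (Hr : 0 < r) (Hr' : 0 < r').
Hypotheses (HP : forall n, <|pw K n ∘ P|> <= M * r ^ n) (HP' : forall n, <|P' ∘ pw K' n|> <= M' * r' ^ n).
Hypotheses (cP : comm P K) (cP' : comm P' K').
Let S0 : Bop (opB X) := lr (idB +v K) (idB +v K') -v idB.

(** Phi - 1 sends y to K y + y K' + K y K'. Each [K] that reaches [P] contributes r and each [K']
    that reaches [P'] contributes r', so one application costs r + r' + r r'. The exponents i and j
    record the factors already collected. *)
Lemma compress_power n i j (y : Bop X) :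
  <|pw K i ∘ P ∘ (pw S0 n y : Bop X) ∘ (P' ∘ pw K' j)|> <= M * M' * (r + r' + r * r') ^ n * r ^ i * r' ^ j * <|y|>.
Proof.
have p1 k : 0 < r ^ k by apply: pow_lt.
have p2 k : 0 < r' ^ k by apply: pow_lt.
elim: n i j => [|n IH] i j.
  rewrite idB_app; apply: Rle_trans (bnorm_cmp _ _) _.
  apply: Rle_trans (_ : (M * r ^ i * <|y|>) * (M' * r' ^ j) <= _); last by rewrite /=; right; ring.
  apply: Rmult_le_compat; try exact: vnorm_nonneg; last exact: HP'.
  apply: Rle_trans (bnorm_cmp _ _) _; apply: Rmult_le_compat_r; [exact: vnorm_nonneg|exact: HP].
rewrite pw_app; set u : Bop X := pw S0 n y in IH *.
have E : S0 u = (K ∘ u +v u ∘ K') +v K ∘ u ∘ K'.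
  by rewrite /S0 badd_app bopp_app idB_app lr_app !(cmpDl, cmpDr, cmp1l, cmp1r); vring.
have KP k : pw K k ∘ P ∘ K = pw K (S k) ∘ P by rewrite -cmpA cP cmpA pwSr.
have KP' k : K' ∘ (P' ∘ pw K' k) = P' ∘ pw K' (S k) by rewrite pwS !cmpA cP'.
have -> : pw K i ∘ P ∘ (S0 u : Bop X) ∘ (P' ∘ pw K' j) =
   (pw K (S i) ∘ P ∘ u ∘ (P' ∘ pw K' j) +v pw K i ∘ P ∘ u ∘ (P' ∘ pw K' (S j)))
   +v pw K (S i) ∘ P ∘ u ∘ (P' ∘ pw K' (S j)).
  by rewrite E !cmpDr !cmpDl -!KP -!KP' !cmpA.
apply: Rle_trans (vnorm_triangle _ _) _; apply: Rle_trans (Rplus_le_compat_r _ _ _ (vnorm_triangle _ _)) _.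
have := IH (S i) j; have := IH i (S j); have := IH (S i) (S j); cbn [pow] => *; lra.
Qed.
End Compress.

Lemma inv_unscal (X : CBanach) c (A R : Bop X) : inv (c *v A) R -> inv A (c *v R).
Proof. by move=> [H1 H2]; split; [move: H1|move: H2]; rewrite !cmpZl !cmpZr. Qed.

(* Let E be the projection along the spectrum of Phi outside a small disc at 1.  Compressed between the
   Riesz projections of K and K' at 0, Phi - 1 is small, so x - E x has finite rank; it lies in W, so it is 0. *)
Lemma phi_generalized_kernel (X : CBanach) (K K' : Bop X) (W : opB X -> Prop) :
  compact_op K -> compact_op K' -> closed_subspace W -> (forall y, W y -> W (lr (idB +v K) (idB +v K') y)) ->
  (forall y, W y -> finrank y -> y = 0v) ->
  forall y, W y -> NN (lr (idB +v K) (idB +v K') -v idB) y.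
Proof.
move=> HK HK' HW HD HF y Wy t t0; have [W0 [Wa Ws]] := closed_subsp HW.
set Phi := lr _ _ in HD *; set S0 : Bop (opB X) := Phi -v idB.
have [g Hg] := weight_enum HK HK'.
(* A circle around 1 of radius [tau] below t that meets no weight; tau < 1 serves to absorb the
   product r r' below. *)
case: (@avoid_seq (fun n => Cabs (Cminus (g n) C1)) 0 (Rmin t 1)); first by apply: Rmin_glb_lt; lra.
move=> tau [[tau0 Htau] Hav].
have tau1 : tau < 1 by have := Rmin_r t 1; lra.
have taut : tau < t by have := Rmin_l t 1; lra.
have tauc : RtoC tau <> C0 by apply: RtoC_neq0; lra.
have tauc' : RtoC (/ tau) <> C0 by apply: RtoC_neq0; have := Rinv_0_lt_compat _ tau0; lra.
pose zz b := Cadd C1 (Cmul (RtoC tau) (Cinv b)).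
have Hzz b : Cabs b = 1 -> ~ weight K K' (zz b).
  move=> Hb Hw; case: (Hg _ Hw) => n Hn; apply: (Hav n); rewrite Hn.
  have -> : Cminus (zz b) C1 = Cmul (RtoC tau) (Cinv b) by rewrite /zz /Cminus; ring.
  by rewrite Cabs_mul Cabs_inv ?Hb ?Cabs_RtoC ?Rabs_right; [field|lra|exact: unit_neq0].
set T : Bop (opB X) := RtoC (/ tau) *v S0.
have TE b : Cabs b = 1 -> zz b *v idB -v Phi = Cmul (RtoC tau) (Cinv b) *v (idB -v b *v T).
  move=> Hb; have b0 := unit_neq0 Hb.
  have E : Cmul (Cmul (RtoC tau) (Cinv b)) (Cmul b (RtoC (/ tau))) = C1.
    rewrite (_ : Cmul _ _ = Cmul (Cmul b (Cinv b)) (Cmul (RtoC tau) (RtoC (/ tau)))); last by ring.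
    by rewrite Cinv_r //; apply: C_ext; cbn; field; lra.
  rewrite /T vscal_distr_v; have -> : Cmul (RtoC tau) (Cinv b) *v -v (b *v (RtoC (/ tau) *v S0)) = -v S0.
    have -> : Cmul (RtoC tau) (Cinv b) *v -v (b *v (RtoC (/ tau) *v S0)) =
      -v (Cmul (Cmul (RtoC tau) (Cinv b)) (Cmul b (RtoC (/ tau))) *v S0) by vring.
    by rewrite E vscal_1.
  by rewrite /S0 /zz; vring.
have cb0 b : Cabs b = 1 -> Cmul (RtoC tau) (Cinv b) <> C0.
  move=> Hb E; have : Cabs (Cmul (RtoC tau) (Cinv b)) = 0 by rewrite E Cabs_C0.
  rewrite Cabs_mul Cabs_inv; last exact: unit_neq0. rewrite Hb Cabs_RtoC Rabs_right; lra.
case: (@circ_bound _ T).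
{ move=> b Hb; case: (phi_inv HK HK' (Hzz b Hb)) => R HR.
  by exists (Cmul (RtoC tau) (Cinv b) *v R); apply: inv_unscal; rewrite -TE. }
move=> M M0 HM; case: (circle_proj HM) => E [A [HA [_ [_ [_ [HE [_ [HY [HV _]]]]]]]]].
have WE : W (E y).
  apply: HV => // b Q Hb HQ x Wx.
  have -> : Q x = Cmul (RtoC tau) (Cinv b) *v (Cinv (Cmul (RtoC tau) (Cinv b)) *v Q : Bop (opB X)) x.
    by rewrite bscal_app vscal_assoc Cinv_r ?vscal_1 //; exact: cb0.
  apply: Ws; apply: (phi_resolvent_invariant HK HK' HW HD (Hzz b Hb)) => //.
  by rewrite -/Phi TE //; apply: inv_scal => //; exact: cb0.
have Ey : E y = y.
  set z : Bop X := y -v E y.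
  (* With r, r' < tau/6 and tau < 1 one has r + r' + r r' <= tau/2, so the n-th power of (Phi -
     1)/tau, compressed between P and P', decays like (1/2)^n. *)
  case: (@riesz_decomp X K (tau / 6) HK); first lra.
  move=> r [N [P [l [Hr [N0 [HN [PP [HC Hl]]]]]]]].
  case: (@riesz_decomp X K' (tau / 6) HK'); first lra.
  move=> r' [N' [P' [l' [Hr' [N0' [HN' [PP' [HC' Hl']]]]]]]].
  have PzP : P ∘ z ∘ P' = 0v.
    apply: vnorm_small => e e0.
    have qP := vnorm_nonneg P; have qP' := vnorm_nonneg P'; have qy := vnorm_nonneg y.
    have q1 : 0 <= <|P|> * <|P'|> * <|y|> by repeat apply: Rmult_le_pos.
    have q2 : 0 <= N * N' * (M * <|y|>) by repeat apply: Rmult_le_pos => //; lra.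
    case: (@pow_lt_small (/ 2) ltac:(lra) (e / (2 * (N * N' * (M * <|y|>) + 1)))); first by apply: Rdiv_lt_0_compat; lra.
    move=> n Hn; have {Hn} := Hn (S n) ltac:(lia) => Hn.
    (* 1 - E is approximated by T^(n+1) Y with Y bounded by M: the error contributes at most e/2
       after compression, and so does the compressed power. *)
    case: (HY n (e / (2 * (<|P|> * <|P'|> * <|y|> + 1)))); first by apply: Rdiv_lt_0_compat; lra.
    move=> Y [HYM [HYe _]].
    set Q : Bop (opB X) := idB -v E -v pw T (S n) ∘ Y in HYe.
    have -> : P ∘ z ∘ P' = P ∘ (Q y : Bop X) ∘ P' +v P ∘ (pw T (S n) (Y y) : Bop X) ∘ P'.
      rewrite -cmpDl -cmpDr; congr (P ∘ _ ∘ P').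
      by rewrite /z /Q !badd_app !bopp_app idB_app cmp_app; vring.
    have B1 : <|P ∘ (Q y : Bop X) ∘ P'|> <= e / 2.
      apply: Rle_trans (bnorm_cmp _ _) _.
      apply: Rle_trans (_ : <|P|> * (e / (2 * (<|P|> * <|P'|> * <|y|> + 1)) * <|y|>) * <|P'|> <= _).
        apply: Rmult_le_compat_r => //; apply: Rle_trans (bnorm_cmp _ _) _; apply: Rmult_le_compat_l => //.
        by apply: Rle_trans (bop_le _ _) _; apply: Rmult_le_compat_r.
      set c := <|P|> * <|P'|> * <|y|> in q1 *.
      have -> : <|P|> * (e / (2 * (c + 1)) * <|y|>) * <|P'|> = e / 2 * (c / (c + 1)) by rewrite {2}/c; field; lra.
      have : c / (c + 1) <= 1 by apply: (Rmult_le_reg_r (c + 1)); [lra|rewrite /Rdiv Rmult_assoc Rinv_l; lra].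
      nra.
    have B2 : <|P ∘ (pw T (S n) (Y y) : Bop X) ∘ P'|> <= e / 2.
      case: (pwZ (RtoC (/ tau)) S0 (S n)) => b [Eb Hb].
      rewrite /T Eb bscal_app cmpZr cmpZl vnorm_scal Hb Cabs_RtoC Rabs_right; last by left; exact: Rinv_0_lt_compat.
      have HP'2 k : <|P' ∘ pw K' k|> <= N' * r' ^ k.
        by rewrite (comm_pw k (HC' K' eq_refl)).
      set m := S n in Hn *.
      have := compress_power (proj1 Hr) (proj1 Hr') HN HP'2 (HC K eq_refl) (HC' K' eq_refl) m 0 0 (Y y).
      rewrite -/Phi -/S0 !pow_O /pw -!/(pw _ _) !cmp1l cmp1r !Rmult_1_r; set nn := <|_|> => H.
      have p1 : 0 < (/ tau) ^ m by apply: pow_lt; exact: Rinv_0_lt_compat.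
      have p2 : 0 < tau ^ m by apply: pow_lt.
      have p3 : 0 < (/ 2) ^ m by apply: pow_lt; lra.
      have rho : (r + r' + r * r') ^ m <= tau ^ m * (/ 2) ^ m.
        by rewrite -Rpow_mult_distr; apply: pow_incr; nra.
      have rho0 : 0 <= (r + r' + r * r') ^ m by apply: pow_le; nra.
      have Yy : <|Y y|> <= M * <|y|> by apply: Rle_trans (bop_le _ _) _; apply: Rmult_le_compat_r.
      have qYy := vnorm_nonneg (Y y).
      have NN0 : 0 <= N * N' by apply: Rmult_le_pos.
      have H2 : nn <= N * N' * (tau ^ m * (/ 2) ^ m) * (M * <|y|>).
        apply: Rle_trans H _; apply: Rmult_le_compat => //; first by apply: Rmult_le_pos.
        exact: Rmult_le_compat_l.
      apply: Rle_trans (Rmult_le_compat_l _ _ _ (Rlt_le _ _ p1) H2) _.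
      have tt : (/ tau) ^ m * tau ^ m = 1 by rewrite -Rpow_mult_distr Rinv_l ?pow1 //; lra.
      set c := N * N' * (M * <|y|>) in q2 Hn *.
      have -> : (/ tau) ^ m * (N * N' * (tau ^ m * (/ 2) ^ m) * (M * <|y|>)) = ((/ tau) ^ m * tau ^ m) * ((/ 2) ^ m * c) by rewrite /c; ring.
      rewrite tt; have : (/ 2) ^ m * c <= e / (2 * (c + 1)) * (c + 1) by nra.
      have -> : e / (2 * (c + 1)) * (c + 1) = e / 2 by field; lra. lra.
    apply: Rle_trans (vnorm_triangle _ _) _; lra.
  symmetry; apply: vsub_eq0; apply: HF; first by apply: Wa => //; apply: subsp_opp (closed_subsp HW) _.
  exact: (finrank_corner Hl Hl' PzP).
exists (M * <|y|>); split; first by apply: Rmult_le_pos; [lra|exact: vnorm_nonneg].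
move=> n; have q := vnorm_nonneg y; have p : 0 < tau ^ n by apply: pow_lt.
have H : <|pw T n y|> <= M * <|y|>.
  by rewrite -{1}Ey -cmp_app; apply: Rle_trans (bop_le _ _) _; exact: Rmult_le_compat_r.
move: H; case: (pwZ (RtoC (/ tau)) S0 n) => b [Eb Hb].
rewrite /T Eb bscal_app vnorm_scal Hb Cabs_RtoC Rabs_right; last by left; exact: Rinv_0_lt_compat.
rewrite pow_inv => H2.
apply: Rle_trans (_ : M * <|y|> * tau ^ n <= _).
  apply: (Rmult_le_reg_l (/ tau ^ n)); first exact: Rinv_0_lt_compat.
  apply: Rle_trans H2 _.
  by right; field; lra.
apply: Rmult_le_compat_l; first by apply: Rmult_le_pos; lra.
apply: pow_incr; lra.
Qed.

(** * Jacobson's theorem on weakly closed sets of nilpotent operators *)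

Lemma zorn_sets (T : Type) (P : (T -> Prop) -> Prop) :
  (forall F : (T -> Prop) -> Prop, (forall A, F A -> P A) ->
     (forall A B, F A -> F B -> (forall x, A x -> B x) \/ (forall x, B x -> A x)) ->
     P (fun x => exists2 A, F A & A x)) ->
  exists A, P A /\ forall B, P B -> (forall x, A x -> B x) -> forall x, B x -> A x.
Proof.
move=> H; case: (@classical_sets.Zorn_bigcup T P) => [F HF Ht|A [PA HA]].
  apply: H => [A FA|A B FA FB]; first exact: HF.
  exact: Ht.
exists A; split=> // B PB AB x Bx; apply: NNPP => nAx.
by apply: (HA B) => //; split=> // BA; apply: nAx; exact: BA.
Qed.

Section Jacobson.
Variables (X : CBanach).
Implicit Types (A B T S a b h x : Bop X) (H J : Bop X -> Prop) (E : X -> Prop) (w : list (Bop X)).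

Definition jp a b : Bop X := a ∘ b +v b ∘ a.
Definition wd w : Bop X := fold_right (@cmp X) idB w.
Definition vanish E T := forall y, E y -> T y = 0v.
Definition stable E T := forall y, E y -> E (T y).
Definition nilp E H n := forall w, Forall H w -> (n <= length w)%nat -> vanish E (wd w).

Lemma wd_cat (u v : list (Bop X)) : wd (u ++ v) = wd u ∘ wd v.
Proof. by elim: u => [|a u IH]; [rewrite cmp1l|rewrite /= IH cmpA]. Qed.

Lemma wdS a w : wd (a :: w) = a ∘ wd w. Proof. by []. Qed.
Lemma wd1 a : wd [a] = a. Proof. exact: cmp1r. Qed.

Lemma wd_stable E w : Forall (stable E) w -> stable E (wd w).
Proof. by elim=> [|a v Ha _ IH] y Ey //=; apply: Ha; apply: IH. Qed.

Lemma pw_stable E a n : stable E a -> stable E (pw a n).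
Proof. by move=> Ha; elim: n => [|n IH] y Ey //; rewrite pw_app; apply: Ha; apply: IH. Qed.

(* The dimension of the spans of the iterated ranges H^k E strictly decreases until it reaches 0. *)
Lemma nilp_dim E (l : list X) H n : subsp E -> (forall y, E y -> span l y) -> (forall a, H a -> stable E a) ->
  nilp E H n -> nilp E H (length l).
Proof.
have [d Hd] : exists d, (length l <= d)%nat by exists (length l).
elim: d l E Hd => [|d IH] l E Hd HE Hl HS HN w Hw Lw y Ey.
  by case: l Hd Hl Lw => [|z l] /= Hd Hl Lw; [rewrite (Hl y Ey) bop0|lia].
pose E' z := exists F : list X, (forall v, In v F -> exists a u, H a /\ E u /\ v = a u) /\ span F z.
have HE' : subsp E'.
  split; first by exists []; split.
  split.
    move=> z1 z2 [F1 [A1 B1]] [F2 [A2 B2]]; exists (F1 ++ F2); split; last exact: span_app.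
    by move=> v /in_app_iff [/A1|/A2].
  move=> c z [F [A1 B1]]; exists F; split=> //; exact: (proj2 (proj2 (span_subsp F))).
have E'E z : E' z -> E z.
  by move=> [F [A1 B1]]; apply: (span_min HE _ B1) => v /A1 [a [u [Ha [Eu ->]]]]; apply: HS.
have E'i a z : H a -> E z -> E' (a z).
  move=> Ha Ez; exists [a z]; split; last by apply: span_In; left.
  by move=> v [<-|//]; exists a, z.
case: (subspan HE' (fun z Ez => Hl z (E'E z Ez))) => [Hall|[l' [L1 [L2 _]]]].
  have EE z : E z -> E' z by move=> /Hl /Hall.
  (* If the range of H spans all of [E], then [E] is spanned by values of words of any length k;
     with k = n these are all 0. *)
  have Z k : forall z, E z -> exists F : list X, (forall v, In v F -> exists u t, Forall H u /\ length u = k /\ E t /\ v = wd u t) /\ span F z.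
    elim: k => [|k IHk] z Ez.
      exists [z]; split; last by apply: span_In; left.
      by move=> v [<-|//]; exists [], z.
    case: (EE z Ez) => F [A1 B1].
    have : forall G : list X, (forall v, In v G -> In v F) -> forall z, span G z -> 
       exists F : list X, (forall v, In v F -> exists u t, Forall H u /\ length u = S k /\ E t /\ v = wd u t) /\ span F z.
      elim=> [|v G IHG] HG z' /=; first by move=> ->; exists []; split.
      move=> [c [z'' [Sz ->]]].
      case: (IHG (fun v Hv => HG v (or_intror Hv)) _ Sz) => F1 [A2 B2].
      case: (A1 v (HG v (or_introl eq_refl))) => a [t [Ha [Et ->]]].
      case: (IHk t Et) => F2 [A3 B3].
      exists (map (fun s => a s) F2 ++ F1); split.
        move=> s /in_app_iff [/in_map_iff [s' [<- /A3 [u [t' [Hu [Lu [Et' ->]]]]]]]|/A2] //.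
        by exists (a :: u), t'; split; [constructor|split; [rewrite /= Lu|]].
      apply: span_app B2; apply: (proj2 (proj2 (span_subsp _))); exact: span_map.
    by move=> K; apply: (K F (fun v Hv => Hv) z).
  have E0 z : E z -> z = 0v.
    move=> Ez; case: (Z n z Ez) => F [A1 B1].
    have : span (@nil X) z; last by [].
    apply: (span_min (span_subsp _) _ B1) => v /A1 [u [t [Hu [Lu [Et ->]]]]] /=.
    by apply: HN => //; rewrite Lu.
  by rewrite (E0 y Ey) bop0.
have HN' : nilp E' H (length l').
  apply: (IH l' E' _ HE' L2); first by lia.
    by move=> a Ha z /E'E Ez; exact: E'i.
  by move=> u Hu Lu z /E'E; apply: HN.
case: (classic (w = [])) => [w0|w0].
  by move: Lw (Hl y Ey); rewrite w0; case: (l) => [|z l0] /=; [move=> _ ->|lia].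
case: (exists_last w0) => w' [a Ea]; subst w; move: Hw; rewrite Forall_app => -[Hw' Ha].
rewrite wd_cat cmp_app; apply: HN' => //; first by rewrite length_app /= in Lw; lia.
by rewrite wd1; apply: E'i => //; exact: (Forall_inv Ha).
Qed.

Variables (E : X -> Prop) (l : list X) (J : Bop X -> Prop).
Hypotheses (HE : subsp E) (Hl : forall y, E y -> span l y).
Hypotheses (JS : forall a, J a -> stable E a) (JJ : forall a b, J a -> J b -> J (jp a b)).
Hypothesis (Jn : forall a, J a -> exists n, vanish E (pw a n)).
Let d := length l.

(** By [nilp_dim] the fixed length d serves for every nilpotent subset. This makes nilpotency a
    condition on finite words, each of which lies in one member of a chain, so Zorn's lemma
    applies. *)
Lemma nilp_maximal : exists H, (forall a, H a -> J a) /\ nilp E H d /\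
  forall x N, J x -> nilp E (fun a => H a \/ a = x) N -> H x.
Proof.
case: (@zorn_sets (Bop X) (fun H => (forall a, H a -> J a) /\ nilp E H d)).
  move=> F HF Ht; split; first by move=> a [A FA Aa]; exact: (proj1 (HF A FA)).
  move=> w Hw Lw.
  case: w Hw Lw => [|a w] Hw Lw.
    move=> y Ey; have : span l y by exact: Hl. by move: Lw; rewrite /d; case: l => [|z l'] /=; [move=> _ ->|lia].
  have [A FA HA] : exists2 A, F A & Forall A (a :: w).
    elim: w a Hw {Lw} => [|b w IH] a Hw.
      by case: (Forall_inv Hw) => A FA Aa; exists A => //; constructor.
    case: (IH b (Forall_inv_tail Hw)) => A FA HA; case: (Forall_inv Hw) => B FB Bb.
    case: (Ht A B FA FB) => K; [exists B|exists A] => //.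
      by constructor=> //; apply: Forall_impl HA.
    by constructor=> //; exact: K.
  exact: (proj2 (HF A FA)).
move=> H [[HJ HN] Hm]; exists H; split=> //; split=> // x N Jx Hx.
apply: (Hm (fun a => H a \/ a = x)); [|by left|by right].
have HJ' a : H a \/ a = x -> J a by case=> [/HJ|->].
split=> //; apply: nilp_dim Hx => // a /HJ'; exact: JS.
Qed.

Section Step.
Variables (H : Bop X -> Prop) (x : Bop X) (n : nat).
Hypotheses (HJ : forall a, H a -> J a) (HN : nilp E H d) (Jx : J x) (Hx : forall h, H h -> H (jp h x)).
Hypothesis (xn : vanish E (pw x n)).

(** [p] counts the letters of [H] already absorbed by [T]: any d - p further letters, followed by
    any power of [x], annihilate [E]. *)
Let V p T := stable E T /\ forall u j, Forall H u -> (d <= length u + p)%nat -> vanish E (T ∘ wd u ∘ pw x j).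

Lemma V_start : V 0 idB.
Proof.
split; first by move=> y.
move=> u j Hu Lu y Ey; rewrite cmp1l cmp_app; apply: HN => //; first by lia.
by apply: pw_stable => //; exact: JS.
Qed.

Lemma V_h p T h : H h -> V p T -> V (S p) (T ∘ h).
Proof.
move=> Hh [ST HV]; split; first by move=> y Ey; rewrite cmp_app; apply: ST; apply: JS => //; exact: HJ.
move=> u j Hu Lu; rewrite -(cmpA T); apply: (HV (h :: u)); [by constructor|rewrite /=; lia].
Qed.

(** The identity x h = jp h x - h x moves [x] to the right: [jp h x] is again a letter of [H], and
    in the other term [h] has joined [T]. *)
Lemma V_x p T : V p T -> V p (T ∘ x).
Proof.
move=> HV; split; first by move=> y Ey; rewrite cmp_app; apply: (proj1 HV); exact: JS.
move=> u; elim: u p T HV => [|h u IH] p T HV j Hu Lu.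
  by rewrite /= cmp1r -cmpA -pwS; have := proj2 HV [] (S j) Hu Lu; rewrite /= cmp1r.
have Hh := Forall_inv Hu; have Hu' := Forall_inv_tail Hu.
have -> : T ∘ x ∘ wd (h :: u) ∘ pw x j = T ∘ wd (jp h x :: u) ∘ pw x j -v T ∘ h ∘ x ∘ wd u ∘ pw x j.
  by rewrite !wdS /jp !(cmpDl, cmpDr) !cmpA; vring.
move=> y Ey; rewrite badd_app bopp_app.
rewrite (proj2 HV (jp h x :: u)) //; last by constructor=> //; exact: Hx.
by rewrite (IH (S p) (T ∘ h) (V_h Hh HV)) //; [vring|move: Lu; rewrite /=; lia].
Qed.

Lemma V_xn p T i : V p T -> V p (T ∘ pw x i).
Proof.
move=> HV; elim: i => [|i IH]; first by rewrite cmp1r.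
by rewrite pwSr cmpA; exact: V_x.
Qed.

Lemma run_split m w : Forall (fun a => H a \/ a = x) w -> (m <= length w)%nat ->
  (exists w', Forall (fun a => H a \/ a = x) w' /\ wd w = pw x m ∘ wd w') \/
  (exists i h w', H h /\ Forall (fun a => H a \/ a = x) w' /\ (length w <= length w' + m)%nat /\
     wd w = pw x i ∘ h ∘ wd w').
Proof.
elim: m w => [|m IH] w Hw Lw; first by left; exists w; rewrite cmp1l.
case: w Hw Lw => [|a w] Hw Lw; first by move: Lw => /=; lia.
have Hw' := Forall_inv_tail Hw.
case: (Forall_inv Hw) => [Ha|Ea].
  by right; exists 0%nat, a, w; rewrite cmp1l; split=> //; split=> //; split=> //=; lia.
case: (IH w Hw'); first by move: Lw => /=; lia.
  by move=> [w' [H1 E1]]; left; exists w'; split=> //; rewrite /= Ea E1 cmpA.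
move=> [i [h [w' [Hh [H1 [L1 E1]]]]]]; right; exists (S i), h, w'; split=> //; split=> //; split; first by rewrite /=; lia.
by rewrite /= Ea E1 !cmpA.
Qed.

(** A word of length k n either has a run of n letters [x], which vanishes, or yields k letters of
    [H] that raise [p] one by one to d. *)
Lemma mixed_vanish k p T w : (d <= p + k)%nat -> V p T -> Forall (fun a => H a \/ a = x) w ->
  (k * n <= length w)%nat -> vanish E (T ∘ wd w).
Proof.
have Hst u : Forall (fun a => H a \/ a = x) u -> stable E (wd u).
  move=> Hu; apply: wd_stable; apply: Forall_impl Hu => a [/HJ|->]; exact: JS.
elim: k p T w => [|k IH] p T w Hd HV Hw Lw y Ey.
  rewrite cmp_app; apply: (proj2 HV [] 0%nat (Forall_nil _) _ (wd w y)); first by rewrite /=; lia.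
  exact: Hst.
case: (@run_split n w Hw); first by move: Lw => /=; lia.
  move=> [w' [H1 ->]]; rewrite !cmp_app xn ?bop0 //; exact: Hst.
move=> [i [h [w' [Hh [H1 [L1 ->]]]]]].
rewrite !cmpA; apply: (IH (S p)) => //; first by lia.
  by apply: V_h => //; exact: V_xn.
by move: Lw => /=; lia.
Qed.

Lemma nilp_step : nilp E (fun a => H a \/ a = x) (d * n).
Proof. by move=> w Hw Lw; rewrite -(cmp1l (wd w)); apply: (mixed_vanish (k := d) _ V_start). Qed.
End Step.

(** A maximal nilpotent subset [H] must be all of [J]: otherwise some [x] outside satisfies
    [H (jp h x)] for all h in [H], and [nilp_step] would allow adjoining it. *)
Lemma jacobson w : Forall J w -> (d <= length w)%nat -> vanish E (wd w).
Proof.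
have [H [HJ [HN Hm]]] := nilp_maximal.
suff JH a : J a -> H a by move=> Hw; apply: HN; apply: Forall_impl Hw.
move=> Ja; apply: NNPP => nHa.
have [x [Jx [nHx Hx]]] : exists x, J x /\ ~ H x /\ forall h, H h -> H (jp h x).
  apply: NNPP => K.
  have nxt x : J x -> ~ H x -> exists h, H h /\ ~ H (jp h x).
    move=> Jx nHx; apply: NNPP => K2; apply: K; exists x; split=> //; split=> // h Hh.
    by apply: NNPP => K3; apply: K2; exists h.
  (* If no such x exists, iterating x -> jp h x from [a] never enters [H]. After k steps x is a sum
     of products u a v with k letters of [H]; once there are 2 d letters in all, one side has at
     least d of them and the product vanishes on [E]. *)
  have chain k : exists x, J x /\ ~ H x /\ forall u v, Forall H u -> Forall H v ->
      (2 * d <= length u + length v + k)%nat -> vanish E (wd u ∘ x ∘ wd v).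
    have Hst u : Forall H u -> stable E (wd u).
      by move=> Hu; apply: wd_stable; apply: Forall_impl Hu => b /HJ; exact: JS.
    elim: k => [|k [x [Jx [nHx IH]]]].
      exists a; split=> //; split=> // u v Hu Hv L y Ey; rewrite !cmp_app.
      case: (Nat.le_gt_cases d (length v)) => Lv; first by rewrite (HN v) // !bop0.
      by apply: HN => //; [lia|apply: JS => //; apply: Hst].
    case: (nxt x Jx nHx) => h [Hh nHh]; exists (jp h x); split; first by apply: JJ => //; exact: HJ.
    split=> // u v Hu Hv L y Ey.
    have -> : wd u ∘ jp h x ∘ wd v = wd (u ++ [h]) ∘ x ∘ wd v +v wd u ∘ x ∘ wd (h :: v).
      by rewrite wd_cat /= cmp1r /jp cmpDr cmpDl !cmpA.
    rewrite badd_app (IH (u ++ [h]) v) //; last by rewrite length_app /=; lia.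
      rewrite (IH u (h :: v)) //; [vring|by constructor|rewrite /=; lia].
    by apply/Forall_app; split=> //; constructor.
  (* The element reached vanishes on [E], so adjoining it keeps [H] nilpotent, against
     maximality. *)
  case: (chain (2 * d)%nat) => x [Jx [nHx Hx]]; apply: nHx; apply: (Hm x (S d)) => //.
  have x0 : vanish E x by have := Hx [] [] (Forall_nil _) (Forall_nil _) ltac:(rewrite /=; lia); rewrite /= cmp1l cmp1r.
  move=> w' Hw' Lw'.
  have Hst : stable E (wd w').
    by apply: wd_stable; apply: Forall_impl Hw' => b [/HJ|->]; exact: JS.
  case: (classic (Forall H w')) => [Hall|nall]; first by apply: HN => //; lia.
  have {nall Lw' Hst} : Exists (fun b => b = x) w'.
    apply: NNPP => K3; apply: nall; apply/Forall_forall => b Hb.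
    move/Forall_forall: Hw' => /(_ b Hb) [] // Eb; exfalso; apply: K3; apply/Exists_exists; by exists b.
  elim: w' Hw' => [|b w' IH] Hw' Hex; first by inversion Hex.
  have Hst : stable E (wd w').
    by apply: wd_stable; apply: Forall_impl (Forall_inv_tail Hw') => c [/HJ|->]; exact: JS.
  move=> y Ey; rewrite wdS cmp_app.
  inversion Hex; subst; first by apply: x0; exact: Hst.
  by rewrite (IH (Forall_inv_tail Hw')) ?bop0.
case: (Jn Jx) => n xn; apply: nHx; apply: (Hm x (d * n)%nat) => //.
exact: (nilp_step HJ HN Jx Hx xn).
Qed.
End Jacobson.

(** * Finite-rank elements *)

(** An eigenvalue a <> 0 would make the powers grow like |a|^n, so the annihilating polynomial from
    [annihilate] is a power of T. *)
Lemma qn_nilpotent (X : CBanach) (E : X -> Prop) (l : list X) (T : Bop X) : subsp E -> (forall y, E y -> span l y) ->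
  stable E T -> gz T -> exists n, vanish E (pw T n).
Proof.
move=> HE Hl HT Hg; case: (annihilate HE Hl HT) => L [HL HV]; exists (length L).
have eig0 a : eigenvalue T a -> a = C0.
  move=> [v [v0 Ev]]; apply: NNPP => a0; have pa := Cabs_pos a0; have pv := vnorm_pos v0.
  case: (Hg (Cabs a / 2)); first lra. move=> K [K0 HK].
  have it n : <|pw T n v|> = Cabs a ^ n * <|v|>.
    have [c [-> Hc]] : exists c, pw T n v = c *v v /\ Cabs c = Cabs a ^ n.
      elim: n => [|n [c [E1 Hc]]]; first by exists C1; rewrite vscal_1 Cabs_C1.
      by exists (Cmul c a); rewrite pw_app E1 bopZ Ev vscal_assoc Cabs_mul Hc /= Rmult_comm.
    by rewrite vnorm_scal Hc.
  case: (@pow_lt_small (/ 2) ltac:(lra) (/ (K + 1))); first by apply: Rinv_0_lt_compat; lra.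
  move=> n /(_ n (le_n _)) Hn.
  have p : 0 < Cabs a ^ n by apply: pow_lt.
  have := bop_le (pw T n) v; rewrite it => H.
  have {}H : Cabs a ^ n <= K * (Cabs a / 2) ^ n.
    apply: Rle_trans (HK n); apply: (Rmult_le_reg_r <|v|>) => //.
  rewrite /Rdiv Rpow_mult_distr in H.
  have : (/ 2) ^ n * (K + 1) < 1 by have := Rmult_lt_compat_r (K + 1) _ _ ltac:(lra) Hn; rewrite Rinv_l; lra.
  have : 0 < (/ 2) ^ n by apply: pow_lt; lra.
  nra.
have -> : pw T (length L) = prodK T L; last exact: HV.
elim: L HL {HV} => [|a L IH] HL //.
have -> : a = C0 by apply: eig0; apply: HL; left.
cbn [length prodK]; rewrite pwSr IH; last by move=> b Hb; apply: HL; right.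
by congr (_ ∘ _); vring.
Qed.

Section Poly.
Variable X : CBanach.
Implicit Types (a b p q f S T : Bop X) (H J W : Bop X -> Prop).

(** Homogeneous of degree [k]: the grading fixes the sign acquired when a letter of [J] passes a
    polynomial, and positive degree ensures finite rank and nilpotency. *)
Inductive poly H : nat -> Bop X -> Prop :=
| poly1 : poly H 0 idB
| polyM k f T : H f -> poly H k T -> poly H (S k) (f ∘ T)
| polyD k p q : poly H k p -> poly H k q -> poly H k (p +v q)
| polyZ k c p : poly H k p -> poly H k (c *v p).

Lemma poly_mul H k m p q : poly H k p -> poly H m q -> poly H (k + m) (p ∘ q).
Proof.
move=> Hp Hq; elim: Hp => [|i f T Hf _ IH|i S T _ IHS _ IHT|i c T _ IH].
- by rewrite cmp1l.
- by rewrite -cmpA; apply: polyM.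
- by rewrite cmpDl; apply: polyD.
- by rewrite cmpZl; apply: polyZ.
Qed.

Lemma poly_pw H k p n : poly H k p -> poly H (n * k) (pw p n).
Proof. by move=> Hp; elim: n => [|n IH]; [exact: poly1|rewrite pwS; apply: poly_mul]. Qed.

Lemma poly_mono H H' k p : (forall f, H f -> H' f) -> poly H k p -> poly H' k p.
Proof.
move=> HH; elim=> [|i f T Hf _ IH|i S T _ IHS _ IHT|i c T _ IH]; 
  [exact: poly1|by apply: polyM => //; exact: HH|exact: polyD|exact: polyZ].
Qed.

Lemma poly_vanish H E d k p : nilp E H d -> poly H k p -> (d <= k)%nat -> vanish E p.
Proof.
move=> HN Hp Hd; suff K w : Forall H w -> (d <= length w + k)%nat -> vanish E (wd w ∘ p).
  by have := K [] (Forall_nil _); rewrite cmp1l; apply.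
elim: Hp w {Hd} => [|i f T Hf _ IH|i S T _ IHS _ IHT|i c T _ IH] w Hw Lw y Ey.
- by rewrite cmp1r; apply: HN => //; lia.
- have -> : wd w ∘ (f ∘ T) = wd (w ++ [f]) ∘ T by rewrite wd_cat wd1 cmpA.
  apply: IH => //; last by rewrite length_app /=; lia.
  by apply/Forall_app; split=> //; constructor.
- by rewrite cmpDr badd_app IHS // IHT //; vring.
- by rewrite cmpZr bscal_app IH //; vring.
Qed.

Variables (J W : Bop X -> Prop).
Hypotheses (WJ : forall a T, J a -> W T -> W (jp a T)) (WW : forall S T, W S -> W T -> W (jp S T)).
Hypotheses (Wgz : forall T, W T -> gz T).
Let F T := W T /\ finrank T.
Let FL l T := W T /\ forall y, span l (T y).

Lemma poly_supp k p : poly F k p -> exists l, poly (FL l) k p.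
Proof.
have mono l l' (T : Bop X) : FL l T -> FL (l ++ l') T /\ FL (l' ++ l) T.
  move=> [WT HT]; have S0 m := proj1 (span_subsp m); split; split=> // y.
    by rewrite -(vadd_0 (T y)); exact: span_app.
  by rewrite -(vadd_0l (T y)); exact: span_app.
elim=> [|i f T [Wf [l Hl]] _ [l' IH]|i S T _ [l IHS] _ [l' IHT]|i c T _ [l IH]].
- by exists []; exact: poly1.
- exists (l ++ l'); apply: polyM; first by apply: (proj1 (mono _ _ _ _)).
  by apply: poly_mono IH => f' /(mono _ l) [].
- exists (l ++ l'); apply: polyD; [apply: poly_mono IHS|apply: poly_mono IHT] => f' H.
    exact: (proj1 (mono _ _ _ H)). exact: (proj2 (mono _ _ _ H)).
- by exists l; exact: polyZ.
Qed.

Lemma poly_range H l k p : (forall f, H f -> forall y, span l (f y)) -> poly H (S k) p -> forall y, span l (p y).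
Proof.
move=> HH Hp; have [S0 [Sa Ss]] := span_subsp l.
move Em : (S k) Hp => m Hp; elim: Hp Em => [|i f T Hf _ _|i S T _ IHS _ IHT|i c T _ IH] Em y //.
- exact: (HH f Hf).
- by apply: Sa; [exact: IHS|exact: IHT].
- by apply: Ss; exact: IH.
Qed.

(** Finitely many letters occur, so one finite-dimensional space contains all their ranges.
    Jacobson's theorem makes long words vanish on it, and [p] maps into it. *)
Lemma poly_nilpotent k p : poly F (S k) p -> exists n, pw p n = 0v.
Proof.
move=> /poly_supp [l Hp].
have Hst f : FL l f -> stable (span l) f by move=> [_ Hf] y _; exact: Hf.
have HN : nilp (span l) (FL l) (length l).
  move=> w; apply: jacobson => //; first exact: span_subsp.
    move=> a b [Wa Ha] [Wb Hb]; split; first exact: WW.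
    by move=> y; rewrite badd_app !cmp_app; apply: (proj1 (proj2 (span_subsp l))).
  move=> a Ha; apply: (qn_nilpotent (span_subsp l) (fun y Hy => Hy) (Hst _ Ha)); apply: Wgz; exact: (proj1 Ha).
exists (S (length l)); apply: Bop_ext => y; rewrite pwSr cmp_app bzero_app.
apply: (poly_vanish HN (poly_pw (length l) Hp)); first by lia.
by apply: (poly_range _ Hp) => f [].
Qed.

Fixpoint sgn (k : nat) : C := match k with O => C1 | S k => Copp (sgn k) end.

(** Each letter f is passed by a f = jp a f - f a, where [jp a f] is again a finite-rank element of
    [W]; the degree is kept and every step changes the sign. *)
Lemma poly_comm a k p : J a -> poly F k p -> exists p', poly F k p' /\ a ∘ p = p' +v sgn k *v (p ∘ a).
Proof.
move=> Ja; elim=> [|i f T Hf HT [T' [H1 E1]]|i S T _ [S' [HS ES]] _ [T' [HT ET]]|i c T _ [T' [H1 E1]]].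
- exists (C0 *v idB); split; first by apply: polyZ; exact: poly1.
  by rewrite cmp1l cmp1r; cbn [sgn]; vring.
- exists (jp a f ∘ T +v Copp C1 *v (f ∘ T')); split.
    apply: polyD; last by apply: polyZ; exact: polyM.
    apply: polyM => //; split; first by apply: WJ => //; exact: (proj1 Hf).
    case: (proj2 Hf) => l Hl; exists (l ++ map a l) => y.
    rewrite badd_app !cmp_app vadd_comm; apply: span_app => //; exact: span_map.
  have -> : a ∘ (f ∘ T) = jp a f ∘ T -v f ∘ (a ∘ T) by rewrite /jp cmpDl !cmpA; vring.
  by rewrite E1 cmpDr cmpZr !cmpA; cbn [sgn]; vring.
- exists (S' +v T'); split; first exact: polyD.
  by rewrite cmpDr cmpDl ES ET; vring.
- by exists (c *v T'); split; [exact: polyZ|rewrite cmpZr cmpZl E1; vring].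
Qed.
End Poly.

Definition irr (X : CBanach) (J : Bop X -> Prop) := forall M : X -> Prop, closed_subspace M ->
  (forall a x, J a -> M x -> M (a x)) -> (forall x, M x -> x = 0v) \/ (forall x, M x).

(** The vectors killed by S w for all words w form a closed invariant subspace containing the range
    of [T]. *)
Lemma irr_prime (X : CBanach) (J : Bop X -> Prop) (S T : Bop X) : irr J ->
  (forall w, Forall J w -> S ∘ wd w ∘ T = 0v) -> S = 0v \/ T = 0v.
Proof.
move=> HI H; case: (HI (fun y => forall w, Forall J w -> S (wd w y) = 0v)).
- split; first by move=> w _; rewrite !bop0.
  split; first by move=> x y Hx Hy w Hw; rewrite !bopD Hx // Hy //; vring.
  split; first by move=> c x Hx w Hw; rewrite !bopZ Hx //; vring.
  move=> u y Hu Hy w Hw; apply: (converges_unique (u := fun n => S (wd w (u n)))).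
    exact: conv_bop (conv_bop _ Hy).
  move=> e e0; exists 0%nat => n _; rewrite Hu // vadd_opp vnorm_0 //.
- move=> a x Ja Hx w Hw.
  have -> : wd w (a x) = wd (w ++ [a]) x by rewrite wd_cat wd1.
  by apply: Hx; apply/Forall_app; split=> //; constructor.
- move=> H0; right; apply: Bop_ext => x; apply: H0 => w Hw.
  by have := f_equal (fun A : Bop X => A x) (H w Hw); rewrite !cmp_app.
- by move=> H1; left; apply: Bop_ext => x; have := H1 x [] (Forall_nil _).
Qed.

Section FiniteRank.
Variable X : CBanach.
Implicit Types (a b p q f S T : Bop X).
Variables (J W : Bop X -> Prop).
Hypotheses (HI : irr J).
Hypotheses (WJ : forall a T, J a -> W T -> W (jp a T)) (WW : forall S T, W S -> W T -> W (jp S T)).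
Hypotheses (Wgz : forall T, W T -> gz T).
Let F T := W T /\ finrank T.

Section Minimal.
Variables (k : nat) (p : Bop X) (l : list X).
Hypotheses (Hp : poly F (S k) p) (pn : p <> 0v) (Hl : forall y, span l (p y)).
Hypothesis (Hmin : forall l' m q, poly F (S m) q -> q <> 0v -> (forall y, span l' (q y)) -> (length l <= length l')%nat).

(* The values at p of the iterated (anti)commutation operators with elements of J. *)
Inductive Dq : nat -> Bop X -> Prop :=
| Dq0 : Dq 0 p
| DqS n q a : Dq n q -> J a -> Dq (S n) (a ∘ q -v sgn (S k) *v (q ∘ a)).

Lemma Dq_poly n q : Dq n q -> poly F (S k) q.
Proof.
elim=> [|i q' a _ IH Ja] //.
case: (poly_comm WJ Ja IH) => q'' [H1 ->].
by have -> : q'' +v sgn (S k) *v (q' ∘ a) -v sgn (S k) *v (q' ∘ a) = q'' by vring.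
Qed.

(** The last letter of the word is pushed into q: a q is a deeper iterated commutator plus a
    multiple of q a, and word length plus depth stays below n in both terms. *)
Lemma Dq_words n : (forall i q, (i < n)%nat -> Dq i q -> p ∘ q = 0v) ->
  forall v i q, Forall J v -> (length v + i < n)%nat -> Dq i q -> p ∘ wd v ∘ q = 0v.
Proof.
move=> A; elim/rev_ind => [|a v IH] i q Hv Lv Hq.
  by rewrite cmp1r; apply: (A i) => //; rewrite /= in Lv.
move: Hv; rewrite Forall_app => -[Hv Ha]; have Ja := Forall_inv Ha; rewrite length_app /= in Lv.
have -> : p ∘ wd (v ++ [a]) ∘ q = p ∘ wd v ∘ (a ∘ q -v sgn (S k) *v (q ∘ a)) +v sgn (S k) *v (p ∘ wd v ∘ q ∘ a).
  by rewrite wd_cat wd1 cmpDr cmpNr cmpZr !cmpA; vring.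
rewrite (IH (S i)) //; [|lia|exact: DqS].
by rewrite (IH i) //; [rewrite cmp0l; vring|lia].
Qed.

(** Unfolding q one commutator at a time, the terms with a letter on the right are killed by
    [Dq_words]; only the word with all letters on the left survives. *)
Lemma Dq_lead n q : (forall i q, (i < n)%nat -> Dq i q -> p ∘ q = 0v) -> Dq n q ->
  exists w, p ∘ q = p ∘ wd w ∘ p.
Proof.
move=> A Hq; have : exists v i q', Forall J v /\ (length v + i = n)%nat /\ Dq i q' /\ p ∘ q = p ∘ wd v ∘ q'.
  by exists [], n, q; rewrite cmp1r.
move=> [v [i [q' [Hv [Lv [Hq' ->]]]]]]; elim: i v q' Hv Lv Hq' => [|i IH] v q' Hv Lv Hq'.
  by inversion Hq'; exists v.
inversion Hq' as [|i' q1 a Hq1 Ja Ei Eq]; subst.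
case: (IH (v ++ [a]) q1) => //; first by apply/Forall_app; split=> //; constructor.
  by rewrite length_app /=; lia.
move=> w Ew; exists w; rewrite -Ew wd_cat wd1 cmpDr cmpNr cmpZr !cmpA.
by rewrite (Dq_words A Hv _ Hq1); [rewrite cmp0l; vring|lia].
Qed.

(* If p q <> 0 then p q has the same range as p by minimality of the rank, and p q = p w p shows
   that this persists for p q^j; but q is nilpotent. *)
Lemma Dq_zero n q : Dq n q -> p ∘ q = 0v.
Proof.
elim/Wf_nat.lt_wf_ind: n q => n A q Hq; apply: NNPP => nz.
have Hq' := Dq_poly Hq.
have range y : exists z, p y = p (q z).
  pose R y := exists z, y = p (q z).
  have RS : subsp R.
    split; first by exists 0v; rewrite !bop0.
    split; first by move=> _ _ [z ->] [t ->]; exists (z +v t); rewrite !bopD.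
    by move=> c _ [z ->]; exists (c *v z); rewrite !bopZ.
  case: (subspan RS (l := l)); first by move=> _ [z ->]; exact: Hl.
    by move=> /(_ (p y)); apply; exact: Hl.
  move=> [l' [L1 [L2 _]]]; exfalso.
  have := @Hmin l' _ _ (poly_mul Hp Hq') nz (fun z => L2 _ (ex_intro _ z eq_refl)); lia.
case: (Dq_lead (fun i q' Hi => A i Hi q') Hq) => w Ew.
have Ew' y : p (q y) = p (wd w (p y)) by have := f_equal (fun B : Bop X => B y) Ew; rewrite !cmp_app.
have it j y : exists z, p y = p (pw q j z).
  elim: j y => [|j IH] y; first by exists y.
  case: (range y) => z Ez; case: (IH z) => t Et.
  by exists t; rewrite Ez pw_app Ew' Et -Ew'.
case: (poly_nilpotent WW Wgz Hq') => j Ej.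
by apply: pn; apply: Bop_ext => y; case: (it j y) => z ->; rewrite Ej !bzero_app bop0.
Qed.

Lemma minimal_absurd : False.
Proof.
case: (@irr_prime X J p p HI) => // v Hv.
exact: (Dq_words (fun i q (_ : (i < S (length v))%nat) Hq => Dq_zero Hq) Hv (i := 0) ltac:(lia) Dq0).
Qed.
End Minimal.

Lemma finite_rank_zero T : W T -> finrank T -> T = 0v.
Proof.
move=> WT FT; apply: NNPP => T0.
pose P n := exists l m q, length l = n /\ poly F (S m) q /\ q <> 0v /\ forall y, span l (q y).
have [n [[l [m [q [Ln [Hq [q0 Hl]]]]]] Hmin]] : exists n, P n /\ forall n', P n' -> (n <= n')%nat.
  case: FT => l Hl.
  have : P (length l).
    exists l, 0%nat, T; split=> //; split; last by [].
    by rewrite -(cmp1r T); apply: polyM; [split=> //; exists l|exact: poly1].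
  elim/Wf_nat.lt_wf_ind: (length l) => n IH Pn.
  case: (classic (exists n', P n' /\ (n' < n)%nat)) => [[n' [Pn' Hn']]|K]; first exact: (IH n').
  exists n; split=> // n' Pn'; case: (Nat.le_gt_cases n n') => // Hlt; case: K; by exists n'.
apply: (@minimal_absurd m q l) => // l' m' q' Hq' q0' Hl'.
by rewrite Ln; apply: Hmin; exists l', m', q'.
Qed.
End FiniteRank.

(** * Quasinilpotence of products *)

Lemma Copp_neq0 a : a <> C0 -> Copp a <> C0.
Proof. move=> H E; apply: H; have -> : a = Copp (Copp a) by ring. rewrite E; ring. Qed.

(** Put A = [lr G H] - 1, which commutes with left multiplication by [G]. Iterating the relation
    expands S^n (x u) into terms G^k (A^j x) D^k u with j + k = n. Here A^j x and D^k u may be given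
    arbitrarily small exponential growth, small enough for the latter to absorb G^k. *)
Lemma NN_transport (X : CBanach) (G H S D x : Bop X) c u :
  (forall (y : Bop X) v, S (y v) = c *v (((lr G H -v idB) y : Bop X) v) -v G (y (D v))) ->
  NN (lr G H -v idB) x -> NN D u -> NN S (x u).
Proof.
move=> HS Hx Hu t t0; set A := lr G H -v idB in HS Hx.
have pc := Cabs_nonneg c; have pG := vnorm_nonneg G.
pose s := t / (2 * (Cabs c + 1)); pose s' := t / (2 * (<|G|> + 1)).
have s0 : 0 < s by apply: Rdiv_lt_0_compat; lra.
have s0' : 0 < s' by apply: Rdiv_lt_0_compat; lra.
case: (Hx s s0) => K1 [K10 HK1]; case: (Hu s' s0') => K2 [K20 HK2].
have AG y i : A (pw G i ∘ y : Bop X) = pw G i ∘ (A y : Bop X).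
  have cG : G ∘ pw G i = pw G i ∘ G by rewrite -pwS pwSr.
  by rewrite /A !badd_app !bopp_app !idB_app !lr_app !cmpDr cmpNr !cmpA cG.
have key n : forall i j k, <|pw S n ((pw G i ∘ (pw A j x : Bop X)) (pw D k u))|> <=
    (K1 * K2) * (<|G|> ^ i * s ^ j * s' ^ k) * (Cabs c * s + <|G|> * s') ^ n.
  elim: n => [|n IH] i j k.
    rewrite idB_app cmp_app; apply: Rle_trans (bop_le _ _) _.
    have h1 : <|pw G i|> <= <|G|> ^ i by exact: bnorm_pw.
    have h2 := bop_le (pw A j x : Bop X) (pw D k u); have h3 := HK1 j; have h4 := HK2 k.
    have q1 := vnorm_nonneg (pw G i); have q2 := vnorm_nonneg ((pw A j x : Bop X) (pw D k u)).
    have q3 := vnorm_nonneg (pw A j x); have q4 := vnorm_nonneg (pw D k u).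
    apply: Rle_trans (_ : <|G|> ^ i * ((K1 * s ^ j) * (K2 * s' ^ k)) <= _); last by rewrite /=; right; ring.
    apply: Rmult_le_compat => //; apply: Rle_trans h2 _; exact: Rmult_le_compat.
  rewrite pwSr cmp_app HS AG -pw_app bopD bopN bopZ.
  have -> : G ((pw G i ∘ (pw A j x : Bop X)) (D (pw D k u))) = (pw G (Datatypes.S i) ∘ (pw A j x : Bop X)) (pw D (Datatypes.S k) u) by [].
  apply: Rle_trans (vnorm_sub_le _ _) _; rewrite vnorm_scal.
  have := IH i (Datatypes.S j) k; have := IH (Datatypes.S i) j (Datatypes.S k).
  set n1 := <|_|>; set n2 := <|_|> => h1 h2.
  have := Rmult_le_compat_l _ _ _ pc h2; cbn [pow] in *; lra.
exists (K1 * K2); split; first by apply: Rmult_le_pos.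
move=> n; have := key n 0%nat 0%nat 0%nat; cbn [pow]; rewrite !Rmult_1_r => H1.
apply: Rle_trans (H1 : <|pw S n (x u)|> <= _) _.
apply: Rmult_le_compat_l; first by apply: Rmult_le_pos.
apply: pow_incr; split.
  by have := Rmult_le_pos _ _ pc (Rlt_le _ _ s0); have := Rmult_le_pos _ _ pG (Rlt_le _ _ s0'); lra.
have h1 : Cabs c * s <= t / 2.
  have : (Cabs c + 1) * s = t / 2 by rewrite /s; field; lra. lra.
have h2 : <|G|> * s' <= t / 2.
  have : (<|G|> + 1) * s' = t / 2 by rewrite /s'; field; lra. lra.
lra.
Qed.

(** Without a common kernel vector, v could be prolonged to nonzero products of any length, but
    products of length at least that of [l] vanish on [E]. *)
Lemma common_kernel (X : CBanach) (E : X -> Prop) (l : list X) (W : Bop X -> Prop) v :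
  subsp E -> (forall y, E y -> span l y) -> (forall T, W T -> stable E T) -> 
  (forall S T, W S -> W T -> W (jp S T)) -> (forall T, W T -> gz T) -> E v -> v <> 0v ->
  exists v', v' <> 0v /\ forall T, W T -> T v' = 0v.
Proof.
move=> HE Hl HS WW Wgz Ev v0.
have HN w : Forall W w -> (length l <= length w)%nat -> vanish E (wd w).
  apply: (jacobson HE Hl HS WW) => a Wa; apply: (qn_nilpotent HE Hl) => //; [exact: HS|exact: Wgz].
apply: NNPP => K.
have nz y : y <> 0v -> exists T, W T /\ T y <> 0v.
  move=> y0; apply: NNPP => K2; apply: K; exists y; split=> // T WT.
  by apply: NNPP => Ty; apply: K2; exists T.
have long n : exists w, Forall W w /\ length w = n /\ wd w v <> 0v.
  elim: n => [|n [w [Hw [Lw Nw]]]]; first by exists [].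
  case: (nz _ Nw) => T [WT NT]; exists (T :: w); split; first by constructor.
  by split; [rewrite /= Lw|].
case: (long (length l)) => w [Hw [Lw Nw]]; apply: Nw; apply: HN => //; lia.
Qed.

Lemma qn_scal (X : CBanach) c (T : Bop X) : qn T -> qn (c *v T : Bop X).
Proof.
move=> H a a0; case: (classic (c = C0)) => [->|c0].
  exists (Cinv (Copp a) *v idB).
  have -> : C0 *v T -v a *v (idB : Bop X) = Copp a *v idB by vring.
  by apply: (inv_scal (Copp_neq0 a0)); split; rewrite cmp1l.
case: (H (Cmul (Cinv c) a)); first by apply: Cmul_neq0 => //; exact: Cinv_neq0.
move=> R HR; exists (Cinv c *v R).
have -> : c *v T -v a *v idB = c *v (T -v Cmul (Cinv c) a *v idB).
  have -> : c *v (T -v Cmul (Cinv c) a *v idB) = c *v T -v Cmul (Cmul c (Cinv c)) a *v idB by vring.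
  by rewrite Cinv_r //; vring.
exact: inv_scal.
Qed.

Section Words.
Variable X : CBanach.
Implicit Types (a b S T : Bop X) (w : list (Bop X)).
Variables (J : Bop X -> Prop) (W : opB X -> Prop).
Hypotheses (HI : irr J) (Jc : forall a, J a -> compact_op a) (JZ : forall c a, J a -> J (c *v a : Bop X)).
Hypotheses (JJ : forall a b, J a -> J b -> J (jp a b)).
Hypotheses (HW : closed_subspace W) (WJ : forall a T, J a -> W T -> W (jp a T)).
Hypotheses (WW : forall S T, W S -> W T -> W (jp S T)) (Wgz : forall T, W T -> gz T).
Hypothesis (Wn : exists T, W T /\ T <> 0v).

(** The common kernel of [W] is invariant under J: on it T a coincides with [jp a T], which lies in
    [W]. *)
Lemma W_kernel v : (forall T, W T -> T v = 0v) -> v = 0v.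
Proof.
move=> Hv; case: (@HI (fun y : X => forall T, W T -> T y = 0v)).
- split; first by move=> T _; rewrite bop0.
  split; first by move=> x y Hx Hy T WT; rewrite bopD Hx // Hy //; vring.
  split; first by move=> c x Hx T WT; rewrite bopZ Hx //; vring.
  move=> u y Hu Hy T WT; apply: (converges_unique (u := fun n => T (u n))); first exact: conv_bop.
  by move=> e e0; exists 0%nat => n _; rewrite Hu // vadd_opp vnorm_0.
- move=> a x Ja Hx T WT; have := Hx _ (WJ Ja WT); rewrite badd_app !cmp_app (Hx T WT) bop0 vadd_0l //.
- by apply.
- by move=> H; case: Wn => T [WT []]; apply: Bop_ext => x; exact: H.
Qed.

Fixpoint gprod w : Bop X := match w with [] => idB | a :: w => (idB +v a) ∘ gprod w end.
Fixpoint hprod w : Bop X := match w with [] => idB | a :: w => hprod w ∘ (idB +v a) end.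

Lemma gprod_compact w : Forall J w -> compact_op (gprod w -v idB : Bop X).
Proof.
elim=> [|a v Ja Hv IH].
  have -> : gprod [] -v idB = 0v :> Bop X by exact: vadd_opp.
  exact: compact_zero.
have -> : gprod (a :: v) -v idB = (gprod v -v idB) +v a ∘ gprod v.
  by cbn [gprod]; rewrite cmpDl cmp1l; vring.
by apply: compact_add => //; apply: compact_cmp_r; exact: Jc.
Qed.

Lemma hprod_compact w : Forall J w -> compact_op (hprod w -v idB : Bop X).
Proof.
elim=> [|a v Ja Hv IH].
  have -> : hprod [] -v idB = 0v :> Bop X by exact: vadd_opp.
  exact: compact_zero.
have -> : hprod (a :: v) -v idB = (hprod v -v idB) +v hprod v ∘ a.
  by cbn [hprod]; rewrite cmpDr cmp1r; vring.
by apply: compact_add => //; apply: compact_cmp_l; exact: Jc.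
Qed.

(** The term a T a equals jp a (jp a T) / 2 - jp (jp a a) T / 4, since [jp a a] is 2 a^2. *)
Lemma W_quadratic a (T : Bop X) : J a -> W T -> W ((idB +v a) ∘ T ∘ (idB +v a) : Bop X).
Proof.
move=> Ja WT; have [_ [Wa Ws]] := closed_subsp HW.
pose half := RtoC (/ 2).
have W1 : W (jp a T) by exact: WJ.
have W2 : W (jp a (jp a T)) by exact: WJ.
have W3 : W (jp (jp a a) T) by apply: WJ => //; exact: JJ.
have -> : (idB +v a) ∘ T ∘ (idB +v a) =
    (T +v jp a T) +v (half *v jp a (jp a T) +v (Copp (Cmul half half)) *v jp (jp a a) T) :> Bop X.
  rewrite /jp !(cmpDl, cmpDr, cmp1l, cmp1r) !cmpA; vring; apply: C_ext; cbn; lra.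
by repeat first [assumption | apply: (Wa) | apply: (Ws)].
Qed.

Lemma W_gh w (T : Bop X) : Forall J w -> W T -> W (gprod w ∘ T ∘ hprod w : Bop X) /\ W (hprod w ∘ T ∘ gprod w : Bop X).
Proof.
move=> Hw; elim: Hw T => [|a v Ja Hv IH] T WT; first by rewrite /= cmp1l cmp1r.
split; cbn [gprod hprod].
  have := W_quadratic Ja (proj1 (IH _ WT)); by rewrite !cmpA.
have := proj2 (IH _ (W_quadratic Ja WT)); by rewrite !cmpA.
Qed.

Hypothesis Wf : forall T, W T -> finrank T -> T = 0v.

Lemma lr_generalized_kernel (G H T : Bop X) : compact_op (G -v idB : Bop X) -> compact_op (H -v idB : Bop X) ->
  (forall S : Bop X, W S -> W (G ∘ S ∘ H : Bop X)) -> W T -> NN (lr G H -v idB) T.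
Proof.
move=> HG HH HP WT.
have E (A : Bop X) : idB +v (A -v idB) = A by vring.
have := @phi_generalized_kernel X (G -v idB) (H -v idB) W HG HH HW; rewrite !E; apply => //.
Qed.

Lemma hprod_qn w : Forall J w -> qn (hprod w -v idB : Bop X).
Proof.
move=> Hw m m0; have Kh := hprod_compact Hw; have Kg := gprod_compact Hw.
apply: fredholm_eig => // -[v [v0 Ev]].
set g := gprod w in Kg *; set h := hprod w in Kh Ev *.
(* With c = 1 + m the operators are D = -m + (h - 1) and S = m + c (g - 1), nonzero scalars plus
   compact operators, so [NN_fd] makes both generalised kernels finite-dimensional. *)
pose c := Cadd C1 m; pose D := h -v c *v idB : Bop X; pose S := c *v g -v idB : Bop X.
have Dv : NN D v.
  have Dv0 : D v = 0v.
    have -> : D v = (h -v idB : Bop X) v -v m *v v by rewrite /D /c; autorewrite with bop; vring.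
    by rewrite Ev vadd_opp.
  move=> t t0; exists <|v|>; split; first exact: vnorm_nonneg.
  case=> [|n]; first by rewrite idB_app /=; lra.
  rewrite pwSr cmp_app Dv0 bop0 vnorm_0; apply: Rmult_le_pos; [exact: vnorm_nonneg|apply: pow_le; lra].
pose E (y : X) := exists y1 y2, NN D y1 /\ NN S y2 /\ y = y1 +v y2.
have ES : subsp E.
  have [D0 [Da Ds]] := NN_subsp D; have [S0 [Sa Ss]] := NN_subsp S.
  split; first by exists 0v, 0v; split=> //; split=> //; vring.
  split.
    move=> _ _ [y1 [y2 [H1 [H2 ->]]]] [z1 [z2 [H3 [H4 ->]]]]; exists (y1 +v z1), (y2 +v z2).
    by split; [exact: Da|split; [exact: Sa|vring]].
  move=> b _ [y1 [y2 [H1 [H2 ->]]]]; exists (b *v y1), (b *v y2).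
  by split; [exact: Ds|split; [exact: Ss|vring]].
have [l1 Hl1] : exists l, forall y, NN D y -> span l y.
  have -> : D = Copp m *v idB +v (h -v idB) by rewrite /D /c; vring.
  by apply: NN_fd => //; exact: Copp_neq0.
have [l2 Hl2] : exists l, forall y, NN S y -> span l y.
  have -> : S = m *v idB +v c *v (g -v idB) by rewrite /S /c; vring.
  apply: NN_fd => //; exact: compact_scal.
have El y : E y -> span (l1 ++ l2) y.
  by move=> [y1 [y2 [H1 [H2 ->]]]]; apply: span_app; [exact: Hl1|exact: Hl2].
have tr1 T y : W T -> NN D y -> NN S (T y).
  move=> WT; apply: (@NN_transport X g h S D T C1).
    move=> A u; have -> : (lr g h -v idB) A = g ∘ A ∘ h -v A :> Bop X by [].
    by rewrite /S /D; autorewrite with bop; vring.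
  by apply: lr_generalized_kernel => // A WA; exact: (proj1 (W_gh Hw WA)).
have tr2 T y : W T -> NN S y -> NN D (T y).
  move=> WT; apply: (@NN_transport X h g D S T c).
    move=> A u; have -> : (lr h g -v idB) A = h ∘ A ∘ g -v A :> Bop X by [].
    by rewrite /S /D; autorewrite with bop; vring.
  by apply: lr_generalized_kernel => // A WA; exact: (proj2 (W_gh Hw WA)).
case: (@common_kernel X E (l1 ++ l2) W v ES El) => //.
- move=> T WT _ [y1 [y2 [H1 [H2 ->]]]]; exists (T y2), (T y1).
  by split; [exact: tr2|split; [exact: tr1|rewrite bopD vadd_comm]].
- by exists v, 0v; split=> //; split; [exact: (proj1 (NN_subsp S))|rewrite vadd_0].
- by move=> v' [n0 Hv']; apply: n0; exact: W_kernel.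
Qed.

(* t^-n (prod (1 + t a_i) - 1) tends to the product of the a_i as t goes to infinity. *)
Lemma words_qn w : Forall J w -> w <> [] -> qn (wd w).
Proof.
move=> Hw w0; rewrite -(rev_involutive w); set v := rev w.
have Hv : Forall J v by exact: Forall_rev.
have v0 : v <> [] by move=> E; apply: w0; rewrite -(rev_involutive w) -/v E.
clearbody v; clear w Hw w0.
(* The parameter t is [s n] = n + 1 and [r n] its inverse: each factor r + a equals r (1 + s a), so
   [P n] is a scalar multiple of a product [hprod] and tends to the product of the letters. Since
   [hprod] multiplies in reverse, the word was reversed beforehand. *)
pose r n := RtoC (/ INR (S n)); pose s n := RtoC (INR (S n)).
have rs n : Cmul (r n) (s n) = C1.
  by have p := lt_0_INR (S n) (Nat.lt_0_succ n); apply: C_ext; cbn -[INR]; field; lra.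
pose P := fix P n (w : list (Bop X)) : Bop X := match w with [] => idB | a :: w => P n w ∘ (r n *v idB +v a) end.
have rconv (T : Bop X) : converges (fun n => r n *v T) 0v.
  move=> e e0; have q := vnorm_nonneg T.
  have [[|N] [HN N0]] := archimed_cor1 (e / (<|T|> + 1)) ltac:(apply: Rdiv_lt_0_compat; lra); first by lia.
  exists N => n Hn; have -> : r n *v T -v 0v = r n *v T by vring.
  have p : 0 < INR (S N) by exact: lt_0_INR (Nat.lt_0_succ N).
  have p' : 0 < INR (S n) by exact: lt_0_INR (Nat.lt_0_succ n).
  have le : / INR (S n) <= / INR (S N) by apply: Rinv_le_contravar => //; apply: le_INR; lia.
  have p2 := Rinv_0_lt_compat _ p'.
  rewrite vnorm_scal Cabs_RtoC Rabs_right; last lra.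
  have E : e = e / (<|T|> + 1) * (<|T|> + 1) by field; lra.
  rewrite {}E; apply: Rle_lt_trans (_ : / INR (S n) * (<|T|> + 1) < _); first nra.
  apply: Rmult_lt_compat_r; lra.
have Pconv : converges (fun n => P n v) (wd (rev v)).
  elim: (v) => [|a u IH]; first exact: converges_const.
  have -> : wd (rev (a :: u)) = wd (rev u) ∘ (0v +v a) by rewrite vadd_0l /= wd_cat wd1.
  by apply: conv_cmp => //; apply: converges_add; [exact: rconv|exact: converges_const].
have r1 n : Cabs (r n) = / INR (S n).
  by rewrite Cabs_RtoC Rabs_right //; left; apply: Rinv_0_lt_compat; exact: lt_0_INR (Nat.lt_0_succ n).
have r2 n : 0 < / INR (S n) <= 1.
  have p' : 1 <= INR (S n) by rewrite S_INR; have := pos_INR n; lra.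
  split; first by apply: Rinv_0_lt_compat; lra.
  by rewrite -Rinv_1; apply: Rinv_le_contravar; lra.
have PS n u a : P n (a :: u) = P n u ∘ (r n *v (idB +v s n *v a)).
  have -> : r n *v (idB +v s n *v a) = r n *v idB +v Cmul (r n) (s n) *v a by vring.
  by rewrite rs vscal_1.
have PE n u : exists b : C, Cabs b <= 1 /\ P n u = b *v hprod (map (fun a => s n *v a : Bop X) u).
  elim: u => [|a u [b [Hb E]]]; first by exists C1; rewrite Cabs_C1 vscal_1; split; [lra|].
  exists (Cmul (r n) b); rewrite PS E cmpZr cmpZl vscal_assoc; split=> //.
  by rewrite Cabs_mul r1; have := r2 n; have := Cabs_nonneg b; nra.
(* [c n] is the scalar by which [P n] differs from that multiple of [hprod] - 1; it tends to 0
   because the word is nonempty. *)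
have [c Hc] : exists c : nat -> C, forall n, Cabs (c n) <= / INR (S n) /\ qn (P n v -v c n *v idB : Bop X).
  apply: (@fchoice nat C (fun n c => Cabs c <= / INR (S n) /\ qn (P n v -v c *v idB : Bop X))) => n.
  move: Hv v0; case: (v) => [|a u] // Hau _; case: (PE n u) => b [Hb E].
  exists (Cmul (r n) b); split; first by rewrite Cabs_mul r1; have := r2 n; have := Cabs_nonneg b; nra.
  have -> : P n (a :: u) -v Cmul (r n) b *v idB = Cmul (r n) b *v (hprod (map (fun a => s n *v a : Bop X) (a :: u)) -v idB).
    by rewrite PS E cmpZr cmpZl; cbn [map hprod]; vring.
  apply: qn_scal; apply: hprod_qn; elim: Hau => [|a' u' Ja _ IH]; first by [].
  by cbn [map]; constructor=> //; exact: JZ.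
apply: (@qn_limit X (fun n => P n v -v c n *v idB)); first by move=> n; exact: (proj2 (Hc n)).
  have := converges_sub Pconv (_ : converges (fun n => c n *v (idB : Bop X)) 0v).
  have -> : wd (rev v) -v 0v = wd (rev v) by vring.
  apply; move=> e e0; case: (rconv idB e e0) => N HN; exists N => n Hn.
  apply: Rle_lt_trans (HN n Hn).
  have E0 (z : Bop X) : z -v 0v = z by vring.
  rewrite !E0 !vnorm_scal r1; apply: Rmult_le_compat_r; [exact: vnorm_nonneg|exact: (proj1 (Hc n))].
have : Forall J (rev v) by exact: Forall_rev.
case E : (rev v) => [|a u] Hau; first by case: v0; rewrite -(rev_involutive v) E.
by rewrite wdS; apply: compact_cmp_r; apply: Jc; exact: (Forall_inv Hau).
Qed.
End Words.

(** * Vala's theorem on two-sided multiplications *)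

Lemma net (X : CBanach) (B : X -> Prop) e :
  (forall u : nat -> X, (forall n, B (u n)) -> exists i j, (i < j)%nat /\ <|u i -v u j|> < e) ->
  exists L, forall x, B x -> exists2 y, In y L & <|x -v y|> < e.
Proof.
move=> H; apply: NNPP => K.
case: (@greedy X (fun L a => B a /\ forall y, In y L -> e <= <|a -v y|>)).
  move=> L; apply: NNPP => K1; apply: K; exists L => x Bx; apply: NNPP => K2; apply: K1; exists x; split=> // y Hy.
  by apply: Rnot_lt_le => Hlt; apply: K2; exists y.
move=> f Hf; case: (H f) => [n|i [j [Hij]]]; first exact: (proj1 (Hf n)).
have := proj2 (Hf j) (f i) (In_flist f Hij); rewrite vnorm_sub_sym; lra.
Qed.

Lemma bop_ball (X : CBanach) (T : Bop X) M : 0 <= M -> (forall x, <|x|> <= 1 -> <|T x|> <= M) -> <|T|> <= M.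
Proof.
move=> M0 H; apply: bop_lub => // x.
case: (classic (x = 0v)) => [->|x0]; first by rewrite bop0 vnorm_0; lra.
have px := vnorm_pos x0; have pi := Rinv_0_lt_compat _ px.
have := H (RtoC (/ <|x|>) *v x); rewrite bopZ !vnorm_scal Cabs_RtoC Rabs_right; last lra.
rewrite Rinv_l; last lra. move=> /(_ (Rle_refl 1)) H1.
apply: (Rmult_le_reg_l (/ <|x|>)) => //; apply: Rle_trans H1 _; right; field; lra.
Qed.

(** A finite net of the image of the unit ball under [K] leaves finitely many vectors y. For these
    the K u_n y are made nearly constant along an infinite index set, one y at a time; the bound on
    the u_n extends the estimate from the net to the whole image. *)
Lemma lr_compact (X : CBanach) (K : Bop X) : compact_op K -> compact_op (lr K K).
Proof.
move=> HK; split; first exact: (bprf (lr K K)).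
move=> u [M HM]; suff : precomp (fun n => lr K K (u n)) by [].
have M0 : 0 <= M by apply: Rle_trans (HM 0%nat); exact: vnorm_nonneg.
have pK := vnorm_nonneg K.
apply: precompP => P HP e e0.
pose e1 := e / (8 * (<|K|> * M + 1)); have KM : 0 <= <|K|> * M by apply: Rmult_le_pos.
have e10 : 0 < e1 by apply: Rdiv_lt_0_compat; lra.
case: (@net X (fun y => exists2 x, <|x|> <= 1 & y = K x) e1).
  move=> v Hv; have [x Hx] : exists x : nat -> X, forall n, <|x n|> <= 1 /\ v n = K (x n).
    by apply: (@fchoice nat X (fun n x => <|x|> <= 1 /\ v n = K x)) => n; case: (Hv n) => x; exists x.
  have [i [j [Hij Hlt]]] := precomp_pair (compact_precomp HK (fun n => proj1 (Hx n))) e10.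
  by exists i, j; rewrite !(proj2 (Hx _)).
move=> L HL.
have [Q [HQ HQe]] : exists Q, infinite Q /\ (forall n, Q n -> P n) /\
    (forall i j, Q i -> Q j -> forall y, In y L -> <|K ((u i : Bop X) y) -v K ((u j : Bop X) y)|> < e / 4).
  elim: L {HL} => [|y L [Q [HQ [HQP HQe]]]]; first by exists P.
  case: (@close_refine X (fun n => K ((u n : Bop X) y)) Q (e / 4)) => //; last 2 first.
  - lra.
  - move=> Q' [H1 [H2 H3]]; exists Q'; split=> //; split; first by move=> n /H2 /HQP.
    by move=> i j Qi Qj z [<-|Hz]; [exact: H3|apply: HQe => //; exact: H2].
  - move=> P' HP' e' e0'; apply: (precomp_close _ HP' e0') => phi _ _.
    apply: (compact_precomp (M := M * <|y|>) HK) => n; apply: Rle_trans (bop_le _ _) _.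
    apply: Rmult_le_compat_r; [exact: vnorm_nonneg|exact: HM].
case: (HQ 0%nat) => i _ Qi; case: (HQ (S i)) => j Hij Qj.
exists i, j; split; first lia. split; first exact: (proj1 HQe). split; first exact: (proj1 HQe).
apply: Rle_lt_trans (_ : e / 2 < _); last lra.
have -> : lr K K (u i) -v lr K K (u j) = K ∘ (u i -v u j : Bop X) ∘ K.
  by rewrite !lr_app cmpDr cmpDl cmpNr cmpNl.
apply: bop_ball; first lra. move=> x Hx; rewrite !cmp_app.
case: (HL (K x)) => [|y Hy Hxy]; first by exists x.
have E : K ((u i -v u j : Bop X) (K x)) = (K ((u i : Bop X) y) -v K ((u j : Bop X) y)) +v K ((u i -v u j : Bop X) (K x -v y)).
  by autorewrite with bop; vring.
rewrite E; apply: Rle_trans (vnorm_triangle _ _) _.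
have h1 := proj2 HQe i j Qi Qj y Hy.
have h2 : <|(u i -v u j : Bop X) (K x -v y)|> <= (2 * M) * e1.
  apply: Rle_trans (bop_le _ _) _; apply: Rmult_le_compat; [exact: vnorm_nonneg|exact: vnorm_nonneg| |lra].
  apply: Rle_trans (vnorm_sub_le _ _) _; have := HM i; have := HM j; lra.
have h3 := bop_le K ((u i -v u j : Bop X) (K x -v y)).
have h4 := Rmult_le_compat_l _ _ _ pK h2.
have h5 : (<|K|> * M + 1) * e1 = e / 8 by rewrite /e1; field; lra.
nra.
Qed.

(** * Semigroups of quasinilpotent compact operators *)

Section Chains.
Variable X : CBanach.
Implicit Types (a b A S T K V Z u : Bop X).
Variable J : Bop X -> Prop.
Hypotheses (HI : irr J) (Jc : forall a, J a -> compact_op a) (JZ : forall c a, J a -> J (c *v a : Bop X)).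

Definition sg T := exists a w, J a /\ Forall J w /\ T = wd (a :: w).
(** Light operators fill the gaps between the factors [K] of a chain: [idB] allows empty gaps, and
    the norm bound makes the gaps cost nothing. *)
Definition light b := (b = idB \/ sg b) /\ <|b|> <= 1.

Lemma sg_cmp S T : sg S -> sg T -> sg (S ∘ T).
Proof.
move=> [a [w [Ja [Hw ->]]]] [b [v [Jb [Hv ->]]]]; exists a, (w ++ b :: v); split=> //.
by split; [apply/Forall_app; split=> //; constructor|rewrite -wd_cat].
Qed.

Lemma sg_light b T : light b -> sg T -> sg (b ∘ T).
Proof. by move=> [[->|Hb] _] HT; [rewrite cmp1l|exact: sg_cmp]. Qed.

Lemma sg_scal c T : sg T -> sg (c *v T : Bop X).
Proof.
move=> [a [w [Ja [Hw ->]]]]; exists (c *v a), w; split; first exact: JZ.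
by split=> //; rewrite !wdS cmpZl.
Qed.

Lemma sg_compact T : sg T -> compact_op T.
Proof. by move=> [a [w [Ja [_ ->]]]]; rewrite wdS; apply: compact_cmp_r; exact: Jc. Qed.

Lemma light1 : light idB.
Proof. split; [by left|exact: bnorm_id]. Qed.

(** Since J is closed under scalars, dividing by the norm plus 1 keeps a nonempty word in the
    semigroup. *)
Lemma word_light w : Forall J w -> exists (c : R) b, 0 < c /\ light b /\ wd w = RtoC c *v b.
Proof.
case: w => [|a w] Hw.
  exists 1, idB; split; first lra. split; first exact: light1.
  have -> : RtoC 1 = C1 by []. by rewrite vscal_1.
have q := vnorm_nonneg (wd (a :: w)); set T := wd (a :: w) in q *.
have p : 0 < <|T|> + 1 by lra.
exists (<|T|> + 1), (RtoC (/ (<|T|> + 1)) *v T); split=> //; split; last by rewrite scal_RtoC_one //; lra.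
have pi := Rinv_0_lt_compat _ p.
split.
  right; apply: sg_scal; exists a, w; split; first exact: (Forall_inv Hw).
  by split; first exact: (Forall_inv_tail Hw).
rewrite vnorm_scal Cabs_RtoC Rabs_right; last lra.
apply: (Rmult_le_reg_l (<|T|> + 1)) => //; rewrite -Rmult_assoc Rinv_r; lra.
Qed.

(** Products K b K b' ... K in which [K] occurs [n] times. *)
Inductive chain K : nat -> Bop X -> Prop :=
| chain1 : chain K 1 K
| chainS n b T : light b -> chain K n T -> chain K (S n) (K ∘ b ∘ T).

Lemma chain_pos K n T : chain K n T -> (1 <= n)%nat.
Proof. by case=> [|m b S _ _]; lia. Qed.

Lemma chain_sg K n T : sg K -> chain K n T -> sg T.
Proof. by move=> HK; elim=> [|m b S Hb _ IH] //; rewrite -cmpA; apply: sg_cmp => //; exact: sg_light. Qed.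

Lemma chain_cat K m n S T b : light b -> chain K m S -> chain K n T -> chain K (m + n) (S ∘ b ∘ T).
Proof.
move=> Hb HS HT; elim: HS => [|i c V Hc _ IH]; first exact: chainS.
have -> : K ∘ c ∘ V ∘ b ∘ T = K ∘ c ∘ (V ∘ b ∘ T) by rewrite !cmpA.
exact: chainS.
Qed.

(** All suffixes of one product are recorded together with their quotients, because the pigeonhole
    argument later compares suffixes of the same product. *)
Lemma chain_suffix K n T : chain K n T -> exists V : nat -> Bop X, V n = T /\
  (forall i, (1 <= i <= n)%nat -> chain K i (V i)) /\
  (forall i j, (1 <= i < j)%nat -> (j <= n)%nat -> exists Z b, chain K (j - i) Z /\ light b /\ V j = Z ∘ b ∘ V i).
Proof.
elim=> [|m b S Hb HS [V [Vm [V1 V2]]]].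
  exists (fun _ => K); split=> //; split; last by lia.
  by move=> i Hi; rewrite (_ : i = 1%nat); [exact: chain1|lia].
have m1 := chain_pos HS.
exists (fun i => match Nat.eq_dec i (Datatypes.S m) with left _ => K ∘ b ∘ S | right _ => V i end).
have E i : (i <= m)%nat -> (match Nat.eq_dec i (Datatypes.S m) with left _ => K ∘ b ∘ S | right _ => V i end) = V i.
  by move=> Hi; case: Nat.eq_dec => // ?; lia.
have E' : (match Nat.eq_dec (Datatypes.S m) (Datatypes.S m) with left _ => K ∘ b ∘ S | right _ => V (Datatypes.S m) end) = K ∘ b ∘ S.
  by case: Nat.eq_dec => // H; case: H.
split=> //; split.
  move=> i Hi; case: (Nat.eq_dec i (Datatypes.S m)) => Hi2; first by rewrite Hi2; exact: chainS.
  by apply: V1; lia.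
move=> i j Hi Hj; rewrite (E i); last by lia.
case: (Nat.eq_dec j (Datatypes.S m)) => Hj2; last by apply: V2; lia.
case: (Nat.eq_dec i m) => Him.
  by exists K, b; rewrite Him Vm Hj2 (_ : (Datatypes.S m - m)%nat = 1%nat); [split; [exact: chain1|]|lia].
case: (V2 i m) => [||Z [c [HZ [Hc EZ]]]]; [lia|lia|].
exists (K ∘ b ∘ Z), c; split; last by split=> //; rewrite -Vm EZ !cmpA.
by rewrite Hj2 (_ : (Datatypes.S m - i)%nat = Datatypes.S (m - i)); [exact: chainS|lia].
Qed.

Lemma chain_split K m n T : (1 <= m)%nat -> (1 <= n)%nat -> chain K (m + n) T ->
  exists S V b, chain K m S /\ chain K n V /\ light b /\ T = S ∘ b ∘ V.
Proof.
move=> Hm Hn /chain_suffix [V [<- [V1 V2]]].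
case: (V2 n (m + n)%nat) => [||Z [b [HZ [Hb ->]]]]; [lia|lia|].
exists Z, (V n), b; rewrite Nat.add_sub in HZ; split=> //.
by split; first by apply: V1; lia.
Qed.

(** Products with at least three factors have the form K u K, so bounded families of them are
    precompact through [lr_compact]. *)
Lemma chain_middle K n T : chain K (Datatypes.S (Datatypes.S (Datatypes.S n))) T ->
  exists u S, chain K (Datatypes.S n) S /\ T = K ∘ u ∘ K /\ <|u|> <= <|S|>.
Proof.
have -> : Datatypes.S (Datatypes.S (Datatypes.S n)) = ((1 + Datatypes.S n) + 1)%nat by lia.
case/chain_split; [lia|lia|] => Z [V [b [HZ [HV [Hb ->]]]]].
case/chain_split: HZ; [lia|lia|] => Z' [S [c [HZ' [HS [Hc ->]]]]].
have one A : chain K 1 A -> A = K.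
  by move=> HA; inversion HA as [|m b' T' _ HT']; subst => //; have := chain_pos HT'; lia.
rewrite (one _ HZ') (one _ HV); exists (c ∘ S ∘ b), S; split=> //; split; first by rewrite !cmpA.
have := bnorm_cmp (c ∘ S) b; have := bnorm_cmp c S; have := proj2 Hb; have := proj2 Hc.
have := vnorm_nonneg c; have := vnorm_nonneg b; have := vnorm_nonneg S; have := vnorm_nonneg (c ∘ S) => *; nra.
Qed.

Definition bnd K n (r : R) := forall T, chain K n T -> <|T|> <= r.

Lemma light_sandwich S b T : light b -> <|S ∘ b ∘ T|> <= <|S|> * <|T|>.
Proof.
move=> [_ Hb]; apply: Rle_trans (bnorm_cmp _ _) _; apply: Rmult_le_compat_r; first exact: vnorm_nonneg.
apply: Rle_trans (bnorm_cmp _ _) _; have := vnorm_nonneg S; have := vnorm_nonneg b; nra.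
Qed.

Lemma bnd_add K m n r s : (1 <= m)%nat -> (1 <= n)%nat -> bnd K m r -> bnd K n s -> bnd K (m + n) (r * s).
Proof.
move=> Hm Hn Hr Hs T /(chain_split Hm Hn) [S [V [b [HS [HV [Hb ->]]]]]].
apply: Rle_trans (light_sandwich _ _ Hb) _; apply: Rmult_le_compat; try exact: vnorm_nonneg.
  exact: Hr. exact: Hs.
Qed.

Lemma bnd_mul K n r k : (1 <= n)%nat -> bnd K n r -> bnd K (Datatypes.S k * n) (r ^ Datatypes.S k).
Proof.
move=> Hn Hr; elim: k => [|k IH]; first by rewrite Nat.mul_1_l pow_1.
have -> : (Datatypes.S (Datatypes.S k) * n = n + Datatypes.S k * n)%nat by lia.
have -> : r ^ Datatypes.S (Datatypes.S k) = r * r ^ Datatypes.S k by [].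
by apply: bnd_add => //; lia.
Qed.

(* Elements of the algebra generated by J, with a bound for their projective norm over the light operators. *)
Inductive alg : R -> Bop X -> Prop :=
| alg0 : alg 0 0v
| algD c b r A : light b -> alg r A -> alg (Cabs c + r) (c *v b +v A).

Lemma alg_add r s A B : alg r A -> alg s B -> alg (r + s) (A +v B).
Proof.
move=> HA HB; elim: HA => [|c b t T Hb _ IH]; first by rewrite Rplus_0_l vadd_0l.
by rewrite Rplus_assoc -vadd_assoc; apply: algD.
Qed.

Lemma alg_scal r c A : alg r A -> alg (Cabs c * r) (c *v A).
Proof.
elim=> [|d b t T Hb _ IH].
  have -> : c *v 0v = 0v :> Bop X by vring. rewrite Rmult_0_r; exact: alg0.
have -> : c *v (d *v b +v T) = Cmul c d *v b +v c *v T :> Bop X by vring.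
by rewrite Rmult_plus_distr_l -Cabs_mul; apply: algD.
Qed.

Lemma alg_mul a r A : J a -> alg r A -> exists s, alg s (a ∘ A).
Proof.
move=> Ja; elim=> [|d b t T [[->|Hb] _] _ [s IH]].
- by exists 0; rewrite cmp0r; exact: alg0.
- case: (@word_light [a]) => [|c [b' [c0 [Hb' E]]]]; first by constructor.
  rewrite wd1 in E; exists (Cabs (Cmul d (RtoC c)) + s).
  have -> : a ∘ (d *v idB +v T) = Cmul d (RtoC c) *v b' +v a ∘ T.
    by rewrite cmpDr cmpZr cmp1r {1}E; vring.
  exact: algD.
- case: Hb => [a' [w [Ja' [Hw ->]]]].
  case: (@word_light (a :: a' :: w)) => [|c [b' [c0 [Hb' E]]]]; first by do 2 constructor=> //.
  exists (Cabs (Cmul d (RtoC c)) + s).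
  have -> : a ∘ (d *v wd (a' :: w) +v T) = Cmul d (RtoC c) *v b' +v a ∘ T.
    by rewrite cmpDr cmpZr -wdS E; vring.
  exact: algD.
Qed.

(** The closure of the vectors A y is a closed invariant subspace containing y, hence everything by
    irreducibility. *)
Lemma alg_dense y x0 e : y <> 0v -> 0 < e -> exists r A, alg r A /\ <|A y -v x0|> < e.
Proof.
move=> y0 e0.
case: (@HI (fun z : X => forall e, 0 < e -> exists r A, alg r A /\ <|A y -v z|> < e)).
- split; first by move=> e1 e10; exists 0, 0v; split; [exact: alg0|rewrite bzero_app vadd_opp vnorm_0].
  split.
    move=> z1 z2 H1 H2 e1 e10; case: (H1 (e1 / 2)); first lra. move=> r [A [HA EA]].
    case: (H2 (e1 / 2)); first lra. move=> s [B [HB EB]]; exists (r + s), (A +v B); split; first exact: alg_add.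
    have -> : (A +v B : Bop X) y -v (z1 +v z2) = (A y -v z1) +v (B y -v z2) by rewrite badd_app; vring.
    apply: Rle_lt_trans (vnorm_triangle _ _) _; lra.
  split.
    move=> c z H1 e1 e10; have q := Cabs_nonneg c.
    case: (H1 (e1 / (Cabs c + 1))); first by apply: Rdiv_lt_0_compat; lra.
    move=> r [A [HA EA]]; exists (Cabs c * r), (c *v A); split; first exact: alg_scal.
    have -> : (c *v A : Bop X) y -v c *v z = c *v (A y -v z) by rewrite bscal_app; vring.
    rewrite vnorm_scal; have q2 := vnorm_nonneg (A y -v z).
    have : e1 = e1 / (Cabs c + 1) * (Cabs c + 1) by field; lra. nra.
  move=> u z Hu Hz e1 e10; case: (Hz (e1 / 2)); first lra. move=> n /(_ n (le_n _)) Hn.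
  case: (Hu n (e1 / 2)); first lra. move=> r [A [HA EA]]; exists r, A; split=> //.
  apply: Rle_lt_trans (vnorm_tri _ (u n) _) _; lra.
- move=> a z Ja H1 e1 e10; have q := vnorm_nonneg a.
  case: (H1 (e1 / (<|a|> + 1))); first by apply: Rdiv_lt_0_compat; lra.
  move=> r [A [HA EA]]; case: (alg_mul Ja HA) => s Hs; exists s, (a ∘ A); split=> //.
  have -> : (a ∘ A) y -v a z = a (A y -v z) by rewrite bopD bopN.
  apply: Rle_lt_trans (bop_le _ _) _; have q2 := vnorm_nonneg (A y -v z).
  have : e1 = e1 / (<|a|> + 1) * (<|a|> + 1) by field; lra. nra.
- move=> H; case: y0; apply: H => e1 e10; exists (Cabs C1 + 0), (C1 *v idB +v 0v); split.
    by apply: algD; [exact: light1|exact: alg0].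
  have -> : (C1 *v idB +v 0v : Bop X) y = y by autorewrite with bop; vring.
  by rewrite vadd_opp vnorm_0.
- by move=> H; apply: H.
Qed.

(* Hilden's argument: starting at x0, alternate K with algebra elements of bounded projective norm that
   bring K x back to a ball U around x0 on which K is bounded below. *)
Lemma hilden K : sg K -> K <> 0v -> exists c C : R, 0 < c /\ 0 < C /\
  forall n r, bnd K (Datatypes.S n) r -> c <= C ^ n * r.
Proof.
move=> HK K0; have Kc := sg_compact HK; have qK := vnorm_nonneg K.
have [x1 Hx1] : exists x, K x <> 0v.
  by apply: NNPP => H; apply: K0; apply: Bop_ext => x; apply: NNPP => Kx; apply: H; exists x.
have p1 := vnorm_pos Hx1.
(* Moving by at most 1 from [x0] changes the image under [K] by at most the norm of [K], so |K x| >=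
   1 on the unit ball around [x0]. *)
have [x0 Hx0] : exists x0, <|K|> + 1 <= <|K x0|>.
  exists (RtoC ((<|K|> + 1) / <|K x1|>) *v x1); rewrite bopZ vnorm_scal Cabs_RtoC Rabs_right.
    by right; field; lra.
  by apply: Rle_ge; apply: Rlt_le; apply: Rdiv_lt_0_compat; lra.
have low x : <|x -v x0|> <= 1 -> 1 <= <|K x|>.
  move=> Hx; have := bop_le K (x -v x0); rewrite bopD bopN.
  have := vnorm_rev (K x0) (K x); rewrite (vnorm_sub_sym (K x0)); nra.
(* The constant is uniform by compactness: if none worked, K x_n would tend along a subsequence to
   some y <> 0, and one fixed A with A y near [x0] would serve for almost all of its terms. *)
have [C [C0' HC]] : exists C : R, 0 < C /\ forall x, <|x -v x0|> <= 1 -> exists r A, alg r A /\ r <= C /\ <|A (K x) -v x0|> <= 1.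
  apply: NNPP => H.
  have [x Hx] : exists x : nat -> X, forall n, <|x n -v x0|> <= 1 /\ forall r A, alg r A -> r <= INR (Datatypes.S n) -> 1 < <|A (K (x n)) -v x0|>.
    apply: (@fchoice nat X (fun n x => <|x -v x0|> <= 1 /\ forall r A, alg r A -> r <= INR (Datatypes.S n) -> 1 < <|A (K x) -v x0|>)) => n.
    apply: NNPP => H2; apply: H; exists (INR (Datatypes.S n)); split; first exact: lt_0_INR (Nat.lt_0_succ n).
    move=> x Hx; apply: NNPP => H3; apply: H2; exists x; split=> // r A HA Hr; apply: Rnot_le_lt => Hle; apply: H3.
    by exists r, A.
  have Hxb n : <|x n|> <= <|x0|> + 1.
    have -> : x n = (x n -v x0) +v x0 by vring.
    have := vnorm_triangle (x n -v x0) x0; have := proj1 (Hx n); lra.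
  case: (compact_precomp Kc Hxb) => phi [y [Hphi Hy]].
  have y0 : y <> 0v.
    move=> E; have : 1 <= <|y|>; last by rewrite E vnorm_0; lra.
    by apply: (converges_norm_ge Hy); exists 0%nat => n _; apply: low; exact: (proj1 (Hx _)).
  case: (@alg_dense y x0 (/ 2) y0 ltac:(lra)) => r [A [HA EA]].
  case: (conv_bop A Hy (ltac:(lra) : 0 < / 2)) => N HN.
  have [m Hm] := INR_unbounded r.
  have := HN (max N m) ltac:(lia); set n := max N m.
  have : 1 < <|A (K (x (phi n))) -v x0|>.
    apply: (proj2 (Hx (phi n)) r) => //; apply: Rlt_le; apply: Rlt_le_trans Hm _; apply: le_INR.
    have := subseq_ge Hphi n; rewrite /n; lia.
  have := vnorm_tri (A (K (x (phi n)))) (A y) x0; lra.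
have [x [A [r [Ex0 Hx]]]] : exists (x : nat -> X) (A : nat -> Bop X) (r : nat -> R), x 0%nat = x0 /\
   forall n, <|x n -v x0|> <= 1 /\ alg (r n) (A n) /\ r n <= C /\ x (Datatypes.S n) = A n (K (x n)).
  have [f Hf] : exists f : X -> R * Bop X, forall x, <|x -v x0|> <= 1 ->
      alg (fst (f x)) (snd (f x)) /\ fst (f x) <= C /\ <|snd (f x) (K x) -v x0|> <= 1.
    apply: (@fchoice X (R * Bop X) (fun x f => <|x -v x0|> <= 1 -> alg (fst f) (snd f) /\ fst f <= C /\ <|snd f (K x) -v x0|> <= 1)) => x.
    case: (classic (<|x -v x0|> <= 1)) => Hx; last by exists (0, 0v).
    by case: (HC x Hx) => r [A H]; exists (r, A).
  pose x := fix x n := match n with O => x0 | Datatypes.S n => snd (f (x n)) (K (x n)) end.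
  exists x, (fun n => snd (f (x n))), (fun n => fst (f (x n))); split=> // n.
  have Hn : <|x n -v x0|> <= 1.
    elim: n => [|n IH]; first by rewrite /= vadd_opp vnorm_0; lra.
    by case: (Hf _ IH) => _ [_].
  by case: (Hf _ Hn) => H1 [H2 _].
(* Each return operator is a combination of light operators of total weight at most [C], so one more
   step lengthens the chain by one [K] at the cost of a factor [C]. *)
have key n : forall m T s, chain K m T -> bnd K (m + n) s -> <|T (x n)|> <= C ^ n * s * <|x0|>.
  elim: n => [|n IH] m T s HT Hs.
    rewrite Ex0 Nat.add_0_r /= in Hs *; apply: Rle_trans (bop_le _ _) _.
    rewrite Rmult_1_l; apply: Rmult_le_compat_r; [exact: vnorm_nonneg|exact: Hs].
  have [_ [HA [Hr ->]]] := Hx n.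
  have B b : light b -> <|T (b (K (x n)))|> <= C ^ n * s * <|x0|>.
    move=> Hb; have := IH (m + 1)%nat (T ∘ b ∘ K) s (chain_cat Hb HT (chain1 K)); rewrite !cmp_app; apply.
    by have -> : (m + 1 + n = m + Datatypes.S n)%nat by lia.
  have B0 : 0 <= C ^ n * s * <|x0|> by apply: Rle_trans (B idB light1); exact: vnorm_nonneg.
  have : <|T (A n (K (x n)))|> <= r n * (C ^ n * s * <|x0|>).
    elim: HA {Hr} => [|c b t A' Hb _ IH2]; first by rewrite bzero_app bop0 vnorm_0; lra.
    rewrite badd_app bscal_app bopD bopZ; apply: Rle_trans (vnorm_triangle _ _) _; rewrite vnorm_scal.
    have := Rmult_le_compat_l _ _ _ (Cabs_nonneg c) (B b Hb); lra.
  have := Rmult_le_compat_r _ _ _ B0 Hr; cbn [pow]; lra.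
have px0 : 0 < <|x0|>.
  apply: vnorm_pos => E; move: Hx0; rewrite E bop0 vnorm_0; lra.
exists (/ <|x0|>), C; split; first exact: Rinv_0_lt_compat. split=> // n s Hs.
have := key n 1%nat K s (chain1 K) Hs; have := low _ (proj1 (Hx n)) => h1 h2.
apply: (Rmult_le_reg_r <|x0|>) => //; rewrite Rinv_l; lra.
Qed.

Lemma chain_scal K c n T : c <> C0 -> chain K n T -> exists T', chain (c *v K) n T' /\ <|T'|> = Cabs c ^ n * <|T|>.
Proof.
move=> c0 HT; suff [d [H Hd]] : exists d, chain (c *v K) n (d *v T) /\ Cabs d = Cabs c ^ n.
  by exists (d *v T); rewrite vnorm_scal Hd.
elim: HT => [|m b V Hb _ [d [IH Hd]]]; first by exists c; rewrite pow_1; split=> //; exact: chain1.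
exists (Cmul c d); split; last by rewrite Cabs_mul Hd.
have -> : Cmul c d *v (K ∘ b ∘ V) = (c *v K) ∘ b ∘ (d *v V) by rewrite !cmpZl cmpZr vscal_assoc.
exact: chainS.
Qed.

Lemma bnd_scal K (t : R) n r : 0 < t -> bnd K n r <-> bnd (RtoC t *v K) n (t ^ n * r).
Proof.
move=> t0; have p : 0 < t ^ n by apply: pow_lt.
have tc : RtoC t <> C0 by apply: RtoC_neq0; lra.
have ti := Rinv_0_lt_compat _ t0; have tc' : RtoC (/ t) <> C0 by apply: RtoC_neq0; lra.
split=> H T HT.
  case: (chain_scal tc' HT) => T' [HT' E].
  rewrite vscal_assoc (_ : Cmul (RtoC (/ t)) (RtoC t) = C1) ?vscal_1 in HT'; last by apply: C_ext; cbn; field; lra.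
  have := H T' HT'; rewrite E Cabs_RtoC Rabs_right; last lra.
  move=> H1; have -> : <|T|> = t ^ n * ((/ t) ^ n * <|T|>) by rewrite pow_inv; field; lra.
  by apply: Rmult_le_compat_l => //; lra.
case: (chain_scal tc HT) => T' [HT' E]; have := H T' HT'; rewrite E Cabs_RtoC Rabs_right; last lra.
by move=> H1; apply: (Rmult_le_reg_l (t ^ n)).
Qed.

(* Division of K by the joint spectral radius of the products of elements K b, b light. *)
Lemma normalise K : sg K -> K <> 0v -> exists K', sg K' /\
  (forall n (a : R), (1 <= n)%nat -> a < 1 -> exists T, chain K' n T /\ a < <|T|>) /\
  (forall lam, 1 < lam -> exists n, (1 <= n)%nat /\ bnd K' n (lam ^ n)).
Proof.
move=> HK K0; have [c [C [c0 [C0' HC]]]] := hilden HK K0.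
(* The infimum [rho] of the good t is the joint spectral radius; [hilden] shows that it is at least
   1 / C, so dividing by it makes sense. *)
pose good t := 0 < t /\ exists n, (1 <= n)%nat /\ bnd K n (t ^ n).
have low t : good t -> / C <= t.
  move=> [t0 [n [Hn Hb]]]; apply: Rnot_lt_le => Hlt.
  have tC : 0 <= t * C < 1.
    split; first by apply: Rmult_le_pos; lra.
    by have := Rmult_lt_compat_r _ _ _ C0' Hlt; rewrite Rinv_l //; lra.
  case: (@pow_lt_small _ tC (c * C)); first by apply: Rmult_lt_0_compat.
  move=> N HN; have [k Ek] : exists k, (Datatypes.S N * n = Datatypes.S k)%nat by exists (Datatypes.S N * n - 1)%nat; lia.
  have := @bnd_mul K n _ N Hn Hb; rewrite -pow_mult (Nat.mul_comm n) Ek => /HC H1.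
  have := HN (Datatypes.S k) ltac:(nia); rewrite Rpow_mult_distr.
  have -> : t ^ Datatypes.S k * C ^ Datatypes.S k = (C ^ k * t ^ Datatypes.S k) * C by cbn [pow]; ring.
  move=> H2; have := Rmult_le_compat_r _ _ _ (Rlt_le _ _ C0') H1; lra.
have q := vnorm_nonneg K.
have g1 : good (<|K|> + 1).
  split; first lra. exists 1%nat; split=> // T HT.
  have -> : T = K by inversion HT as [|m b' T' _ HT']; subst => //; have := chain_pos HT'; lia.
  rewrite pow_1; lra.
have [rho [ub lu]] : exists rho, (forall t, good t -> rho <= t) /\ forall r, (forall t, good t -> r <= t) -> r <= rho.
  case: (completeness (fun s => good (- s))); last 1 first.
  - move=> m [Hm1 Hm2]; exists (- m); split=> [t Ht|r Hr].
      by have := Hm1 (- t); rewrite Ropp_involutive => /(_ Ht); lra.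
    have := Hm2 (- r) _; suff H : is_upper_bound (fun s => good (- s)) (- r) by move=> /(_ H); lra.
    move=> s /Hr; lra.
  - exists 0 => s [Hs _]; lra.
  - by exists (- (<|K|> + 1)); rewrite Ropp_involutive.
have r0 : 0 < rho by have := lu (/ C) low; have := Rinv_0_lt_compat _ C0'; lra.
have ri := Rinv_0_lt_compat _ r0.
exists (RtoC (/ rho) *v K); split; first exact: sg_scal.
have tr n : (/ rho) ^ n * rho ^ n = 1 by rewrite -Rpow_mult_distr Rinv_l ?pow1 //; lra.
split.
  move=> n r Hn Ha; apply: NNPP => H.
  have Hb : bnd (RtoC (/ rho) *v K) n r.
    by move=> T HT; apply: Rnot_lt_le => Hlt; apply: H; exists T.
  have p : 0 < rho ^ n by apply: pow_lt.
  have {}Hb : bnd K n (rho ^ n * r).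
    apply/(bnd_scal _ _ _ ri); have -> : (/ rho) ^ n * (rho ^ n * r) = r by rewrite -Rmult_assoc tr; lra.
    exact: Hb.
  case: (@pow_nbhd rho n (rho ^ n * r) r0); first nra.
  move=> t [Ht Hta]; have : good t; last by move/ub; lra.
  split; first lra. exists n; split=> // T /Hb; lra.
move=> lam Hlam.
have [t [Ht Htl]] : exists t, good t /\ t < lam * rho.
  apply: NNPP => H; have := lu (lam * rho) _; suff H2 : forall t, good t -> lam * rho <= t by move=> /(_ H2); nra.
  by move=> t Ht; apply: Rnot_lt_le => Hlt; apply: H; exists t.
case: Ht => t0 [n [Hn Hb]]; exists n; split=> // T HT.
have := proj1 (bnd_scal _ _ _ ri) Hb T HT; have : t ^ n <= (lam * rho) ^ n by apply: pow_incr; lra.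
rewrite Rpow_mult_distr => H1 H2; apply: Rle_trans H2 _.
have p : 0 < (/ rho) ^ n by apply: pow_lt.
have -> : lam ^ n = (/ rho) ^ n * (lam ^ n * rho ^ n) by rewrite (Rmult_comm (lam ^ n)) -Rmult_assoc tr; lra.
by apply: Rmult_le_compat_l; lra.
Qed.

Section Normalised.
Variable K : Bop X.
Hypotheses (HK : sg K) (H1 : forall n (a : R), (1 <= n)%nat -> a < 1 -> exists T, chain K n T /\ a < <|T|>).
Hypothesis (H2 : forall lam, 1 < lam -> exists n, (1 <= n)%nat /\ bnd K n (lam ^ n)).

Lemma chain_bound n : bnd K n (<|K|> ^ n).
Proof.
move=> T; elim=> [|m b S Hb _ IH]; first by rewrite pow_1; lra.
apply: Rle_trans (light_sandwich _ _ Hb) _; apply: Rmult_le_compat_l => //; exact: vnorm_nonneg.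
Qed.

Lemma growth_fun : exists g : nat -> R, (forall n, bnd K n (g n)) /\
  (forall n r, (1 <= n)%nat -> bnd K n r -> g n <= r) /\ forall n, (1 <= n)%nat -> 1 <= g n.
Proof.
(* The value 0 keeps the set nonempty when n = 0, where no chain exists; it does not change the
   supremum of norms. *)
have [g Hg] : exists g : nat -> R, forall n, is_lub (fun r => r = 0 \/ exists T, chain K n T /\ r = <|T|>) (g n).
  apply: (@fchoice nat R (fun n g => is_lub (fun r => r = 0 \/ exists T, chain K n T /\ r = <|T|>) g)) => n.
  case: (completeness (fun r => r = 0 \/ exists T, chain K n T /\ r = <|T|>)); last by move=> m; exists m.
    exists (<|K|> ^ n) => r [->|[T [HT ->]]]; last exact: chain_bound.
    by apply: pow_le; exact: vnorm_nonneg.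
  by exists 0; left.
have B n : bnd K n (g n) by move=> T HT; apply: (proj1 (Hg n)); right; exists T.
exists g; split=> //; split.
  move=> n r Hn Hr; apply: (proj2 (Hg n)) => _ [->|[T [HT ->]]]; last exact: Hr.
  case: (@H1 n 0 Hn); first lra. move=> T [/Hr HT]; lra.
move=> n Hn; apply: Rnot_lt_le => Hlt; case: (H1 Hn Hlt) => T [HT]; have := B n T HT; lra.
Qed.

(** Chains of some length N are bounded by mu^N; submultiplicativity strips blocks of that length,
    and the shorter lengths determine the constant. *)
Lemma growth_below (g : nat -> R) mu : (forall n, bnd K n (g n)) -> (forall n r, (1 <= n)%nat -> bnd K n r -> g n <= r) ->
  (forall n, (1 <= n)%nat -> 1 <= g n) -> 1 < mu -> exists M : R, forall n, (1 <= n)%nat -> g n <= M * mu ^ n.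
Proof.
move=> Hg Hl Hg1 Hmu; case: (H2 Hmu) => N [HN HbN].
have [M [M1 HM]] : exists M, 0 <= M /\ forall n, (1 <= n)%nat -> (n <= N)%nat -> g n <= M.
  elim: (N) => [|m [M [M0 IH]]]; first by exists 0; split; [lra|move=> n; lia].
  exists (Rmax M (g (Datatypes.S m))); split; first by apply: Rle_trans (Rmax_l _ _).
  move=> n Hn Hnm; case: (Nat.eq_dec n (Datatypes.S m)) => E; first by rewrite E; exact: Rmax_r.
  by apply: Rle_trans (Rmax_l _ _); apply: IH; lia.
exists M; elim/Wf_nat.lt_wf_ind => n IH Hn.
case: (Nat.le_gt_cases n N) => HnN.
  have : 1 <= mu ^ n by apply: pow_R1_Rle; lra.
  have := HM n Hn HnN; nra.
have := IH (n - N)%nat ltac:(lia) ltac:(lia) => h.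
have : g n <= g (n - N)%nat * mu ^ N.
  apply: Hl => //; have E : n = (n - N + N)%nat by lia.
  rewrite {1}E; apply: bnd_add => //; lia.
have p : 0 < mu ^ N by apply: pow_lt; lra.
have E : mu ^ n = mu ^ (n - N) * mu ^ N by rewrite -pow_add; congr (_ ^ _); lia.
rewrite E; nra.
Qed.

Lemma argmax (v : nat -> R) : 0 < v 1%nat -> (forall e, 0 < e -> exists N, forall n, (N <= n)%nat -> v n < e) ->
  exists k, (1 <= k)%nat /\ forall j, (1 <= j)%nat -> v j <= v k.
Proof.
move=> v1 Hv; case: (Hv _ v1) => N HN.
have [k [Hk Hkm]] : exists k, (1 <= k)%nat /\ forall j, (1 <= j <= S N)%nat -> v j <= v k.
  elim: (N) => [|m [k [Hk IH]]].
    by exists 1%nat; split=> // j Hj; rewrite (_ : j = 1%nat); [lra|lia].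
  case: (Rle_lt_dec (v (S (S m))) (v k)) => H.
    exists k; split=> // j Hj; case: (Nat.eq_dec j (S (S m))) => E; first by rewrite E.
    by apply: IH; lia.
  exists (S (S m)); split; first lia. move=> j Hj; case: (Nat.eq_dec j (S (S m))) => E; first by rewrite E; lra.
  apply: Rlt_le; apply: Rle_lt_trans H; apply: IH; lia.
exists k; split=> // j Hj; case: (Nat.le_gt_cases j (S N)) => HjN; first by apply: Hkm; lia.
apply: Rlt_le; apply: Rlt_le_trans (HN j ltac:(lia)) _; apply: Hkm; lia.
Qed.

Section Growth.
Variable g : nat -> R.
Hypotheses (Hg : forall n, bnd K n (g n)) (Hl : forall n r, (1 <= n)%nat -> bnd K n r -> g n <= r).
Hypothesis (Hg1 : forall n, (1 <= n)%nat -> 1 <= g n).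

Lemma growth_witness n (r : R) : (1 <= n)%nat -> r < g n -> exists T, chain K n T /\ r < <|T|>.
Proof.
move=> Hn Hr; apply: NNPP => H; have := Hl Hn (_ : bnd K n r); suff B : bnd K n r by move=> /(_ B); lra.
by move=> T HT; apply: Rnot_lt_le => Hlt; apply: H; exists T.
Qed.

(* T is a nearly norming product of length k, where k maximises g j / lam^j for some lam close to 1:
   then g (2 k) / g k ^ 2 is at most lam^k / g k, which is small because g is unbounded. *)
Lemma small_square (B : R) : (forall M, exists n, (1 <= n)%nat /\ M < g n) -> 0 < B ->
  exists T u, T = K ∘ u ∘ K /\ <|u|> <= 1 /\ / 2 <= <|T|> /\ forall b, light b -> <|T ∘ b ∘ T|> <= / B.
Proof.
move=> Hub B0; have h1 := Hg1 (le_n 1); have h2 := Hg1 (le_S _ _ (le_n 1)).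
(* Including g 1 and g 2 makes g k >= B' force k >= 3, as [chain_middle] requires. *)
pose B' := B + g 1%nat + g 2%nat.
case: (Hub (2 * B')) => n [Hn Hgn].
case: (@pow_nbhd_up 1 n 2); [lra|rewrite pow1; lra|] => d [d0 Hd].
pose lam := 1 + d / 2; have lam1 : 1 < lam by rewrite /lam; lra.
have Hlamn : lam ^ n < 2 by apply: Hd; rewrite /lam; lra.
have pl j : 0 < lam ^ j by apply: pow_lt; lra.
have pl1 j : 1 <= lam ^ j by apply: pow_R1_Rle; lra.
case: (@argmax (fun j => g j / lam ^ j)).
- by apply: Rdiv_lt_0_compat => //; lra.
- move=> e e0; case: (@growth_below g ((1 + lam) / 2) Hg Hl Hg1); first lra. move=> M HM.
  have M0 : 0 < M.
    have := HM 1%nat (le_n _); rewrite pow_1; nra.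
  case: (@pow_lt_small ((1 + lam) / 2 / lam) _ (e / M)).
  + split; first by apply: Rlt_le; apply: Rdiv_lt_0_compat; lra.
    by apply: (Rmult_lt_reg_r lam); [lra|rewrite /Rdiv Rmult_assoc Rinv_l; lra].
  + by apply: Rdiv_lt_0_compat.
  + move=> N HN; exists (Datatypes.S N) => j Hj.
    have := HN j ltac:(lia); have := HM j ltac:(lia) => q1 q2.
    apply: Rle_lt_trans (_ : M * ((1 + lam) / 2 / lam) ^ j < _).
      apply: (Rmult_le_reg_r (lam ^ j)) => //; rewrite /Rdiv Rmult_assoc Rinv_l; last by have := pl j; lra.
      rewrite Rmult_1_r Rmult_assoc -Rpow_mult_distr Rmult_assoc Rinv_l; last lra. by rewrite Rmult_1_r.
    have := Rmult_lt_compat_l _ _ _ M0 q2; have -> : M * (e / M) = e by field; lra. by [].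
move=> k [Hk Hmax].
have Emax j : (1 <= j)%nat -> g j * lam ^ k <= g k * lam ^ j.
  move=> Hj; have := Hmax j Hj => h.
  have := Rmult_le_compat_r (lam ^ j * lam ^ k) _ _ (Rlt_le _ _ (Rmult_lt_0_compat _ _ (pl j) (pl k))) h.
  have e1 := Rgt_not_eq _ _ (pl j); have e2 := Rgt_not_eq _ _ (pl k).
  have -> : g j / lam ^ j * (lam ^ j * lam ^ k) = g j * lam ^ k by field.
  by have -> : g k / lam ^ k * (lam ^ j * lam ^ k) = g k * lam ^ j by field.
(* Maximality at k is compared with the index n, where g n > 2 B' and lam^n < 2. *)
have Hc : B' * lam ^ k <= g k.
  have := Emax n Hn; have := pl k; have := pl n => q1 q2 q3.
  have : 2 * B' * lam ^ k <= g n * lam ^ k by apply: Rmult_le_compat_r; lra.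
  have := Hg1 Hk; nra.
have Bpos : 0 < B' by rewrite /B'; lra.
have gkB : B' <= g k by have := pl1 k; nra.
have [k' Ek] : exists k', k = Datatypes.S (Datatypes.S (Datatypes.S k')).
  case: k Hk gkB {Hmax Emax Hc} => [|[|[|k]]] Hk; [lia| | |by exists k]; rewrite /B'; lra.
have gk0 : 0 < g k by lra. have gi := Rinv_0_lt_compat _ gk0.
case: (@growth_witness k (g k / 2) Hk); first lra. move=> T [HT HTn].
move: (HT); rewrite Ek => /chain_middle [u [S' [HS' [ET Hu]]]].
have Hu1 : <|u|> <= g k.
  apply: Rle_trans Hu _; apply: Rle_trans (Hg HS') _.
  have := Emax (Datatypes.S k') ltac:(lia) => h; apply: (Rmult_le_reg_r (lam ^ k)) => //.
  apply: Rle_trans h _; apply: Rmult_le_compat_l; first lra. apply: Rle_pow; [lra|lia].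
exists (RtoC (/ g k) *v T), (RtoC (/ g k) *v u); split; first by rewrite ET cmpZr cmpZl.
rewrite !vnorm_scal Cabs_RtoC Rabs_right; last lra.
split; first by apply: (Rmult_le_reg_l (g k)) => //; rewrite -Rmult_assoc Rinv_r; lra.
split; first by apply: (Rmult_le_reg_l (g k)) => //; rewrite -Rmult_assoc Rinv_r; lra.
move=> b Hb; rewrite !cmpZl cmpZr vscal_assoc vnorm_scal Cabs_mul Cabs_RtoC Rabs_right; last lra.
have HTT := Hg (chain_cat Hb HT HT).
have := Emax (k + k)%nat ltac:(lia); rewrite pow_add => h.
have {}h : g (k + k)%nat <= g k * lam ^ k by apply: (Rmult_le_reg_r (lam ^ k)) => //; lra.
have h3 : B * lam ^ k <= g k by apply: Rle_trans Hc; apply: Rmult_le_compat_r; [have := pl k; lra|rewrite /B'; lra].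
have h4 : <|T ∘ b ∘ T|> * B <= g k * g k.
  apply: Rle_trans (_ : g k * lam ^ k * B <= _); first by apply: Rmult_le_compat_r; lra.
  by rewrite Rmult_assoc; apply: Rmult_le_compat_l; lra.
apply: (Rmult_le_reg_r B) => //; rewrite Rinv_l; last lra.
apply: (Rmult_le_reg_l (g k * g k)); first exact: Rmult_lt_0_compat.
have -> : g k * g k * (/ g k * / g k * <|T ∘ b ∘ T|> * B) = <|T ∘ b ∘ T|> * B by field; lra.
lra.
Qed.

Lemma K_compact : compact_op (lr K K).
Proof. by apply: lr_compact; exact: sg_compact. Qed.

Lemma growth_not_unbounded : ~ (forall M, exists n, (1 <= n)%nat /\ M < g n).
Proof.
move=> Hub.
have [f Hf] : exists f : nat -> Bop X * Bop X, forall n, fst (f n) = K ∘ snd (f n) ∘ K /\ <|snd (f n)|> <= 1 /\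
    / 2 <= <|fst (f n)|> /\ forall b, light b -> <|fst (f n) ∘ b ∘ fst (f n)|> <= / INR (Datatypes.S n).
  apply: (@fchoice nat (Bop X * Bop X) (fun n f => fst f = K ∘ snd f ∘ K /\ <|snd f|> <= 1 /\
    / 2 <= <|fst f|> /\ forall b, light b -> <|fst f ∘ b ∘ fst f|> <= / INR (Datatypes.S n))) => n.
  by case: (small_square Hub (lt_0_INR _ (Nat.lt_0_succ n))) => T [u H]; exists (T, u).
case: (compact_precomp K_compact (fun n => proj1 (proj2 (Hf n)))) => phi [T [Hphi HT]].
have {}HT : converges (fun n => fst (f (phi n)) : opB X) T.
  move=> e e0; case: (HT e e0) => N HN; exists N => n Hn; rewrite (proj1 (Hf _)); exact: HN.
have T0 : / 2 <= <|T|>.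
  by apply: (converges_norm_ge HT); exists 0%nat => n _; exact: (proj1 (proj2 (proj2 (Hf _)))).
have TbT b : light b -> T ∘ b ∘ T = 0v.
  move=> Hb; apply: vnorm_small => e e0.
  apply: (@converges_norm_le (opB X) (fun n => fst (f (phi n)) ∘ b ∘ fst (f (phi n)))).
    by apply: conv_cmp => //; apply: conv_cmp => //; exact: converges_const.
  have [[|N] [HN N0]] := archimed_cor1 e e0; first by lia.
  exists N => n Hn; apply: Rle_trans (proj2 (proj2 (proj2 (Hf _))) b Hb) _.
  apply: Rlt_le; apply: Rle_lt_trans HN; apply: Rinv_le_contravar; first exact: lt_0_INR (Nat.lt_0_succ N).
  by apply: le_INR; have := subseq_ge Hphi n; lia.
case: (@irr_prime X J T T HI) => [w Hw||]; last 2 first.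
- by move=> E; move: T0; rewrite E vnorm_0; lra.
- by move=> E; move: T0; rewrite E vnorm_0; lra.
case: (word_light Hw) => c [b [c0 [Hb ->]]].
by rewrite cmpZr cmpZl TbT //; vring.
Qed.

Lemma pigeonhole (A : Type) (L : list A) (f : nat -> A) : (forall i, (i <= length L)%nat -> In (f i) L) ->
  exists i j, (i < j)%nat /\ (j <= length L)%nat /\ f i = f j.
Proof.
move=> H; apply: NNPP => K'.
have nd : NoDup (map f (seq 0 (Datatypes.S (length L)))).
  apply: NoDup_map_NoDup_ForallPairs; last exact: seq_NoDup.
  move=> i j /in_seq Hi /in_seq Hj Ef; apply: NNPP => Hij; apply: K'.
  case: (Nat.lt_total i j) => [Hlt|[//|Hlt]]; [exists i, j|exists j, i]; split=> //; split=> //; lia.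
have := NoDup_incl_length nd (_ : incl _ L); rewrite length_map length_seq => K2.
suff : incl (map f (seq 0 (Datatypes.S (length L)))) L by move=> /K2; lia.
move=> a /in_map_iff [i [<- /in_seq Hi]]; apply: H; lia.
Qed.

Section Bounded.
Variable M : R.
Hypotheses (M1 : 1 <= M) (HM : forall n, (1 <= n)%nat -> g n <= M).

Lemma chain_form n T : (3 <= n)%nat -> chain K n T -> exists u, T = K ∘ u ∘ K /\ <|u|> <= M.
Proof.
case: n => [|[|[|n]]] Hn; [lia|lia|lia|] => /chain_middle [u [S [HS [E Hu]]]].
exists u; split=> //; apply: Rle_trans Hu _; apply: Rle_trans (Hg HS) _; apply: HM; lia.
Qed.

(* Among the suffixes of a long product, two are close by compactness. *)
Lemma almost_fixed e : 0 < e -> exists V Z b, (exists u, V = K ∘ u ∘ K /\ <|u|> <= M) /\ (exists u, Z = K ∘ u ∘ K /\ <|u|> <= M) /\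
  sg V /\ <|Z|> <= M /\ light b /\ / (2 * M) <= <|V|> /\ <|Z ∘ b ∘ V -v V|> < e.
Proof.
move=> e0; case: (@net (opB X) (fun T => exists u, T = K ∘ u ∘ K /\ <|u|> <= M) (e / 2)).
  move=> v Hv; have [u Hu] : exists u : nat -> opB X, forall n, v n = lr K K (u n) /\ <|u n|> <= M.
    by apply: (@fchoice nat (opB X) (fun n u => v n = lr K K u /\ <|u|> <= M)) => n; case: (Hv n) => u; exists u.
  have [i [j [Hij Hlt]]] := precomp_pair (compact_precomp K_compact (fun n => proj2 (Hu n))) (ltac:(lra) : 0 < e / 2).
  by exists i, j; split=> //; rewrite !(proj1 (Hu _)).
(* The suffixes compared have 3, 6, 9, ... factors: there is one more of them than points of the
   net, and both a suffix and the quotient of two of them have the three factors needed for the form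
   K u K. *)
move=> L HL; pose n := (3 * Datatypes.S (length L))%nat.
case: (@H1 n (/ 2)); [rewrite /n; lia|lra|] => T [/chain_suffix [V [VT [V1 V2]]] HT].
pose V' s := V (3 * Datatypes.S s)%nat.
have HV s : (s <= length L)%nat -> chain K (3 * Datatypes.S s) (V' s) by move=> Hs; apply: V1; rewrite /n; lia.
have HVf s : (s <= length L)%nat -> exists u, V' s = K ∘ u ∘ K /\ <|u|> <= M.
  by move=> Hs; apply: (chain_form _ (HV s Hs)); lia.
have [f Hf] : exists f : nat -> opB X, forall s, (s <= length L)%nat -> In (f s) L /\ <|(V' s : opB X) -v f s|> < e / 2.
  apply: (@fchoice nat (opB X) (fun s y => (s <= length L)%nat -> In y L /\ <|(V' s : opB X) -v y|> < e / 2)) => s.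
  case: (Nat.le_gt_cases s (length L)) => Hs; last by exists 0v; lia.
  by case: (HL (V' s) (HVf s Hs)) => y Hy Hlt; exists y.
case: (@pigeonhole _ L f (fun s Hs => proj1 (Hf s Hs))) => i [j [Hij [Hj Ef]]].
have Hi : (i <= length L)%nat by lia.
case: (V2 (3 * Datatypes.S i)%nat (3 * Datatypes.S j)%nat) => [||Z [b [HZ [Hb EV]]]]; [lia|rewrite /n; lia|].
exists (V' i), Z, b; split; first exact: HVf.
split; first by apply: (chain_form _ HZ); lia.
split; first exact: (chain_sg HK (HV i Hi)).
have ZM A m : (1 <= m)%nat -> chain K m A -> <|A|> <= M by move=> Hm HA; apply: Rle_trans (Hg HA) (HM Hm).
split; first by apply: ZM HZ; lia.
split=> //; split.
  (* The whole product has norm above 1/2 and the part in front of the suffix norm at most M, which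
     leaves at least 1/(2 M) for the suffix. *)
  case: (V2 (3 * Datatypes.S i)%nat n) => [||Z' [b' [HZ' [Hb' E']]]]; [lia|rewrite /n; lia|].
  move: HT; rewrite -VT E' -/(V' i) => HT.
  have h := light_sandwich Z' (V' i) Hb'; have h2 := ZM _ _ (chain_pos HZ') HZ'; have h3 := vnorm_nonneg (V' i).
  apply: (Rmult_le_reg_l (2 * M)); first lra. rewrite Rinv_r; nra.
rewrite /V' -EV; apply: Rle_lt_trans (vnorm_tri _ (f j) _) _.
have := proj2 (Hf j Hj); have := proj2 (Hf i Hi); rewrite (vnorm_sub_sym (f j)) Ef; rewrite /V'; lra.
Qed.

(* In the limit Z b U is arbitrarily close to U for a fixed compact Z and variable light b, so that
   the unit ball of the range of U lies in the closure of the image under Z of the unit ball. *)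
Lemma finite_rank_limit : exists (V : nat -> Bop X) U, (forall n, sg (V n)) /\ converges V U /\ U <> 0v /\ finrank U.
Proof.
have [f Hf] : exists f : nat -> Bop X * Bop X * Bop X, forall n, let: (V, Z, b) := f n in
    (exists u, V = K ∘ u ∘ K /\ <|u|> <= M) /\ (exists u, Z = K ∘ u ∘ K /\ <|u|> <= M) /\
    sg V /\ <|Z|> <= M /\ light b /\ / (2 * M) <= <|V|> /\ <|Z ∘ b ∘ V -v V|> < / INR (Datatypes.S n).
  apply: (@fchoice nat (Bop X * Bop X * Bop X) (fun n f => let: (V, Z, b) := f in
    (exists u, V = K ∘ u ∘ K /\ <|u|> <= M) /\ (exists u, Z = K ∘ u ∘ K /\ <|u|> <= M) /\
    sg V /\ <|Z|> <= M /\ light b /\ / (2 * M) <= <|V|> /\ <|Z ∘ b ∘ V -v V|> < / INR (Datatypes.S n))) => n.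
  case: (@almost_fixed (/ INR (Datatypes.S n))); first by apply: Rinv_0_lt_compat; exact: lt_0_INR (Nat.lt_0_succ n).
  by move=> V [Z [b H]]; exists (V, Z, b).
pose V n := fst (fst (f n)); pose Z n := snd (fst (f n)); pose b n := snd (f n).
have {}Hf n : (exists u, V n = K ∘ u ∘ K /\ <|u|> <= M) /\ (exists u, Z n = K ∘ u ∘ K /\ <|u|> <= M) /\
    sg (V n) /\ <|Z n|> <= M /\ light (b n) /\ / (2 * M) <= <|V n|> /\ <|Z n ∘ b n ∘ V n -v V n|> < / INR (Datatypes.S n).
  by have := Hf n; rewrite /V /Z /b; case: (f n) => [[V0 Z0] b0].
have [u Hu] : exists u : nat -> opB X, forall n, V n = K ∘ u n ∘ K /\ <|u n|> <= M.
  by apply: (@fchoice nat (opB X) (fun n u => V n = K ∘ u ∘ K /\ <|u|> <= M)) => n; exact: (proj1 (Hf n)).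
have [z Hz] : exists z : nat -> opB X, forall n, Z n = K ∘ z n ∘ K /\ <|z n|> <= M.
  by apply: (@fchoice nat (opB X) (fun n u => Z n = K ∘ u ∘ K /\ <|u|> <= M)) => n; exact: (proj1 (proj2 (Hf n))).
case: (compact_precomp K_compact (fun n => proj2 (Hu n))) => phi [U [Hphi HU]].
case: (compact_precomp K_compact (fun n => proj2 (Hz (phi n)))) => psi [Z0 [Hpsi HZ]].
pose p n := phi (psi n).
have Hp : incr p by move=> n; apply: (subseq_mono Hphi); exact: Hpsi.
have {}HU : converges (fun n => V (p n) : opB X) U.
  move=> e e0; case: (converges_subseq Hpsi HU e0) => N HN; exists N => n Hn.
  by rewrite (proj1 (Hu _)); exact: HN.
have {}HZ : converges (fun n => Z (p n) : opB X) Z0.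
  move=> e e0; case: (HZ e e0) => N HN; exists N => n Hn; rewrite (proj1 (Hz _)); exact: HN.
have Zc : compact_op Z0.
  apply: (compact_limit _ HZ) => n; rewrite (proj1 (Hz _)); apply: compact_cmp_l; exact: sg_compact.
(* The light operators need not converge, so [c] depends on e; only [Z] and [V] are replaced by
   their limits. *)
have fix_ e : 0 < e -> exists c, light c /\ <|Z0 ∘ c ∘ U -v U|> < e.
  move=> e0; have qU := vnorm_nonneg U.
  case: (HU (e / (4 * (M + 1)))); first by apply: Rdiv_lt_0_compat; lra. move=> N1 HN1.
  case: (HZ (e / (4 * (<|U|> + 1)))); first by apply: Rdiv_lt_0_compat; lra. move=> N2 HN2.
  have [[|N3] [HN3 N0]] := archimed_cor1 (e / 4) ltac:(lra); first by lia.
  pose n := max N1 (max N2 N3); have := HN1 n ltac:(lia); have := HN2 n ltac:(lia) => h2 h1.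
  have [_ [_ [_ [ZM [Hb [_ h3]]]]]] := Hf (p n).
  have h4 : / INR (Datatypes.S (p n)) <= / INR (Datatypes.S N3).
    apply: Rinv_le_contravar; first exact: lt_0_INR (Nat.lt_0_succ N3).
    by apply: le_INR; have := subseq_ge Hp n; lia.
  exists (b (p n)); split=> //.
  have E : Z0 ∘ b (p n) ∘ U -v U = (((Z0 -v Z (p n)) ∘ b (p n) ∘ U +v Z (p n) ∘ b (p n) ∘ (U -v V (p n)))
     +v (Z (p n) ∘ b (p n) ∘ V (p n) -v V (p n))) +v (V (p n) -v U).
    by rewrite !(cmpDl, cmpNl, cmpDr, cmpNr); vring.
  rewrite E; have t1 := light_sandwich (Z0 -v Z (p n)) U Hb; have t2 := light_sandwich (Z (p n)) (U -v V (p n)) Hb.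
  rewrite (vnorm_sub_sym Z0) in t1; rewrite (vnorm_sub_sym U) in t2.
  have q1 := vnorm_nonneg (Z (p n) -v Z0); have q2 := vnorm_nonneg (V (p n) -v U).
  have e1 : e / (4 * (M + 1)) * (M + 1) = e / 4 by field; lra.
  have e2 : e / (4 * (<|U|> + 1)) * (<|U|> + 1) = e / 4 by field; lra.
  have b1 : <|(Z0 -v Z (p n)) ∘ b (p n) ∘ U|> < e / 4 by nra.
  have b3 : <|V (p n) -v U|> <= e / (4 * (M + 1)) by lra.
  have b4 : <|Z (p n) ∘ b (p n) ∘ (U -v V (p n))|> + <|V (p n) -v U|> <= e / 4 by nra.
  apply: Rle_lt_trans (vnorm_triangle _ _) _.
  have := vnorm_triangle ((Z0 -v Z (p n)) ∘ b (p n) ∘ U +v Z (p n) ∘ b (p n) ∘ (U -v V (p n))) (Z (p n) ∘ b (p n) ∘ V (p n) -v V (p n)).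
  have := vnorm_triangle ((Z0 -v Z (p n)) ∘ b (p n) ∘ U) (Z (p n) ∘ b (p n) ∘ (U -v V (p n))).
  lra.
exists (fun n => V (p n)), U; split; first by move=> n; exact: (proj1 (proj2 (proj2 (Hf _)))).
split=> //; split.
  move=> E; have : / (2 * M) <= <|U|>.
    by apply: (converges_norm_ge HU); exists 0%nat => n _; exact: (proj1 (proj2 (proj2 (proj2 (proj2 (proj2 (Hf _))))))).
  rewrite E vnorm_0; have := Rinv_0_lt_compat (2 * M) ltac:(lra); lra.
case: (@fd_of_pairs X (fun y => exists x, y = U x)).
- split; first by exists 0v; rewrite bop0.
  split; first by move=> _ _ [x ->] [y ->]; exists (x +v y); rewrite bopD.
  by move=> c _ [x ->]; exists (c *v x); rewrite bopZ.
- move=> y Hy.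
  have [c Hc] : exists c : nat -> Bop X, forall n, light (c n) /\ <|Z0 (c n (y n)) -v y n|> < / 8.
    apply: (@fchoice nat (Bop X) (fun n c => light c /\ <|Z0 (c (y n)) -v y n|> < / 8)) => n.
    case: (Hy n) => -[x Ex] _; have q := vnorm_nonneg x.
    case: (fix_ (/ (8 * (<|x|> + 1)))); first by apply: Rinv_0_lt_compat; lra.
    move=> c [Hc HcU]; exists c; split=> //.
    have := bop_le (Z0 ∘ c ∘ U -v U) x; rewrite badd_app bopp_app !cmp_app -Ex => h.
    have : / (8 * (<|x|> + 1)) * (<|x|> + 1) = / 8 by field; lra.
    have := vnorm_nonneg (Z0 ∘ c ∘ U -v U); nra.
  have cb n : <|c n (y n)|> <= 1.
    apply: Rle_trans (bop_le _ _) _; have := proj2 (proj1 (Hc n)); have := proj2 (Hy n).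
    have := vnorm_nonneg (c n); have := vnorm_nonneg (y n); nra.
  have [i [j [Hij Hlt]]] := precomp_pair (compact_precomp Zc cb) (ltac:(lra) : 0 < / 8).
  exists i, j; split=> //.
  have hi := proj2 (Hc i); have hj := proj2 (Hc j); rewrite vnorm_sub_sym in hi.
  apply: Rle_lt_trans (vnorm_tri _ (Z0 (c i (y i))) _) _.
  have := vnorm_tri (Z0 (c i (y i))) (Z0 (c j (y j))) (y j); lra.
- by move=> l [_ Hl']; exists l => x; apply: Hl'; exists x.
Qed.
End Bounded.
End Growth.

Lemma finite_rank_in_closure : exists (V : nat -> Bop X) U, (forall n, sg (V n)) /\ converges V U /\ U <> 0v /\ finrank U.
Proof.
have [g [Hg [Hl Hg1]]] := growth_fun.
case: (classic (forall M, exists n, (1 <= n)%nat /\ M < g n)) => [H|H].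
  by case: (growth_not_unbounded Hg Hl Hg1 H).
have [M HM] : exists M, forall n, (1 <= n)%nat -> g n <= M.
  apply: NNPP => H3; apply: H => M; apply: NNPP => H4; apply: H3; exists M => n Hn.
  by apply: Rnot_lt_le => Hlt; apply: H4; exists n.
apply: (finite_rank_limit Hg _ HM); exact: Rle_trans (Hg1 _ (le_n 1)) (HM _ (le_n 1)).
Qed.
End Normalised.

Hypothesis HQ : forall w, Forall J w -> w <> [] -> qn (wd w).

Lemma turovskii a : J a -> a = 0v.
Proof.
move=> Ja; apply: NNPP => a0.
have Ha : sg a by exists a, []; split=> //; split=> //; rewrite wd1.
case: (normalise Ha a0) => K [HK [H1 H2]].
have sq T : sg T -> qn T by move=> [b [w [Jb [Hw ->]]]]; apply: HQ => //; constructor.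
pose cl U := exists V : nat -> Bop X, (forall n, sg (V n)) /\ converges V U.
pose P n := exists l U, length l = n /\ cl U /\ U <> 0v /\ forall x, span l (U x).
have [n [[l [U [Ln [[V [HV HVU]] [U0 HlU]]]]] Hmin]] : exists n, P n /\ forall n', P n' -> (n <= n')%nat.
  case: (finite_rank_in_closure HK H1 H2) => V [U [HV [HU [U0 [l Hl]]]]].
  have : P (length l) by exists l, U; split=> //; split; [exists V|].
  elim/Wf_nat.lt_wf_ind: (length l) => n IH Pn.
  case: (classic (exists n', P n' /\ (n' < n)%nat)) => [[n' [Pn' Hn']]|H3]; first exact: (IH n').
  exists n; split=> // n' Pn'; case: (Nat.le_gt_cases n n') => // Hlt; case: H3; by exists n'.
(* U w U is again in the closure of the semigroup, so minimality of the rank forces it to have the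
   whole range of U. *)
have [w [Hw Uw]] : exists w, Forall J w /\ U ∘ wd w ∘ U <> 0v.
  apply: NNPP => H3; case: (@irr_prime X J U U HI) => // w Hw; apply: NNPP => H4; apply: H3; by exists w.
have sw T : sg T -> sg (T ∘ wd w).
  move=> HT; case: w Hw {Uw} => [|b w] Hw; first by rewrite cmp1r.
  by apply: sg_cmp => //; exists b, w; split; [exact: (Forall_inv Hw)|split; [exact: (Forall_inv_tail Hw)|]].
have cU : converges (fun n => V n ∘ wd w : opB X) (U ∘ wd w).
  by apply: conv_cmp => //; exact: converges_const.
have range x : exists y, U x = U (wd w (U y)).
  pose R y := exists x, y = U (wd w (U x)).
  have RS : subsp R.
    split; first by exists 0v; rewrite !bop0.
    split; first by move=> _ _ [y ->] [z ->]; exists (y +v z); rewrite !bopD.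
    by move=> c _ [y ->]; exists (c *v y); rewrite !bopZ.
  case: (subspan RS (l := l)); first by move=> _ [y ->]; exact: HlU.
    by move=> /(_ (U x)); apply; exact: HlU.
  move=> [l' [L1 [L2 _]]]; exfalso.
  have : P (length l').
    exists l', (U ∘ wd w ∘ U); split=> //; split.
      exists (fun n => V n ∘ wd w ∘ V n); split; first by move=> m; apply: sg_cmp => //; exact: sw.
      exact: conv_cmp.
    by split=> // y; apply: L2; exists y.
  move=> /Hmin; lia.
(* U w need not belong to the semigroup; it is quasinilpotent as a compact limit of the
   quasinilpotent V n w. *)
have Tq : qn (U ∘ wd w).
  apply: (qn_limit _ cU) => [m|]; first by apply: sq; exact: sw.
  by apply: (compact_limit _ cU) => m; apply: sg_compact; exact: sw.
case: (qn_nilpotent (span_subsp l) (fun y Hy => Hy) _ (qn_gz Tq)); first by move=> x _; rewrite cmp_app; exact: HlU.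
move=> m Hm; apply: U0; apply: Bop_ext => x; rewrite bzero_app.
have it j y : exists z, U y = pw (U ∘ wd w) j (U z).
  elim: j y => [|j IH] y; first by exists y.
  case: (range y) => z Ez; case: (IH z) => t Et.
  by exists t; rewrite Ez pw_app -Et cmp_app.
by case: (it m x) => z ->; apply: Hm; exact: HlU.
Qed.
End Chains.

(** * The norm closure of the ideal and the conclusion *)

Section Closure.
Variable X : CBanach.
Variable I : Bop X -> Prop.

Definition closure (T : opB X) := forall e, 0 < e -> exists b : opB X, I b /\ <|b -v T|> < e.

Lemma closure_in (b : Bop X) : I b -> closure b.
Proof. by move=> Ib e e0; exists b; rewrite vadd_opp vnorm_0. Qed.

Lemma closure_seq T : closure T -> exists u : nat -> opB X, (forall n, I (u n)) /\ converges u T.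
Proof.
move=> H; have [u Hu] : exists u : nat -> opB X, forall n, I (u n) /\ <|u n -v T|> < / INR (S n).
  apply: (@fchoice nat (opB X) (fun n b => I b /\ <|b -v T|> < / INR (S n))) => n.
  by apply: H; apply: Rinv_0_lt_compat; exact: lt_0_INR (Nat.lt_0_succ n).
exists u; split; first by move=> n; exact: (proj1 (Hu n)).
move=> e e0; have [[|N] [HN N0]] := archimed_cor1 e e0; first by lia.
exists N => n Hn; apply: Rlt_trans (proj2 (Hu n)) _; apply: Rle_lt_trans HN.
by apply: Rinv_le_contravar; [exact: lt_0_INR (Nat.lt_0_succ N)|apply: le_INR; lia].
Qed.

Lemma closure_lim (u : nat -> opB X) T : (forall n, closure (u n)) -> converges u T -> closure T.
Proof.
move=> Hu HT e e0; case: (HT (e / 2)); first lra. move=> N /(_ N (le_n _)) HN.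
case: (Hu N (e / 2)); first lra. move=> b [Ib Hb]; exists b; split=> //.
apply: Rle_lt_trans (vnorm_tri _ (u N) _) _; lra.
Qed.

Lemma closure_closed : subsp (I : opB X -> Prop) -> closed_subspace closure.
Proof.
move=> [I0 [Ia Is]]; split; first exact: closure_in.
split.
  move=> S T /closure_seq [u [Iu Hu]] /closure_seq [v [Iv Hv]].
  by apply: (@closure_lim (fun n => u n +v v n)) => [n|]; [apply: closure_in; exact: Ia|exact: converges_add].
split; last by move=> u T; exact: closure_lim.
move=> c T /closure_seq [u [Iu Hu]].
by apply: (@closure_lim (fun n => c *v u n)) => [n|]; [apply: closure_in; exact: Is|exact: converges_scal].
Qed.

(** The first factor enters as a limit from [H], so one statement covers both a fixed element of J
    and a limit of elements of the ideal. *)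
Lemma closure_jp (H : Bop X -> Prop) : (forall a b, H a -> I b -> I (jp a b)) ->
  forall (u : nat -> opB X) (A : opB X) T, (forall n, H (u n)) -> converges u A -> closure T -> closure (jp A T).
Proof.
move=> HI u A T Hu HA /closure_seq [v [Iv Hv]].
apply: (@closure_lim (fun n => jp (u n) (v n))) => [n|]; first by apply: closure_in; exact: HI.
by apply: converges_add; exact: conv_cmp.
Qed.
End Closure.

Theorem mainTheorem20 (X : CBanach) (J I : (X -> X) -> Prop) :
  jordan_algebra_compact J ->
  jordan_ideal J I ->
  (exists b, I b /\ exists x, b x <> vzero) ->
  (forall b, I b -> volterra b) ->
  reducible J.
Proof.
move=> [[J0 [Ja Js]] [Jc Jj]] [[I0 [Ia Is]] [IJ IJj]] [b [Ib [x0 bx0]]] IV; apply: NNPP => Hred.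
(* Elements of J are compact, hence bounded, so nothing is lost in passing to bundled operators. *)
pose JB (a : Bop X) := J a; pose IB (a : Bop X) := I a.
have HI : irr JB.
  move=> M HM HJ; apply: NNPP => H; apply: Hred; exists M; split; first exact: HM. split.
    by apply: NNPP => K; apply: H; left=> x Mx; apply: NNPP => x1; apply: K; exists x.
  split; first by apply: NNPP => K; apply: H; right=> x; apply: NNPP => Mx; apply: K; exists x.
  by move=> a x Ha Mx; apply: (HJ (mkBop (proj1 (Jc a Ha)))).
have JZ (c : C) (a : Bop X) : JB a -> JB (c *v a) by exact: Js.
have JJ (a a' : Bop X) : JB a -> JB a' -> JB (jp a a') by exact: Jj.
have JC (a : Bop X) : JB a -> compact_op a by exact: Jc.
have IJB (a a' : Bop X) : JB a -> IB a' -> IB (jp a a') by exact: IJj.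
set W := closure IB.
have HW : closed_subspace W.
  apply: closure_closed; split; first exact: I0.
  by split; [move=> S T; exact: Ia|move=> c T; exact: Is].
have WJ (a T : Bop X) : JB a -> W T -> W (jp a T).
  by move=> Ha WT; apply: (@closure_jp X IB JB IJB (fun _ => a)) => //; exact: converges_const.
have WW (S T : Bop X) : W S -> W T -> W (jp S T).
  move=> /closure_seq [u [Iu Hu]] WT; apply: (@closure_jp X IB JB IJB u) => // n; exact: (IJ _ (Iu n)).
have Wgz (T : Bop X) : W T -> gz T.
  move=> /closure_seq [u [Iu Hu]]; apply: qn_gz; apply: (qn_limit _ Hu) => [n|].
    by apply: quasinilpotent_qn; exact: (proj2 (IV _ (Iu n))).
  by apply: (compact_limit _ Hu) => n; exact: (proj1 (IV _ (Iu n))).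
pose b' : Bop X := mkBop (proj1 (Jc b (IJ b Ib))).
have b0 : b' <> 0v by move=> E; apply: bx0; have := f_equal (fun A : Bop X => A x0) E.
have Wn : exists T : Bop X, W T /\ T <> 0v by exists b'; split=> //; exact: closure_in.
have Wf := finite_rank_zero HI WJ WW Wgz.
(* If J were irreducible, [turovskii] would make all its elements zero, including [b']. *)
apply: b0; apply: (turovskii HI JC JZ) => [w Hw w0|]; last exact: (IJ _ Ib).
exact: (words_qn HI JC JZ JJ HW WJ WW Wgz Wn Wf Hw w0).
Qed.
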